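(* Let $p$ be a prime and let $D$ be a non-soluble Demushkin pro-$p$ group. Then $D$ has full Hausdorff spectrum $\mathrm{hspec}^{\mathcal{Z}}(D) = [0,1]$ with respect to the Zassenhaus series $\mathcal{Z}$ of $D$.
   Context: Subgroups of pro-$p$ groups are understood to be closed and generation is topological. A Demushkin pro-$p$ group is a Poincaré duality pro-$p$ group of dimension $2$ (i.e. a pro-$p$ group $D$ of cohomological dimension $2$ with $H^1(D,\mathbb{F}_p)$ finite, $\dim_{\mathbb{F}_p} H^2(D,\mathbb{F}_p)=1$, and non-degenerate cup product $H^1(D,\mathbb{F}_p)\times H^1(D,\mathbb{F}_p)\to H^2(D,\mathbb{F}_p)$). A filtration of a finitely generated infinite pro-$p$ group $G$ is a descending chain $\mathcal{S}\colon G_i$ of open normal subgroups with trivial intersection (indexed by $i\in\mathbb{N}_0$ or $i\in\mathbb{N}$). The Hausdorff dimension of a closed subgroup $H\le G$ with respect to $\mathcal{S}$ is $$\mathrm{hdim}_G^{\mathcal{S}}(H) = \liminf_{i\to\infty} \frac{\log_p |HG_i:G_i|}{\log_p |G:G_i|},$$ and the Hausdorff spectrum is $\mathrm{hspec}^{\mathcal{S}}(G) = \{\mathrm{hdim}_G^{\mathcal{S}}(H) \mid H \le G \text{ a closed subgroup}\}$. The Zassenhaus series $\mathcal{Z}\colon Z_i(G)$, $i\in\mathbb{N}$, is defined by $Z_1(G)=G$ and $Z_i(G) = Z_{\lceil i/p\rceil}(G)^p \prod_{1\le j<i}[Z_j(G),Z_{i-j}(G)]$ for $i\ge2$. *)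

(* Defs.v *)
From HB Require Import structures.
From mathcomp Require Import all_boot all_order all_algebra.
From mathcomp Require Import finmap zify.
From mathcomp Require Import all_classical all_reals all_analysis.

Set Implicit Arguments.
Unset Strict Implicit.
Unset Printing Implicit Defensive.

Import Order.TTheory GRing.Theory Num.Theory.

Local Open Scope classical_set_scope.
Local Open Scope group_scope.

HB.mixin Record isTopologicalGroup G of Topological G & Group G := {
  mulg_continuous : continuous (fun z : G * G => z.1 * z.2);
  invg_continuous : continuous (fun x : G => x^-1)
}.

#[short(type="topologicalGroupType")]
HB.structure Definition TopologicalGroup :=
  {G of Topological G & Group G & isTopologicalGroup G}.

Definition subgroup (G : groupType) (H : set G) : Prop :=
  H 1 /\ forall x y, H x -> H y -> H (x / y).

Definition normal_subgroup (G : groupType) (N : set G) : Prop :=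
  subgroup N /\ forall x g, N x -> N (x ^ g).

Definition closed_subgroup (G : topologicalGroupType) (H : set G) : Prop :=
  subgroup H /\ closed H.

Definition closed_generated (G : topologicalGroupType) (X : set G) : set G :=
  \bigcap_(H in [set H : set G | closed_subgroup H /\ X `<=` H]) H.

Definition prodset (G : groupType) (A B : set G) : set G :=
  [set z | exists2 x, A x & exists2 y, B y & z = x * y].

Definition left_coset (G : groupType) (x : G) (U : set G) : set G :=
  [set x * u | u in U].

(* The index |A : U|.  It has the junk value 0 when there are infinitely many
   cosets, which never happens for an open subgroup U of a compact group. *)
Definition index (G : groupType) (A U : set G) : nat :=
  #|` fset_set [set left_coset x U | x in A] |.

Definition pro_p_group (p : nat) (G : topologicalGroupType) : Prop :=
  [/\ compact [set: G], hausdorff_space G, totally_disconnected [set: G] &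
      forall U : set G, open U -> normal_subgroup U ->
        exists n : nat, index [set: G] U = (p ^ n)%N].

Definition closed_commg (G : topologicalGroupType) (A B : set G) : set G :=
  closed_generated [set z | exists2 x, A x & exists2 y, B y & z = [~ x, y]].

Definition closed_powg (G : topologicalGroupType) (p : nat) (A : set G) :
    set G :=
  closed_generated [set x ^+ p | x in A].

Fixpoint derived (G : topologicalGroupType) (n : nat) : set G :=
  if n is m.+1 then closed_commg (derived m) (derived m) else [set: G].
Arguments derived : clear implicits.

Definition soluble (G : topologicalGroupType) : Prop :=
  exists n, derived G n = [set 1].

Definition ceil_div (i p : nat) : nat := ((i + p.-1) %/ p)%N.

(* The recursion decreases the index whenever 1 < p and 1 < i, so that [i]
   units of fuel suffice; see [zassenhausE] below. *)
Fixpoint zassenhaus_fuel (G : topologicalGroupType) (p fuel i : nat) : set G :=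
  if fuel is k.+1 then
    if (i <= 1)%N then [set: G] else
    prodset (closed_powg p (zassenhaus_fuel p k (ceil_div i p)))
      (\big[@prodset G/[set 1]]_(1 <= j < i)
         closed_commg (zassenhaus_fuel p k j) (zassenhaus_fuel p k (i - j)))
  else [set: G].
Arguments zassenhaus_fuel : clear implicits.

(* The index 0 is not used; it has the junk value G. *)
Definition zassenhaus (G : topologicalGroupType) (p i : nat) : set G :=
  zassenhaus_fuel G p i i.
Arguments zassenhaus : clear implicits.

Lemma zassenhaus1 (G : topologicalGroupType) (p : nat) :
  zassenhaus G p 1 = [set: G].
Proof. by []. Qed.

Lemma ceil_div_lt (i p : nat) : (1 < p)%N -> (1 < i)%N -> (ceil_div i p < i)%N.
Proof.
case: p => [|[|p]] // _ i1; rewrite /ceil_div /= ltn_divLR //.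
case: i i1 => [|[|i]] // _.
by rewrite !mulnS !mulSn; lia.
Qed.

Lemma zassenhaus_fuelE (G : topologicalGroupType) (p k i : nat) :
  (1 < p)%N -> (i <= k)%N -> zassenhaus_fuel G p k i = zassenhaus G p i.
Proof.
move=> p1; rewrite /zassenhaus.
elim/ltn_ind: i k => -[|i] IH [|k] //= ik.
case: ifPn => //; rewrite -ltnNge => i1.
have E j : (j < i.+1)%N ->
    zassenhaus_fuel G p k j = zassenhaus_fuel G p i j.
  by move=> ji; rewrite !(IH j) //; lia.
rewrite E ?ceil_div_lt //; congr (prodset _ _).
apply: eq_big_nat => j /andP[j0 ji]; rewrite !E //; lia.
Qed.

Lemma zassenhausE (G : topologicalGroupType) (p i : nat) :
  (1 < p)%N -> (1 < i)%N ->
  zassenhaus G p i =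
  prodset (closed_powg p (zassenhaus G p (ceil_div i p)))
    (\big[@prodset G/[set 1]]_(1 <= j < i)
       closed_commg (zassenhaus G p j) (zassenhaus G p (i - j))).
Proof.
move=> p1; case: i => // i i1; rewrite {1}/zassenhaus /= leqNgt i1 /=.
have := ceil_div_lt p1 i1 => ci.
rewrite zassenhaus_fuelE //; congr (prodset _ _).
by apply: eq_big_nat => j /andP[j0 ji]; rewrite !zassenhaus_fuelE //; lia.
Qed.

Definition logb (R : realType) (p n : nat) : R := (ln n%:R / ln p%:R)%R.

Definition hdim (R : realType) (p : nat) (G : topologicalGroupType)
    (S : nat -> set G) (H : set G) : \bar R :=
  limn_einf (fun i =>
    (logb R p (index (prodset H (S i)) (S i)) /
     logb R p (index [set: G] (S i)))%R%:E).

Definition hspec (R : realType) (p : nat) (G : topologicalGroupType)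
    (S : nat -> set G) : set (\bar R) :=
  [set hdim R p S H | H in @closed_subgroup G].
Arguments hspec R p {G} S.

Definition cochain (G : Type) (A : Type) (n : nat) : Type := ('I_n -> G) -> A.

(* Continuity for the product topology on G^n and the discrete topology on
   A. *)
Definition continuous_cochain (G : topologicalGroupType) (A : Type) (n : nat)
    (f : cochain G A n) : Prop :=
  forall a : A, open [set x : prod_topology (fun _ : 'I_n => G) | f x = a].

Record discrete_module (G : topologicalGroupType) (A : zmodType)
    (act : G -> A -> A) : Prop := DiscreteModule {
  act1 : forall a, act 1 a = a;
  actM : forall g h a, act (g * h) a = act g (act h a);
  actD : forall g a b, act g (a + b)%R = (act g a + act g b)%R;
  act_stab_open : forall a, open [set g | act g a = a]
}.

Definition torsion (A : zmodType) : Prop :=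
  forall a : A, exists2 n : nat, (0 < n)%N & (a *+ n)%R = 0%R.

(* (x_0, ..., x_n) |-> (x_0, ..., x_i x_(i+1), ..., x_n) *)
Definition inner_face (G : groupType) (n : nat) (i : 'I_n)
    (x : 'I_n.+1 -> G) (j : 'I_n) : G :=
  if (j < i)%N then x (widen_ord (leqnSn n) j)
  else if j == i then x (widen_ord (leqnSn n) j) * x (lift ord0 j)
  else x (lift ord0 j).

Definition differential (G : groupType) (A : zmodType) (act : G -> A -> A)
    (n : nat) (f : cochain G A n) : cochain G A n.+1 :=
  fun x =>
    (act (x ord0) (f (fun j => x (lift ord0 j)))
     + \sum_(i < n) f (inner_face i x) *~ (-1) ^+ i.+1
     + f (fun j => x (widen_ord (leqnSn n) j)) *~ (-1) ^+ n.+1)%R.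

Definition cocycle (G : topologicalGroupType) (A : zmodType)
    (act : G -> A -> A) (n : nat) (f : cochain G A n) : Prop :=
  continuous_cochain f /\ forall x, differential act f x = 0%R.

Definition coboundary (G : topologicalGroupType) (A : zmodType)
    (act : G -> A -> A) (n : nat) : cochain G A n -> Prop :=
  if n is m.+1 return cochain G A n -> Prop then
    fun f => exists2 e : cochain G A m,
      continuous_cochain e & forall x, f x = differential act e x
  else fun f => forall x, f x = 0%R.

(* H^n(G, A), as the set of cosets of the coboundaries in the cocycles. *)
Definition cohomology (G : topologicalGroupType) (A : zmodType)
    (act : G -> A -> A) (n : nat) : set (set (cochain G A n)) :=
  [set [set h | cocycle act h /\ coboundary act (h \- f)%R] |
     f in [set f | cocycle act f]].
Arguments cohomology {G A} act n.

Definition cohomology_trivial (G : topologicalGroupType) (A : zmodType)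
    (act : G -> A -> A) (n : nat) : Prop :=
  forall f : cochain G A n, cocycle act f -> coboundary act f.

(* For a pro-p group G, cd(G) = cd_p(G). *)
Definition cohom_dim_le (G : topologicalGroupType) (n : nat) : Prop :=
  forall (A : zmodType) (act : G -> A -> A),
    discrete_module act -> torsion A ->
    forall m : nat, (n < m)%N -> cohomology_trivial act m.

Definition cohom_dim (G : topologicalGroupType) (n : nat) : Prop :=
  cohom_dim_le G n /\ forall m : nat, cohom_dim_le G m -> (n <= m)%N.

Definition trivial_act (G A : Type) : G -> A -> A := fun=> id.
Arguments trivial_act : clear implicits.

Definition cocycleFp (p : nat) (G : topologicalGroupType) (n : nat)
    (f : cochain G 'F_p n) : Prop :=
  cocycle (trivial_act G 'F_p) f.

Definition coboundaryFp (p : nat) (G : topologicalGroupType) (n : nat)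
    (f : cochain G 'F_p n) : Prop :=
  coboundary (trivial_act G 'F_p) f.

(* The vector space H^n(G, F_p) has a basis with d elements, namely the classes
   of the cocycles b i. *)
Definition dim_cohomologyFp (p : nat) (G : topologicalGroupType)
    (n d : nat) : Prop :=
  exists2 b : 'I_d -> cochain G 'F_p n, (forall i, cocycleFp (b i)) &
    forall f : cochain G 'F_p n, cocycleFp f ->
      exists! c : {ffun 'I_d -> 'F_p},
        coboundaryFp (fun x => f x - \sum_(i < d) c i * b i x)%R.

Definition cup (p : nat) (G : Type) (m n : nat)
    (f : cochain G 'F_p m) (g : cochain G 'F_p n) : cochain G 'F_p (m + n) :=
  fun x => (f (fun i => x (lshift n i)) * g (fun j => x (rshift m j)))%R.

(* Non-degeneracy of H^1 x H^1 -> H^2, tested on representatives. *)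
Definition cup_nondegenerate (p : nat) (G : topologicalGroupType) : Prop :=
  (forall f : cochain G 'F_p 1, cocycleFp f ->
     (forall g : cochain G 'F_p 1, cocycleFp g -> coboundaryFp (cup f g)) ->
     coboundaryFp f)
  /\
  (forall g : cochain G 'F_p 1, cocycleFp g ->
     (forall f : cochain G 'F_p 1, cocycleFp f -> coboundaryFp (cup f g)) ->
     coboundaryFp g).

Definition demushkin (p : nat) (D : topologicalGroupType) : Prop :=
  pro_p_group p D /\
  [/\ cohom_dim D 2,
      finite_set (cohomology (trivial_act D 'F_p) 1),
      dim_cohomologyFp p D 2 1 &
      cup_nondegenerate p D].

(* Main.v *)
Require Import Defs.
From HB Require Import structures.
From mathcomp Require Import all_boot all_order all_fingroup all_algebra all_solvable.
From mathcomp Require Import finmap zify ring lra.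
From mathcomp Require Import all_classical all_reals all_analysis.

(** Let [Z n] be the Zassenhaus series, [a n = log_p |D : Z n|] and [d = dim H^1(D, F_p)].  Since [H^2(D, F_p)]
    is a line, [D] has a character onto [Z_p]; let [N] be its kernel and [tau] a lift of a generator.
    Non-degeneracy of the cup product shows that [N] is generated by one element [x2] and by the commutators
    [[x_i, tau, ..., tau]] for [3 <= i <= d], and non-solubility gives [d >= 3].  The finitely generated
    subgroups [F k] of [N] obtained by allowing fewer than [k] letters [tau] have
    [log_p |F k Z n : Z n| = O(t^-n)] with [t] larger than the smaller root [t0] of [1 - d t + t^2], by counting
    words in the group algebra, whereas the Golod-Shafarevich inequality forces the growth rate [1 / t0] for the
    group algebra of [D / Z n], hence for [a n].  So every [F k] has lower density 0, while [N] has density 1 as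
    [D / N Z n] is cyclic of order [O(n)].  For [0 < alpha < 1] one then builds a subgroup of dimension [alpha] by
    successive corrections: each time the density of the current subgroup of some [F k] falls below [alpha], at
    level [m + 1] say, it is enlarged inside [N], modulo [Z m.+1] and without changing its image modulo [Z m],
    to the exact order wanted. *)

Set Implicit Arguments.
Unset Strict Implicit.
Unset Printing Implicit Defensive.

Import Order.TTheory GRing.Theory Num.Theory.

Local Open Scope classical_set_scope.
Local Open Scope group_scope.

(** * Subgroups, topological groups and finite quotients *)

(** The group algebra is mostly handled through its dual: functions of degree below n, which are
    locally constant and factor through a finite quotient. Jennings' ordered monomials enter only as
    a spanning set, once to bound a group order by words and once to bound the space of functions.

    The coincidence behind the two growth rates: with d = r + 3, the generators of N have weights 1
    (for x2) and j + 1 (for the r + 1 families of commutators with j letters tau), so their series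
    is t + (r + 1) t / (1 - t), which equals 1 exactly at t0. Dropping the tail of the families
    moves the radius strictly to the right of t0, so each F k is thin.

    The obstacle in the interpolation is that the subgroup must keep room to be enlarged by any
    order at any level and yet become thin again. Both are secured by working inside N: modulo Z n
    the whole of N is covered by the thin group F n, so an enlargement prescribed modulo Z n can be
    realised inside F n. The target is alpha times the order of the image of N, not of D, because as
    alpha < 1 it then rises per level by no more than the section of N available there. *)

Section AbstractSubgroups.
Variable G : groupType.
Implicit Types (H N U : set G) (x y : G).

Lemma subgroup1 H : subgroup H -> H 1.
Proof. by case. Qed.

Lemma subgroupV H x : subgroup H -> H x -> H x^-1.
Proof. by case=> H1 HD Hx; rewrite -[x^-1]mul1g; exact: HD. Qed.

Lemma subgroupM H x y : subgroup H -> H x -> H y -> H (x * y).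
Proof.
by move=> sH Hx Hy; rewrite -[y]invgK; apply: sH.2 => //; exact: subgroupV.
Qed.

Lemma subgroupVE H x : subgroup H -> H x^-1 = H x.
Proof.
move=> sH; apply/propext; split; last exact: subgroupV.
by move=> /(subgroupV sH); rewrite invgK.
Qed.

Lemma subgroupMr H x y : subgroup H -> H y -> H (x * y) = H x.
Proof.
move=> sH Hy; apply/propext; split=> [Hxy|Hx]; last exact: subgroupM.
by rewrite -(mulgK y x); apply: subgroupM => //; exact: subgroupV.
Qed.

Lemma subgroupMl H x y : subgroup H -> H x -> H (x * y) = H y.
Proof.
move=> sH Hx; apply/propext; split=> [Hxy|Hy]; last exact: subgroupM.
by rewrite -(mulKg x y); apply: subgroupM => //; exact: subgroupV.
Qed.

Lemma subgroupX H x n : subgroup H -> H x -> H (x ^+ n).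
Proof.
move=> sH Hx; elim: n => [|n IH]; first exact: subgroup1.
by rewrite expgS; exact: subgroupM.
Qed.

Lemma subgroupI H K : subgroup H -> subgroup K -> subgroup (H `&` K).
Proof.
move=> [H1 HD] [K1 KD]; split=> // x y [Hx Kx] [Hy Ky].
by split; [exact: HD|exact: KD].
Qed.

Lemma normal_subgroupI H K :
  normal_subgroup H -> normal_subgroup K -> normal_subgroup (H `&` K).
Proof.
move=> [sH nH] [sK nK]; split; first exact: subgroupI.
by move=> x g [Hx Kx]; split; [exact: nH|exact: nK].
Qed.

Lemma subgroupT : subgroup [set: G].
Proof. by []. Qed.

Lemma normal_subgroup1 : normal_subgroup [set (1 : G)].
Proof.
split; first by split=> // x y -> ->; rewrite /= invg1 mulg1.
by move=> x g -> /=; rewrite conj1g.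
Qed.

Lemma normal_conjE U x g : normal_subgroup U -> U (x ^ g) = U x.
Proof.
move=> [_ nU]; apply/propext; split; last exact: nU.
by move=> Uxg; have := nU _ g^-1 Uxg; rewrite conjgK.
Qed.

Lemma normal_subgroupC U x y : normal_subgroup U -> U (x * y) = U (y * x).
Proof. by move=> nU; rewrite -(normal_conjE (x * y) x nU) conjgE -mulgA mulKg. Qed.

Lemma commg_normall U x y : normal_subgroup U -> U x -> U [~ x, y].
Proof.
move=> [sU nU] Ux; rewrite commgEl; apply: subgroupM => //.
  exact: subgroupV.
exact: nU.
Qed.

Lemma commg_normalr U x y : normal_subgroup U -> U y -> U [~ x, y].
Proof.
move=> [sU nU] Uy; rewrite commgEr; apply: subgroupM => //.
by apply: nU; exact: subgroupV.
Qed.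

Lemma subgroup_prodset H N :
  subgroup H -> normal_subgroup N -> subgroup (prodset H N).
Proof.
move=> sH [sN nN]; split.
  exists 1; first exact: subgroup1.
  by exists 1; [exact: subgroup1|rewrite mulg1].
move=> _ _ [h Hh [n Nn ->]] [h' Hh' [n' Nn' ->]].
exists (h * h'^-1); first exact: sH.2.
exists ((n * n'^-1) ^ h'^-1); first by apply: nN; exact: sN.2.
by rewrite conjgE invgK invgM !mulgA mulgKV.
Qed.

Lemma normal_prodset N N' :
  normal_subgroup N -> normal_subgroup N' -> normal_subgroup (prodset N N').
Proof.
move=> nN nN'; split; first by apply: subgroup_prodset => //; exact: nN.1.
move=> _ g [x Nx [y Ny ->]]; exists (x ^ g); first exact: nN.2.
by exists (y ^ g); [exact: nN'.2|rewrite conjMg].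
Qed.

Lemma prodset_subl H N : subgroup N -> H `<=` prodset H N.
Proof.
by move=> sN x Hx; exists x => //; exists 1; [exact: subgroup1|rewrite mulg1].
Qed.

Lemma prodset_subr H N : subgroup H -> N `<=` prodset H N.
Proof.
by move=> sN x Hx; exists 1; [exact: subgroup1|exists x => //; rewrite mul1g].
Qed.

Lemma prodset_sub H N K : subgroup K -> H `<=` K -> N `<=` K ->
  prodset H N `<=` K.
Proof.
by move=> sK HK NK _ [x Hx [y Ny ->]]; apply: subgroupM => //; [exact: HK|exact: NK].
Qed.

Lemma prodsetS H H' N N' : H `<=` H' -> N `<=` N' -> prodset H N `<=` prodset H' N'.
Proof.
by move=> HH NN _ [x Hx [y Ny ->]]; exists x; [exact: HH|exists y; [exact: NN|]].
Qed.

End AbstractSubgroups.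

(* Continuity for the discrete topology on A. *)
Definition dcont (T : topologicalType) (A : Type) (f : T -> A) : Prop :=
  forall a, open [set x | f x = a].

Definition open_normal (G : topologicalGroupType) (U : set G) : Prop :=
  open U /\ normal_subgroup U.

Definition locally_constant (G : topologicalGroupType) (A : Type) (f : G -> A) :=
  exists2 U, open_normal U & forall x u, U u -> f (x * u) = f x.

Section TopGroup.
Variable G : topologicalGroupType.
Implicit Types (H N U : set G) (x y g : G).

Lemma open_normalI U V : open_normal U -> open_normal V -> open_normal (U `&` V).
Proof. by move=> [? ?] [? ?]; split; [exact: openI|exact: normal_subgroupI]. Qed.

Lemma open_normalT : open_normal [set: G].
Proof. by split; [exact: openT|]. Qed.

Lemma cvgMg (T : Type) (F : set_system T) (FF : Filter F) (f h : T -> G) x y :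
  f @ F --> x -> h @ F --> y -> (fun t => f t * h t) @ F --> x * y.
Proof.
move=> fx hy; apply: (@cvg_comp _ _ _ (fun t => (f t, h t)) (fun z => z.1 * z.2) F
  (nbhs (x, y))); last exact: (@mulg_continuous G (x, y)).
exact: cvg_pair.
Qed.

Lemma continuousMl x : continuous (fun y => x * y).
Proof. by move=> y; apply: cvgMg => //; exact: cvg_cst. Qed.

Lemma continuousJ g : continuous (fun y : G => y ^ g).
Proof.
move=> y; rewrite /conjg; apply: cvgMg; first exact: cvg_cst.
by apply: cvgMg => //; exact: cvg_cst.
Qed.

Lemma open_preim (f : G -> G) U : continuous f -> open U -> open (f @^-1` U).
Proof. by move=> cf; apply: open_comp => x _; exact: cf. Qed.

Lemma closed_preim (f : G -> G) U : continuous f -> closed U -> closed (f @^-1` U).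
Proof. by move=> cf; apply: closed_comp => x _; exact: cf. Qed.

Lemma subgroup_open H : subgroup H -> nbhs 1 H -> open H.
Proof.
move=> sH nH; rewrite openE => x Hx; rewrite /interior.
have /(_ H) := @continuousMl x^-1 x; rewrite mulVg => /(_ nH).
by apply: (@filterS _ (nbhs x)) => y /=; rewrite subgroupMl //; exact: subgroupV.
Qed.

Lemma open_subgroup H K : open H -> subgroup H -> subgroup K -> H `<=` K -> open K.
Proof.
move=> oH sH sK HK; apply: subgroup_open => //.
by apply: filterS HK _; apply: open_nbhs_nbhs; split=> //; exact: subgroup1.
Qed.

Lemma open_subgroup_closed H : open H -> subgroup H -> closed H.
Proof.
move=> oH sH; rewrite -[H]setCK; apply: open_closedC.
rewrite openE => x Hx; rewrite /interior.
have oxH : open ((fun y => x^-1 * y) @^-1` H) by apply: open_preim => //; exact: continuousMl.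
apply: (@filterS _ _ _ ((fun y => x^-1 * y) @^-1` H)).
  move=> y /= Hxy Hy; apply: Hx.
  by rewrite -(subgroupVE _ sH) -(subgroupMr _ sH Hy).
by apply: open_nbhs_nbhs; split=> //=; rewrite mulVg; exact: subgroup1.
Qed.

Hypothesis G_compact : compact [set: G].

(** Translating on both sides makes the stabiliser normal. Continuity at a pair [(x, y)] gives a
    neighbourhood of 1 that works near that pair, and compactness of the square of [G] makes it
    uniform. *)
Lemma dcont_stabilizer (A : Type) (f : G -> A) :
  dcont f -> open_normal [set g | forall x y, f (x * g * y) = f (x * y)].
Proof.
move=> cf; set U := [set g | _].
have nU : normal_subgroup U.
  split; first split.
  - by move=> x y; rewrite mulg1.
  - move=> g h Ug Uh x y /=.
    by rewrite -[LHS]Uh mulgA mulgVK -(Ug x y).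
  move=> g h Ug x y; rewrite conjgE.
  by rewrite !mulgA -(mulgA _ h y) Ug -(mulgA _ h^-1) mulKg.
split=> //; apply: subgroup_open; first exact: nU.1.
have /compact_near_coveringP cGG := compact_setX G_compact G_compact.
have : \forall g \near (1 : G), ([set: G] `*` [set: G]) `<=`
    (fun z => f (z.1 * g * z.2) = f (z.1 * z.2)).
  apply: (cGG G (nbhs 1) (fun g z => f (z.1 * g * z.2) = f (z.1 * z.2))).
  move=> z0 _.
  pose B := [set x | f x = f (z0.1 * z0.2)].
  have nB : nbhs (z0.1 * z0.2) B by apply: open_nbhs_nbhs; split=> //; exact: cf.
  have c11 : (fun w : (G * G) * G => w.1.1) @ (nbhs z0, nbhs (1 : G)) --> z0.1.
    by apply: (cvg_comp _ _ cvg_fst); exact: (@cvg_fst _ _ (nbhs z0.1) (nbhs z0.2)).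
  have c12 : (fun w : (G * G) * G => w.1.2) @ (nbhs z0, nbhs (1 : G)) --> z0.2.
    by apply: (cvg_comp _ _ cvg_fst); exact: (@cvg_snd _ _ (nbhs z0.1) (nbhs z0.2)).
  have c1 : (fun w : (G * G) * G => w.1.1 * w.1.2) @ (nbhs z0, nbhs (1 : G)) --> z0.1 * z0.2.
    exact: cvgMg.
  have c2 : (fun w : (G * G) * G => w.1.1 * w.2 * w.1.2) @ (nbhs z0, nbhs (1 : G)) --> z0.1 * 1 * z0.2.
    by apply: cvgMg => //; apply: cvgMg => //; exact: cvg_snd.
  rewrite mulg1 in c2.
  have fB := @filterI _ (filter_prod (nbhs z0) (nbhs (1 : G))) (filter_prod_filter _ _) _ _ (c1 _ nB) (c2 _ nB).
  apply: (@filterS _ (filter_prod (nbhs z0) (nbhs (1 : G))) _ _ _ _ (fB _ _)).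
  by move=> w [/= -> ->].
by apply: filterS => g Hg x y; apply: (Hg (x, y)).
Qed.

Lemma dcont_locally_constant (A : Type) (f : G -> A) : dcont f -> locally_constant f.
Proof.
move=> /dcont_stabilizer Uf; eexists; first exact: Uf.
by move=> x u /(_ x 1); rewrite !mulg1.
Qed.

End TopGroup.

(** Otherwise the sets [C] minus [O] generate a proper filter, and a cluster point lies in every
    closed [C] but not in [O]. Most later compactness arguments, such as finding a common point of a
    decreasing family, take this form. *)
Lemma compact_directed (T : topologicalType) (B : set (set T)) (O : set T) :
  compact [set: T] -> B !=set0 -> (forall C, B C -> closed C) ->
  (forall C C', B C -> B C' -> exists2 C'', B C'' & C'' `<=` C `&` C') ->
  open O -> \bigcap_(C in B) C `<=` O -> exists2 C, B C & C `<=` O.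
Proof.
move=> cT [C0 BC0] clB dirB oO capO; apply: contrapT => nC.
pose F := filter_from B (fun C => C `\` O).
have FF : ProperFilter F.
  apply: filter_from_proper.
    apply: filter_from_filter; first by exists C0.
    move=> C C' BC BC'; have [C'' BC'' CC''] := dirB _ _ BC BC'.
    by exists C'' => // x [C''x nOx]; have [Cx C'x] := CC'' _ C''x.
  move=> C BC; apply: contrapT => /nonemptyPn CO; apply: nC; exists C => //.
  by move=> x Cx; apply: contrapT => nOx; have : (C `\` O) x by []; rewrite CO.
have [p [_ clp]] : [set: T] `&` cluster F !=set0 by apply: (cT F FF); exact: filterT.
have cl (K : set T) : closed K -> F K -> K p.
  move=> cK FK; rewrite (closure_id K).1 // => U Up.
  exact: clp.
have nOp : (~` O) p.
  by apply: cl; [exact: open_closedC|exists C0 => // x []].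
apply: nOp; apply: capO => C BC; apply: cl; first exact: clB.
by exists C => // x [].
Qed.

(** A relatively clopen [B] in the quasi-component [Q] is separated from the rest of [Q] by an open
    [U] whose closure misses that rest. By compactness some clopen [C] around [x] avoids the
    frontier of [U], so [U] cuts [C] into two clopen pieces, and [Q] lies in the one containing
    [x]. *)
Lemma compact_clopen_component (T : topologicalType) (x : T) :
  hausdorff_space T -> compact [set: T] ->
  connected (\bigcap_(C in [set C : set T | clopen C /\ C x]) C).
Proof.
move=> hT cT; set Q := \bigcap_(C in _) _.
have Qx : Q x by move=> C [].
have cQ : closed Q by apply: closed_bigI => C [[]].
move=> B [b Bb] [V oV BV] [W cW BW].
have cB : closed B by rewrite BW; exact: closedI.
have cQB : closed (Q `\` B).
  rewrite (_ : Q `\` B = Q `&` ~` V); first by apply: closedI => //; exact: open_closedC.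
  by rewrite BV; apply/seteqP; split=> y [Qy nB]; split => // Vy; apply: nB => //; case: Vy.
have [|N NB clN] := compact_normal hT cT cB (_ : set_nbhs B (~` (Q `\` B))).
  move=> y By; apply: open_nbhs_nbhs; split; first exact: closed_openC.
  by move=> [].
pose U := N°; have oU : open U by exact: open_interior.
have BU : B `<=` U by move=> y By; exact: NB.
have clU : closure U `<=` closure N by apply: closureS; exact: interior_subset.
have oV' : open (~` closure U) by apply: closed_openC; exact: closed_closure.
have QU y : Q y -> ~ B y -> (~` closure U) y.
  by move=> Qy nBy /clU /clN; apply.
have [|||||C [[oC cC] Cx] CUV] := @compact_directed _
    [set C : set T | clopen C /\ C x] (U `|` ~` closure U) cT.
- by exists setT; split=> //; exact: clopenT.
- by move=> C [[]].
- move=> C C' [cC Cx] [cC' C'x]; exists (C `&` C') => //.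
  by split=> //; exact: clopenI.
- exact: openU.
- move=> y Qy; have [By|nBy] := pselect (B y); [left; exact: BU|right; exact: QU].
have clCU : clopen (C `&` U).
  split; first exact: openI.
  rewrite (_ : C `&` U = C `&` closure U); first by apply: closedI => //; exact: closed_closure.
  apply/seteqP; split=> y [Cy Uy]; split=> //; first exact: subset_closure.
  by have [] := CUV _ Cy.
have clCV : clopen (C `&` ~` closure U).
  split; first exact: openI.
  rewrite (_ : C `&` _ = C `&` ~` U); first by apply: closedI => //; exact: open_closedC.
  apply/seteqP; split=> y [Cy Uy]; split=> //.
    by move=> Uy'; apply: Uy; exact: subset_closure.
  by have [] := CUV _ Cy.
have [Bx|nBx] := pselect (B x).
  apply/seteqP; split=> y; first by rewrite BV => -[].
  move=> Qy; apply: contrapT => nBy; have [_ Uy] : (C `&` U) y.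
    by apply: Qy; split=> //; split=> //; exact: BU.
  by apply: (QU _ Qy nBy); exact: subset_closure.
have [_] : (C `&` ~` closure U) b.
  by move: Bb; rewrite BV => -[Qb _]; apply: Qb; split=> //; split=> //; exact: QU.
by case; apply: subset_closure; exact: BU.
Qed.

Lemma compact_totally_disconnected_zero_dimensional (T : topologicalType) :
  hausdorff_space T -> compact [set: T] -> totally_disconnected [set: T] ->
  zero_dimensional T.
Proof.
move=> hT cT tT x y xy; apply: contrapT => nU.
have : connected_component [set: T] x y.
  apply: (connected_component_max _ _ (@compact_clopen_component T x hT cT)) => //.
    by move=> C [].
  move=> C [cC Cx]; apply: contrapT => nCy; apply: nU; by exists C.
by rewrite tT // => /= yx; rewrite yx eqxx in xy.
Qed.

(** * Profinite groups *)

Definition profinite (G : topologicalGroupType) : Prop :=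
  [/\ compact [set: G], hausdorff_space G & totally_disconnected [set: G]].

Section Profinite.
Variable G : topologicalGroupType.
Hypothesis G_profinite : profinite G.
Implicit Types (H N U : set G) (x y g : G).

Lemma profinite_compact : compact [set: G]. Proof. by case: G_profinite. Qed.
Local Notation G_compact := profinite_compact.

(** The indicator of a clopen neighbourhood of 1 is stabilised by an open normal subgroup, which is
    contained in that neighbourhood. *)
Lemma open_normal_basis (W : set G) : nbhs 1 W -> exists2 U, open_normal U & U `<=` W.
Proof.
case: G_profinite => cG hG tG W1.
have zG := compact_totally_disconnected_zero_dimensional hG cG tG.
have [C [C1 cC] CW] := zero_dimensional_cvg hG zG cG W1.
pose f x := `[< C x >].
have cf : dcont f.
  case.
    rewrite (_ : [set x | _] = C); first by case: cC.
    by apply/seteqP; split=> x /=; rewrite /f => /asboolP.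
  rewrite (_ : [set x | _] = ~` C); first by apply: closed_openC; case: cC.
  by apply/seteqP; split=> x /=; rewrite /f; [move/asboolPn|move=> ?; apply/asboolPn].
exists [set g | forall x y, f (x * g * y) = f (x * y)].
  exact: dcont_stabilizer.
move=> g /(_ 1 1); rewrite mul1g !mulg1 => fg; apply: CW => /=.
by apply/asboolP; rewrite -/(f g) fg /f; exact/asboolP.
Qed.

Lemma closed_compact H : closed H -> compact H.
Proof. by move=> cH; apply: (subclosed_compact cH G_compact). Qed.

Lemma compact_closedG H : compact H -> closed H.
Proof. by apply: compact_closed; case: G_profinite. Qed.

Lemma closed_prodset H N : closed H -> closed N -> closed (prodset H N).
Proof.
move=> cH cN; apply: compact_closedG.
rewrite (_ : prodset H N = (fun z : G * G => z.1 * z.2) @` (H `*` N)).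
  apply: continuous_compact; last by apply: compact_setX; exact: closed_compact.
  by apply: continuous_subspaceT => z; exact: mulg_continuous.
apply/seteqP; split=> z.
  by move=> [x Hx [y Ny ->]]; exists (x, y).
by move=> [[x y] [/= Hx Ny] <-]; exists x => //; exists y.
Qed.

Lemma closed_subgroup_sep H x : closed H -> ~ H x ->
  exists2 U, open_normal U & ~ prodset H U x.
Proof.
move=> cH nHx.
have : nbhs 1 [set u | ~ H (x * u^-1)].
  have cf : continuous (fun u : G => x * u^-1).
    by move=> u; apply: cvgMg; [exact: cvg_cst|exact: invg_continuous].
  apply: open_nbhs_nbhs; split; last by rewrite /= invg1 mulg1.
  by apply: (@open_comp _ _ (fun u => x * u^-1) (~` H)) => //; exact: closed_openC.
move=> /open_normal_basis [U oU UW]; exists U => //.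
by move=> [h Hh [u Uu xhu]]; apply: (UW u Uu); rewrite xhu mulgK.
Qed.

(** The complements of finite unions of cosets form a directed family of closed sets with empty
    intersection, so one of them is empty. *)
Lemma open_normal_cosets_finite U : open_normal U ->
  finite_set [set left_coset x U | x in [set: G]].
Proof.
move=> [oU nU].
have clc x : closed (~` left_coset x U).
  apply: open_closedC; rewrite (_ : left_coset x U = (fun y => x^-1 * y) @^-1` U).
    by apply: open_preim => //; exact: continuousMl.
  apply/seteqP; split=> [_ [u Uu <-]|y Uy] /=; first by rewrite mulKg.
  by exists (x^-1 * y) => //; rewrite mulVKg.
have [|||||_ [D ->] DU] := @compact_directed _
    [set C | exists D : seq G, C = \bigcap_(x in [set` D]) ~` left_coset x U] set0 G_compact.
- by exists (\bigcap_(x in [set` (nil : seq G)]) ~` left_coset x U), nil.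
- by move=> _ [D ->]; exact: closed_bigI.
- move=> _ _ [D ->] [D' ->].
  exists (\bigcap_(x in [set` (D ++ D')]) ~` left_coset x U); first by exists (D ++ D').
  by move=> y Dy; split=> x xD; apply: Dy; rewrite /= mem_cat xD ?orbT.
- exact: open0.
- move=> x capx; have := capx (~` left_coset x U); apply.
    exists [:: x]; apply/seteqP; split=> y; last by apply; rewrite /= inE.
    by move=> nxy z; rewrite /= inE => /eqP ->.
  by exists 1; [exact: subgroup1 nU.1|rewrite mulg1].
apply: (@sub_finite_set _ _ [set left_coset x U | x in [set` D]]).
  move=> _ [x _ <-]; have [[y Dy [u Uu yux]]|nDx] := pselect (exists2 y, y \in D & left_coset y U x).
    2: by exfalso; apply: (DU x) => y yD yx; apply: nDx; exists y.
  exists y => //.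
  rewrite -yux; apply/seteqP; split=> _ [v Uv <-].
    exists (u^-1 * v); last by rewrite -mulgA mulVKg.
    by apply: subgroupM => //; [exact: nU.1|apply: subgroupV => //; exact: nU.1].
  by exists (u * v); [apply: subgroupM => //; exact: nU.1|rewrite mulgA].
by apply: finite_image; exact: finite_seq.
Qed.

End Profinite.

Lemma left_cosetE (G : groupType) (U : set G) (x y : G) : subgroup U ->
  left_coset x U = left_coset y U <-> U (x^-1 * y).
Proof.
move=> sU; split=> [xy|Uxy].
  have : left_coset y U y by exists 1; [exact: subgroup1|rewrite mulg1].
  by rewrite -xy => -[u Uu <-]; rewrite mulKg.
apply/seteqP; split=> _ [v Uv <-].
  exists ((x^-1 * y)^-1 * v); first by apply: subgroupM => //; exact: subgroupV.
  by rewrite invgM invgK !mulgA mulgV mul1g.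
by exists ((x^-1 * y) * v); [exact: subgroupM|rewrite -!mulgA mulVKg].
Qed.

Record quotient_map (G : groupType) (U : set G) (gT : finGroupType)
    (pi : G -> gT) : Prop := QuotientMap {
  qmM : forall x y, pi (x * y) = pi x * pi y;
  qm_surj : forall y, exists x, pi x = y;
  qm_ker : forall x, (pi x = 1) <-> U x
}.

Section FiniteQuotient.
Variables (G : groupType) (U : set G).
Hypotheses (nU : normal_subgroup U)
  (fU : finite_set [set left_coset x U | x in [set: G]]).

(** The quotient is realised by the permutations that right translations induce on the finite set of
    left cosets, well defined by normality. A product of permutations applies its left factor first,
    so [p] is a morphism. *)
Lemma finite_quotient : exists (gT : finGroupType) (pi : G -> gT), quotient_map U pi.
Proof.
pose T := fset_set [set left_coset x U | x in [set: G]].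
have cT x : left_coset x U \in T by rewrite in_fset_set // inE; exists x.
pose c x : T := [` cT x]%fset.
have cE x y : c x = c y <-> U (x^-1 * y).
  rewrite -left_cosetE; last exact: nU.1.
  by split=> [/(congr1 val)|xy]; last exact: val_inj.
have csurj (t : T) : exists x, c x = t.
  have : val t \in T by exact: valP.
  rewrite in_fset_set // inE => -[x _ xt]; exists x; exact: val_inj.
pose r t := projT1 (cid (csurj t)).
have rK t : c (r t) = t by rewrite /r; case: cid.
pose a g t := c (r t * g).
have aE g x : a g (c x) = c (x * g).
  apply/cE; rewrite invgM -mulgA normal_subgroupC // -!mulgA mulgV mulg1.
  by apply/cE; rewrite rK.
have aI g : injective (a g).
  move=> t t'; rewrite -(rK t) -(rK t') !aE => /cE.
  rewrite invgM -mulgA normal_subgroupC // -!mulgA mulgV mulg1 => ?.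
  exact/cE.
pose p g := perm (@aI g).
have pM g h : p (g * h) = p g * p h.
  by apply/permP => t; rewrite permM !permE -(rK t) !aE mulgA.
have p1 g : p g = 1 <-> U g.
  split=> [pg|Ug].
    have /permP /(_ (c 1)) := pg; rewrite perm1 permE aE mul1g => /esym/cE.
    by rewrite invg1 mul1g.
  apply/permP => t; rewrite perm1 permE -(rK t) aE; apply/esym/cE.
  by rewrite mulKg.
pose Q := [set s : {perm T} | `[< exists g, p g = s >]]%SET.
have QP s : reflect (exists g, p g = s) (s \in Q) by rewrite inE; exact: asboolP.
have gQ : group_set Q.
  apply/group_setP; split; first by apply/QP; exists 1; apply/p1; exact: subgroup1 nU.1.
  move=> s t /QP[g <-] /QP[h <-]; apply/QP; exists (g * h); exact: pM.
pose QG := Group gQ.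
have pQ g : p g \in QG by apply/QP; exists g.
exists [the finGroupType of subg_of QG], (fun g => subg QG (p g)); split.
- by move=> x y; rewrite pM subgM.
- move=> y; have : sgval y \in QG by exact: subgP.
  by move=> /QP[g pg]; exists g; rewrite pg sgvalK.
- move=> x; rewrite -p1; split=> [|->]; last by rewrite -[RHS](sgvalK).
  by move=> /(congr1 sgval); rewrite subgK.
Qed.

End FiniteQuotient.

Section QuotientMap.
Variables (G : groupType) (U : set G) (gT : finGroupType) (pi : G -> gT).
Hypothesis qpi : quotient_map U pi.
Implicit Types (H K : set G) (x y : G).

Lemma qm1 : pi 1 = 1.
Proof. by apply: (@mulgI _ (pi 1)); rewrite -(qmM qpi) !mulg1. Qed.

Lemma qmV x : pi x^-1 = (pi x)^-1.
Proof. by apply: (@mulgI _ (pi x)); rewrite -(qmM qpi) !mulgV qm1. Qed.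

Lemma qmX x n : pi (x ^+ n) = pi x ^+ n.
Proof. by elim: n => [|n IH]; rewrite ?expg0 ?qm1 // !expgS (qmM qpi) IH. Qed.

Lemma qmJ x y : pi (x ^ y) = pi x ^ pi y.
Proof. by rewrite /conjg !(qmM qpi) qmV. Qed.

Lemma qmR x y : pi [~ x, y] = [~ pi x, pi y].
Proof. by rewrite /commg (qmM qpi) qmV qmJ. Qed.

Lemma qm_eq x y : pi x = pi y <-> U (x^-1 * y).
Proof.
rewrite -(qm_ker qpi) (qmM qpi) qmV; split=> [->|]; first by rewrite mulVg.
by move/mulg1_eq; rewrite invgK.
Qed.

Definition qimg H : {set gT} := [set y | `[< exists2 x, H x & pi x = y >]]%SET.

Lemma qimgP H (y : gT) : reflect (exists2 x, H x & pi x = y) (y \in qimg H).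
Proof. by rewrite inE; exact: asboolP. Qed.

Lemma mem_qimg H x : H x -> pi x \in qimg H.
Proof. by move=> Hx; apply/qimgP; exists x. Qed.

Lemma qimgS H K : H `<=` K -> qimg H \subset qimg K.
Proof. by move=> HK; apply/fintype.subsetP => _ /qimgP[x /HK Kx <-]; exact: mem_qimg. Qed.

Lemma qimgT : qimg setT = [set: gT]%SET.
Proof. by apply/setP => y; rewrite !inE; apply/asboolP; case: (qm_surj qpi y) => x; exists x. Qed.

Lemma group_set_qimg H : subgroup H -> group_set (qimg H).
Proof.
move=> sH; apply/group_setP; split.
  by rewrite -qm1; apply: mem_qimg; exact: subgroup1.
move=> _ _ /qimgP[x Hx <-] /qimgP[y Hy <-]; rewrite -(qmM qpi).
by apply: mem_qimg; exact: subgroupM.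
Qed.

Lemma mem_qimgE H x : subgroup H -> (pi x \in qimg H) = `[< prodset H U x >].
Proof.
move=> sH; apply/qimgP/asboolP => [[h Hh /qm_eq Uhx]|[h Hh [u /(qm_ker qpi) Uu ->]]].
  by exists h => //; exists (h^-1 * x) => //; rewrite mulVKg.
by exists h => //; rewrite (qmM qpi) Uu mulg1.
Qed.

Lemma index_qimg H : subgroup U -> subgroup H -> Defs.index (prodset H U) U = #|qimg H|.
Proof.
move=> sU sH; rewrite /Defs.index.
pose f (y : gT) := left_coset (projT1 (cid (qm_surj qpi y))) U.
have fpi x : f (pi x) = left_coset x U.
  by rewrite /f; case: cid => z /= /qm_eq zx; exact/left_cosetE.
have -> : [set left_coset x U | x in prodset H U] = f @` [set` qimg H].
  apply/seteqP; split=> [_ [x HUx <-]|_ [y /= yH <-]].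
    by exists (pi x) => //=; rewrite mem_qimgE //; apply/asboolP.
  have [x pix] := qm_surj qpi y; exists x; last by rewrite -fpi pix.
  by apply/asboolP; rewrite -mem_qimgE // pix.
have fI : injective f.
  move=> y y'; have [x <-] := qm_surj qpi y; have [x' <-] := qm_surj qpi y'.
  by rewrite !fpi => /left_cosetE-/(_ sU) ?; apply/qm_eq.
rewrite (_ : f @` [set` qimg H] = [set` [fset f y | y in enum (qimg H)]%fset]); last first.
  apply/seteqP; split=> [_ [y yH <-]|z /= /imfsetP[y /= yH ->]].
    by apply/imfsetP; exists y => //=; rewrite mem_enum.
  by exists y => //=; rewrite mem_enum in yH.
by rewrite set_fsetK card_imfset //= undup_id ?enum_uniq // -cardE.
Qed.

End QuotientMap.

(** * The Zassenhaus series *)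

Section ClosedGenerated.
Variable G : topologicalGroupType.
Implicit Types (H N U X : set G) (x y g : G).

Lemma closed_generated_closed_subgroup X : closed_subgroup (closed_generated X).
Proof.
split; last by apply: closed_bigI => H [[]].
split=> [H [[[]]]//|x y Hx Hy H XH]; have [[sH _] _] := XH.
by apply: sH.2; [exact: Hx|exact: Hy].
Qed.

Lemma sub_closed_generated X : X `<=` closed_generated X.
Proof. by move=> x Xx H [_]; apply. Qed.

Lemma closed_generated_min X H :
  closed_subgroup H -> X `<=` H -> closed_generated X `<=` H.
Proof. by move=> cH XH x; apply. Qed.

Lemma closed_generated_normal X :
  (forall x g, X x -> X (x ^ g)) -> normal_subgroup (closed_generated X).
Proof.
move=> XJ; split; first exact: (closed_generated_closed_subgroup X).1.
move=> x g; have [sX cX] := closed_generated_closed_subgroup X.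
suff : closed_generated X `<=` [set y | closed_generated X (y ^ g)] by apply.
apply: closed_generated_min.
  split; last by apply: closed_preim => //; exact: continuousJ.
  split=> [|y z yX zX] /=; first by rewrite conj1g; exact: subgroup1.
  by rewrite conjMg conjVg; exact: sX.2.
by move=> y Xy; apply: sub_closed_generated; exact: XJ.
Qed.

End ClosedGenerated.

Definition closed_normal (G : topologicalGroupType) (N : set G) : Prop :=
  closed N /\ normal_subgroup N.

Section Zassenhaus.
Variables (G : topologicalGroupType) (p : nat).
Hypotheses (G_profinite : profinite G) (p_gt1 : (1 < p)%N).
Local Notation Z := (zassenhaus G p).

Lemma closed_normal_set1 : closed_normal [set (1 : G)].
Proof.
split; last exact: normal_subgroup1.
by apply: accessible_closed_set1; apply: hausdorff_accessible; case: G_profinite.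
Qed.

Lemma closed_normal_prodset (N N' : set G) :
  closed_normal N -> closed_normal N' -> closed_normal (prodset N N').
Proof.
by move=> [? ?] [? ?]; split; [exact: closed_prodset|exact: normal_prodset].
Qed.

Lemma closed_normal_powg (N : set G) : closed_normal N -> closed_normal (closed_powg p N).
Proof.
move=> [cN nN]; split; first exact: (closed_generated_closed_subgroup _).2.
apply: closed_generated_normal => _ g [x Nx <-]; exists (x ^ g); first exact: nN.2.
by rewrite conjXg.
Qed.

Lemma closed_normal_commg (N N' : set G) :
  closed_normal N -> closed_normal N' -> closed_normal (closed_commg N N').
Proof.
move=> [_ nN] [_ nN']; split; first exact: (closed_generated_closed_subgroup _).2.
apply: closed_generated_normal => _ g [x Nx [y Ny ->]].
by exists (x ^ g); [exact: nN.2|exists (y ^ g); [exact: nN'.2|rewrite conjRg]].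
Qed.

Lemma zassenhaus_closed_normal i : closed_normal (Z i).
Proof.
elim/ltn_ind: i => i IH; have [i1|i1] := leqP i 1.
  by case: i i1 {IH} => [|[|]] // _; split => //; exact: closedT.
rewrite zassenhausE //; apply: closed_normal_prodset.
  by apply: closed_normal_powg; apply: IH; exact: ceil_div_lt.
rewrite big_nat; apply: big_ind; first exact: closed_normal_set1.
  exact: closed_normal_prodset.
by move=> j ji; apply: closed_normal_commg; apply: IH; lia.
Qed.

Lemma zassenhaus_subgroup i : subgroup (Z i).
Proof. by have [_ []] := zassenhaus_closed_normal i. Qed.

Lemma zassenhaus_normal i : normal_subgroup (Z i).
Proof. by have [_] := zassenhaus_closed_normal i. Qed.

Lemma zassenhaus_closed i : closed (Z i).
Proof. by have [] := zassenhaus_closed_normal i. Qed.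

Lemma big_prodset_sup (s : seq nat) (N : nat -> set G) j :
  (forall i, i \in s -> subgroup (N i)) -> j \in s ->
  N j `<=` \big[@prodset G/[set 1]]_(i <- s) N i.
Proof.
elim: s => // i s IH sN; rewrite inE big_cons => /orP[/eqP ->|js] x Nx.
  exists x => //; exists 1; last by rewrite mulg1.
  elim: (s) sN => [|k r IHr] sN; first by rewrite big_nil.
  rewrite big_cons; exists 1; first by apply: subgroup1; apply: sN; rewrite !inE eqxx orbT.
  exists 1; last by rewrite mulg1.
  by apply: IHr => l lr; apply: sN; move: lr; rewrite !inE => /orP[->|->]; rewrite ?orbT.
exists 1; first by apply: subgroup1; apply: sN; rewrite inE eqxx.
exists x; last by rewrite mul1g.
by apply: IH => // k ks; apply: sN; rewrite inE ks orbT.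
Qed.

Lemma zassenhaus_commg i j x y : (0 < i)%N -> (0 < j)%N ->
  Z i x -> Z j y -> Z (i + j) [~ x, y].
Proof.
move=> i0 j0 Zx Zy; rewrite zassenhausE //; last lia.
apply: prodset_subr.
  exact: (closed_generated_closed_subgroup _).1.
apply: (@big_prodset_sup _ (fun k => closed_commg (Z k) (Z (i + j - k))) i).
  by move=> k _; exact: (closed_generated_closed_subgroup _).1.
  by rewrite mem_index_iota; lia.
apply: sub_closed_generated; exists x => //; exists y => //.
by rewrite addKn.
Qed.

Lemma zassenhaus_sub i (K : set G) : (1 < i)%N -> closed_subgroup K ->
  (forall x, Z (ceil_div i p) x -> K (x ^+ p)) ->
  (forall j x y, (0 < j < i)%N -> Z j x -> Z (i - j) y -> K [~ x, y]) ->
  Z i `<=` K.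
Proof.
move=> i1 cK powK comK; rewrite zassenhausE //; apply: prodset_sub; first exact: cK.1.
  by apply: closed_generated_min => // _ [x Zx <-]; exact: powK.
rewrite big_nat; elim/big_ind: _.
- by move=> x ->; exact: subgroup1 cK.1.
- by move=> A B AK BK; apply: prodset_sub => //; exact: cK.1.
move=> j ji; apply: closed_generated_min => // _ [x Zx [y Zy ->]].
exact: (comK j).
Qed.

(** The recursion does not show this. A commutator from [Z 1] and [Z i] stays in [Z i] by normality;
    for the others the first index is lowered by induction. For p-th powers the rounded quotient
    either stays or drops by one. *)
Lemma zassenhausS i : (0 < i)%N -> Z i.+1 `<=` Z i.
Proof.
elim/ltn_ind: i => i IH i0.
apply: zassenhaus_sub; first lia.
- split; [exact: zassenhaus_subgroup|exact: zassenhaus_closed].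
- move=> x Zx; have [i1|i1] := leqP i 1.
    by have -> : i = 1%N by lia.
  rewrite zassenhausE //; apply: prodset_subl.
    suff : closed_normal (\big[@prodset G/[set 1]]_(1 <= j < i)
       closed_commg (Z j) (Z (i - j))) by case=> _ [].
    rewrite big_nat; apply: big_ind; first exact: closed_normal_set1.
      exact: closed_normal_prodset.
    by move=> j ji; apply: closed_normal_commg; exact: zassenhaus_closed_normal.
  apply: sub_closed_generated; exists x => //.
  have [<-//|ne] := eqVneq (ceil_div i.+1 p) (ceil_div i p).
  have ce : ceil_div i.+1 p = (ceil_div i p).+1.
    by move: ne; rewrite /ceil_div addSn divnS ?(ltnW p_gt1) //; case: (_ %| _); rewrite ?eqxx.
  rewrite ce in Zx; apply: IH => //; first exact: ceil_div_lt.
  by rewrite /ceil_div divn_gt0; lia.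
- move=> j x y ji Zx Zy; have [j1|j1] := leqP j 1.
    have -> : i = (i.+1 - j)%N by lia.
    by apply: commg_normalr => //; exact: zassenhaus_normal.
  have -> : (i = j.-1 + (i.+1 - j))%N by lia.
  apply: zassenhaus_commg => //; [lia|lia|].
  by apply: IH; rewrite ?prednK //; lia.
Qed.

Lemma zassenhaus_le i j : (0 < i)%N -> (i <= j)%N -> Z j `<=` Z i.
Proof.
move=> i0; elim: j => [|j IH]; first by case: i i0.
rewrite leq_eqVlt => /orP[/eqP->//|ij]; apply: (subset_trans _ (IH ij)).
by apply: zassenhausS; lia.
Qed.

Lemma zassenhaus_expg i x : (0 < i)%N -> Z i x -> Z (p * i) (x ^+ p).
Proof.
move=> i0 Zx; have pi1 : (1 < p * i)%N by rewrite (leq_trans p_gt1) // leq_pmulr.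
rewrite zassenhausE //; apply: prodset_subl.
  suff : closed_normal (\big[@prodset G/[set 1]]_(1 <= j < p * i)
     closed_commg (Z j) (Z (p * i - j))) by case=> _ [].
  rewrite big_nat; apply: big_ind; first exact: closed_normal_set1.
    exact: closed_normal_prodset.
  by move=> j ji; apply: closed_normal_commg; exact: zassenhaus_closed_normal.
apply: sub_closed_generated; exists x => //.
by rewrite /ceil_div mulnC divnMDl ?divn_small ?addn0 //; lia.
Qed.

Lemma zassenhaus_expg_prime k x : Z (p ^ k) (x ^+ (p ^ k)).
Proof.
elim: k => [|k IH]; first by rewrite expn0 zassenhaus1.
by rewrite expnSr expgnA mulnC; apply: zassenhaus_expg => //; rewrite expn_gt0 ltnW.
Qed.

End Zassenhaus.

(** * Pro-p groups and characters of their subgroups *)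

Section ProP.
Variables (G : topologicalGroupType) (p : nat).
Hypotheses (p_pr : prime p) (G_prop : pro_p_group p G).

Lemma pro_p_profinite : profinite G.
Proof. by case: G_prop. Qed.

Lemma pro_p_quotient (U : set G) : open_normal U ->
  exists (gT : finGroupType) (pi : G -> gT),
    quotient_map U pi /\ p.-group [set: gT]%SET.
Proof.
move=> oU; have [gT [pi qpi]] := finite_quotient oU.2 (open_normal_cosets_finite pro_p_profinite oU).
exists gT, pi; split => //; have [_ _ _ /(_ U oU.1 oU.2)[n idx]] := G_prop.
rewrite /pgroup -(qimgT qpi) -(index_qimg qpi) //; last exact: oU.2.1.
rewrite (_ : prodset setT U = setT) ?idx ?pnatX ?pnat_id //.
by apply/seteqP; split=> // x _; apply: prodset_subl => //; exact: oU.2.1.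
Qed.

(** A maximal subgroup of [K] above [H] is normal of index p; [f] reads off the exponent of a chosen
    generator of the quotient. Its values outside [K] are arbitrary. *)
Lemma pgroup_proper_hom (gT : finGroupType) (H K : {group gT}) :
  p.-group K -> H \proper K ->
  exists f : gT -> 'F_p, [/\ {in K &, forall x y, f (x * y) = (f x + f y)%R},
    {in H, forall x, f x = 0%R} & exists2 x, x \in K & f x != 0%R].
Proof.
move=> pK HK; have [M maxM HM] : {M : {group gT} | maximal M K & H \subset M}.
  by apply: maxgroup_exists.
have nMK : normal M K := p_maximal_normal pK maxM.
have iMK : #|K : M| = p := p_maximal_index pK maxM.
have pKM : prime #|K / M| by rewrite card_quotient ?normal_norm // iMK.
have [y Ky nMy] : exists2 y, y \in K & y \notin M.
  by case/properP: (maxgroupp maxM) => _ [y ? ?]; exists y.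
have nKM := normal_norm nMK.
have yKM : coset M y \in K / M by exact: mem_quotient.
have oy : #[coset M y] = p.
  have := order_dvdG yKM; rewrite card_quotient // iMK => /(primeP p_pr).2 /orP[|/eqP //].
  rewrite order_eq1 => /eqP /coset_idr => /(_ (fintype.subsetP nKM _ Ky)) My.
  by rewrite My in nMy.
have KMy : K / M = <[coset M y]>.
  apply/esym/eqP; rewrite eqEcard cycle_subG yKM /= card_quotient ?normal_norm // iMK.
  by rewrite [X in (_ <= X)%N]oy.
have ex x : exists i, x \in K -> coset M x = coset M y ^+ i.
  have [Kx|] := boolP (x \in K); last by exists 0%N.
  have : coset M x \in <[coset M y]> by rewrite -KMy mem_quotient.
  by case/cycleP => i ->; exists i.
pose e x := projT1 (cid (ex x)).
have eE x : x \in K -> coset M x = coset M y ^+ e x by rewrite /e; case: cid.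
have Fp_mod i j : coset M y ^+ i = coset M y ^+ j -> (i%:R = j%:R :> 'F_p)%R.
  move/eqP; rewrite eq_expg_mod_order oy => /eqP ij.
  by rewrite -(Fp_nat_mod p_pr i) ij Fp_nat_mod.
exists (fun x => (e x)%:R%R); split.
- move=> x x' Kx Kx' /=; rewrite -natrD; apply: Fp_mod.
  rewrite expgD -!eE ?groupM //.
  by rewrite morphM ?(fintype.subsetP nKM).
- move=> x Hx /=; rewrite -[0%R]/(0%:R : 'F_p)%R; apply: Fp_mod.
  have Kx : x \in K by apply: (fintype.subsetP (proper_sub HK)).
  by rewrite -eE // expg0 coset_id // (fintype.subsetP HM).
- exists y => //; apply/eqP => /(congr1 val) /=; rewrite val_Fp_nat // => ey.
  have : coset M y = 1 by rewrite eE // -(expg_mod_order) oy ey expg0.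
  by move/coset_idr => /(_ (fintype.subsetP nKM _ Ky)) My; rewrite My in nMy.
Qed.

(** The Frattini argument by which all generation statements are proved, carried out in a finite
    quotient that separates [F] from a point of [N]. The function lives on [G] but is additive on
    [N] only. *)
Lemma closed_proper_hom (F N : set G) : closed_subgroup F -> subgroup N ->
  F `<=` N -> ~ (N `<=` F) ->
  exists f : G -> 'F_p, [/\ forall x y, N x -> N y -> f (x * y) = (f x + f y)%R,
    forall x, F x -> f x = 0%R, exists2 x, N x & f x != 0%R &
    exists2 U, open_normal U & forall x u, U u -> f (x * u) = f x].
Proof.
move=> [sF cF] sN FN NF.
have [x Nx nFx] : exists2 x, N x & ~ F x.
  by apply: contrapT => nex; apply: NF => x Nx; apply: contrapT => nFx; apply: nex; exists x.
have [U oU nFUx] := closed_subgroup_sep pro_p_profinite cF nFx.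
have [gT [pi [qpi pgT]]] := pro_p_quotient oU.
pose K := Group (group_set_qimg qpi sN); pose H := Group (group_set_qimg qpi sF).
have HK : H \proper K.
  rewrite properE qimgS //=; apply/fintype.subsetPn; exists (pi x); first exact: mem_qimg.
  by rewrite (mem_qimgE qpi) //; apply/asboolPn.
have pK : p.-group K by apply: pgroupS pgT; exact: finset.subsetT.
have [f [fM fH [y Ky fy]]] := pgroup_proper_hom pK HK.
exists (f \o pi); split.
- by move=> a b Na Nb /=; rewrite (qmM qpi) fM //; exact: mem_qimg.
- by move=> a Fa /=; apply: fH; exact: mem_qimg.
- by move/qimgP: Ky => [a Na pia]; exists a => //=; rewrite pia.
- exists U => // a u Uu /=; rewrite (qmM qpi).
  by move/(qm_ker qpi): Uu => ->; rewrite mulg1.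
Qed.

End ProP.

Local Open Scope ring_scope.

(** * Cohomology in degrees 1 and 2 *)

Definition chom (p : nat) (G : topologicalGroupType) (f : G -> 'F_p) : Prop :=
  (forall x y, f (x * y)%g = f x + f y) /\ locally_constant f.

Section LocallyConstant.
Variable G : topologicalGroupType.

Lemma locally_constant2 (A B C : Type) (h : A -> B -> C) (f : G -> A) (g : G -> B) :
  locally_constant f -> locally_constant g -> locally_constant (fun x => h (f x) (g x)).
Proof.
move=> [U oU fU] [V oV gV]; exists (U `&` V); first exact: open_normalI.
by move=> x u [Uu Vu]; rewrite fU // gV.
Qed.

Lemma locally_constant1 (A B : Type) (h : A -> B) (f : G -> A) :
  locally_constant f -> locally_constant (h \o f).
Proof. by move=> [U oU fU]; exists U => // x u Uu /=; rewrite fU. Qed.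

Lemma locally_constant_cst (A : Type) (a : A) : locally_constant (fun _ : G => a).
Proof. by exists setT => //; exact: open_normalT. Qed.

Lemma locally_constantV (A : Type) (f : G -> A) : locally_constant f ->
  locally_constant (fun x => f x^-1%g).
Proof.
move=> [U [oU nU] fU]; exists U => // x u Uu.
have -> : ((x * u)^-1 = x^-1 * (u^-1)^(x^-1))%g by rewrite -conjgC invgM.
by apply: fU; apply: nU.2; apply: subgroupV => //; exact: nU.1.
Qed.

Lemma locally_constantMr (A : Type) (f : G -> A) g : locally_constant f ->
  locally_constant (fun x => f (x * g)%g).
Proof.
move=> [U [oU nU] fU]; exists U => // x u Uu.
by rewrite -mulgA (conjgC u) mulgA [LHS]fU //; apply: nU.2.
Qed.

End LocallyConstant.

Section Cochains.
Variables (p : nat) (G : topologicalGroupType).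
Hypothesis G_profinite : profinite G.

Lemma continuous_diag (n : nat) :
  continuous (fun g : G => (fun _ => g) : prod_topology (fun _ : 'I_n => G)).
Proof.
move=> g; apply/cvg_sup => i A [_ [[B oB <-] Bg] sBA].
by apply: filterS sBA _; apply: open_nbhs_nbhs.
Qed.

Lemma locally_constant_continuous_cochain (A : Type) (n : nat) (f : cochain G A n) (U : set G) :
  open_normal U -> (forall x y, (forall i, U ((x i)^-1 * y i)%g) -> f x = f y) ->
  continuous_cochain f.
Proof.
move=> [oU nU] fU a; rewrite openE => x /= fx; rewrite /interior.
have near_i (i : 'I_n) : nbhs (x : prod_topology (fun _ : 'I_n => G))
    [set y : prod_topology (fun _ : 'I_n => G) | U ((x i)^-1 * y i)%g].
  have oxU : open ((fun y : G => (x i)^-1 * y)%g @^-1` U).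
    by apply: open_preim => //; exact: continuousMl.
  apply: (@proj_continuous _ (fun _ : 'I_n => G) i x ((fun y : G => (x i)^-1 * y)%g @^-1` U)).
  by apply: open_nbhs_nbhs; split=> //=; rewrite mulVg; exact: subgroup1 nU.1.
have near_all := @filter_forall _ _ _ _ (nbhs_filter _) near_i.
by apply: filterS near_all => y /= Uy; rewrite -(fU x y).
Qed.

Lemma ord1_const (g : 'I_1 -> G) : g = (fun _ => g ord0).
Proof. by apply: funext => i; rewrite (ord1 i). Qed.

Lemma coboundary1 (f : cochain G 'F_p 1) : coboundaryFp f -> forall x, f x = 0.
Proof.
move=> [e _ fe] x; rewrite fe /differential /= big_ord0 addr0 /trivial_act.
by rewrite (_ : (fun j : 'I_0 => _) = (fun j : 'I_0 => x (widen_ord (leqnSn 0) j))) ?expr1 ?mulrN1z ?subrr //; apply: funext => -[].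
Qed.

Lemma differential1E (e : cochain G 'F_p 1) (x : 'I_2 -> G) :
  differential (trivial_act G 'F_p) e x =
  e (fun _ => x (lift ord0 ord0)) - e (fun _ => x ord0 * x (lift ord0 ord0))%g
  + e (fun _ => x ord0).
Proof.
rewrite /differential /trivial_act big_ord1 /= expr1 sqrrN expr1n mulr1z mulrN1z.
congr (e _ - e _ + e _); apply: funext => j; rewrite (ord1 j) //.
  rewrite /inner_face /=; congr (x _ * _)%g; exact: val_inj.
by congr (x _); exact: val_inj.
Qed.

Lemma differential2E (a : G -> G -> 'F_p) (x : 'I_3 -> G) :
  let x0 := x ord0 in let x1 := x (lift ord0 ord0) in
  let x2 := x (lift ord0 (lift ord0 ord0)) in
  differential (trivial_act G 'F_p) (fun y : 'I_2 -> G => a (y ord0) (y (lift ord0 ord0))) x =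
  a x1 x2 - a (x0 * x1)%g x2 + a x0 (x1 * x2)%g - a x0 x1.
Proof.
move=> x0 x1 x2; rewrite /differential /trivial_act !big_ord_recl big_ord0 addr0 /= expr1.
rewrite (_ : (-1) ^+ 3 = -1 :> int) // (_ : (-1) ^+ (bump 0 0).+1 = 1 :> int) // mulr1z !mulrN1z.
have E (i j : 'I_3) : val i = val j -> x i = x j by move=> ij; congr (x _); exact: val_inj.
rewrite /inner_face /= /x0 /x1 /x2 addrA.
by congr (_ - a (_ * _)%g _ + a _ (_ * _)%g - a _ _); exact: E.
Qed.

Lemma cocycle1_chom (f : cochain G 'F_p 1) : cocycleFp f -> chom (fun g => f (fun _ => g)).
Proof.
move=> [cf df]; split.
  move=> x y; have := df (fun i : 'I_2 => if i == ord0 then x else y).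
  rewrite differential1E /=.
  by move/eqP; rewrite addrAC subr_eq0 => /eqP <-; rewrite addrC.
apply: dcont_locally_constant => [|a]; first by case: G_profinite.
rewrite (_ : [set x | _] = (fun g : G => (fun _ => g) : prod_topology (fun _ : 'I_1 => G))
  @^-1` [set x | f x = a]) //.
by apply: open_comp => // x _; exact: continuous_diag.
Qed.

Lemma chom_cocycle1 (f : G -> 'F_p) : chom f -> cocycleFp (fun x : 'I_1 -> G => f (x ord0)).
Proof.
move=> [fM [U oU fU]]; split.
  apply: (locally_constant_continuous_cochain oU) => x y Uxy.
  by rewrite -(mulVKg (x ord0) (y ord0)) fU.
by move=> x; rewrite differential1E fM; ring.
Qed.

Lemma cocycle2 (a : G -> G -> 'F_p) (U : set G) : open_normal U ->
  (forall g h u v, U u -> U v -> a (g * u)%g (h * v)%g = a g h) ->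
  (forall g h k, a h k + a g (h * k)%g = a (g * h)%g k + a g h) ->
  cocycleFp (fun x : 'I_2 -> G => a (x ord0) (x (lift ord0 ord0))).
Proof.
move=> oU aU aC; split.
  apply: (locally_constant_continuous_cochain oU) => x y Uxy.
  by rewrite -(mulVKg (x ord0) (y ord0)) -(mulVKg (x (lift ord0 ord0)) (y (lift ord0 ord0))) aU.
move=> x; rewrite differential2E.
have /eqP := aC (x ord0) (x (lift ord0 ord0)) (x (lift ord0 (lift ord0 ord0))).
by rewrite -subr_eq0 => /eqP <-; ring.
Qed.

Lemma coboundary2 (f : cochain G 'F_p 2) : coboundaryFp f <->
  exists2 e : G -> 'F_p, locally_constant e &
    forall x, f x = e (x ord0) + e (x (lift ord0 ord0)) - e (x ord0 * x (lift ord0 ord0))%g.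
Proof.
split.
  move=> [e ce fe]; exists (fun g => e (fun _ => g)).
    apply: dcont_locally_constant => [|a]; first by case: G_profinite.
    rewrite (_ : [set x | _] = (fun g : G => (fun _ => g) : prod_topology (fun _ : 'I_1 => G))
      @^-1` [set x | e x = a]) //.
    by apply: open_comp => // x _; exact: continuous_diag.
  by move=> x; rewrite fe differential1E; ring.
move=> [e [U oU eU] fe]; exists (fun x => e (x ord0)).
  apply: (locally_constant_continuous_cochain oU) => x y Uxy.
  by rewrite -(mulVKg (x ord0) (y ord0)) eU.
by move=> x; rewrite fe differential1E; ring.
Qed.

Definition coboundary_pair (a : G -> G -> 'F_p) : Prop :=
  exists2 e : G -> 'F_p, locally_constant e & forall g h, a g h = e g + e h - e (g * h)%g.

Lemma coboundary_pairP (a : G -> G -> 'F_p) : coboundary_pair a <->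
  coboundaryFp (fun x : 'I_2 -> G => a (x ord0) (x (lift ord0 ord0))).
Proof.
split=> [[e ce ae]|/coboundary2[e ce ae]].
  by apply/coboundary2; exists e.
exists e => // g h.
by have := ae (fun i : 'I_2 => if i == ord0 then g else h).
Qed.

Definition cocycle_pair (a : G -> G -> 'F_p) : Prop :=
  (exists2 U, open_normal U & forall g h u v, U u -> U v -> a (g * u)%g (h * v)%g = a g h) /\
  (forall g h k, a h k + a g (h * k)%g = a (g * h)%g k + a g h).

(** [cls] is the coordinate on the single basis class of H^2. The one-dimensionality is used later
    in this form: proportional coordinates give proportional classes. *)
Lemma cohomology2_dim1 : dim_cohomologyFp p G 2 1 ->
  exists cls : (G -> G -> 'F_p) -> 'F_p,
    forall a b (c : 'F_p), cocycle_pair a -> cocycle_pair b ->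
      cls a = c * cls b -> coboundary_pair (fun x y => a x y - c * b x y).
Proof.
move=> [B _ Bdim].
have ex (a : G -> G -> 'F_p) : exists c : 'F_p, cocycle_pair a ->
    coboundaryFp (fun x : 'I_2 -> G => a (x ord0) (x (lift ord0 ord0)) - c * B ord0 x).
  have [[[U oU aU] aC]|na] := pselect (cocycle_pair a); last by exists 0.
  have [c [ac _]] := Bdim _ (cocycle2 oU aU aC).
  exists (c ord0) => _; move: ac; congr coboundaryFp.
  by apply: funext => x; rewrite big_ord1.
exists (fun a => projT1 (cid (ex a))) => a b c ca cb.
case: cid => /= s /(_ ca) /coboundary2[e ce ae].
case: cid => /= t /(_ cb) /coboundary2[e' ce' be] st.
exists (fun x => e x - c * e' x).
  exact: (locally_constant2 (fun u v => u - c * v)).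
move=> g h; pose x (i : 'I_2) := if i == ord0 then g else h.
have := ae x; have := be x; rewrite /= st.
move/eqP; rewrite subr_eq => /eqP ->; move/eqP; rewrite subr_eq => /eqP ->.
by ring.
Qed.

Lemma cup_pair (f g : G -> 'F_p) : coboundary_pair (fun x y => f x * g y) <->
  coboundaryFp (cup (fun x : 'I_1 -> G => f (x ord0)) (fun x : 'I_1 -> G => g (x ord0))).
Proof.
rewrite coboundary_pairP /cup.
set F := fun x => _; set F' := fun x => _; suff -> : F = F' by [].
by apply: funext => x; rewrite /F /F'; congr (f (x _) * g (x _)); exact: val_inj.
Qed.

Lemma cup_nondegenerate_pair (f : G -> 'F_p) : cup_nondegenerate p G -> chom f ->
  (exists x, f x != 0) -> exists2 g, chom g & ~ coboundary_pair (fun x y => f x * g y).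
Proof.
move=> [nd _] cf [x fx]; apply: contrapT => ng.
have := nd _ (chom_cocycle1 cf); apply: contraPP => _ /(_ _)/coboundary1 f0.
have /f0/(_ (fun _ => x)) /eqP : forall g : cochain G 'F_p 1, cocycleFp g ->
    coboundaryFp (cup (fun x : 'I_1 -> G => f (x ord0)) g).
  move=> g cg; apply: contrapT => ncup; apply: ng.
  exists (fun y => g (fun _ => y)); first exact: cocycle1_chom.
  move=> /cup_pair; set g' := (fun x : 'I_1 -> G => g _).
  by have -> : g' = g by apply: funext => y; rewrite /g' -ord1_const.
by rewrite (negPf fx).
Qed.

(** For the trivial action a coboundary in degree 1 vanishes, so characters embed into H^1. *)
Lemma finite_chom : finite_set (cohomology (trivial_act G 'F_p) 1) ->
  finite_set [set f : G -> 'F_p | chom f].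
Proof.
move=> fH; pose cls (f : G -> 'F_p) := [set h : cochain G 'F_p 1 |
  cocycle (trivial_act G 'F_p) h /\
  coboundary (trivial_act G 'F_p) (h \- (fun x : 'I_1 -> G => f (x ord0)))%R].
have inj : {in [set f | chom f] &, injective cls}.
  move=> f g /set_mem cf _ fg.
  have : cls f (fun x : 'I_1 -> G => f (x ord0)).
    split; first exact: chom_cocycle1.
    exists (fun _ => 0) => [a|x]; last first.
      by rewrite /differential /trivial_act big_ord0 /= !mul0rz !addr0 subrr.
    have [->|a0] := eqVneq a 0.
      rewrite (_ : [set x | _] = setT); first exact: openT.
      by apply/seteqP; split.
    rewrite (_ : [set x | _] = set0); first exact: open0.
    by apply/seteqP; split => y //= /esym/eqP; rewrite (negPf a0).
  rewrite fg => -[_ /coboundary1 fg0]; apply: funext => x; apply/eqP.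
  by rewrite -subr_eq0; apply/eqP; exact: (fg0 (fun _ => x)).
rewrite -(eq_finite_set (inj_card_eq inj)); apply: sub_finite_set fH.
move=> _ [f cf <-]; exists (fun x : 'I_1 -> G => f (x ord0)) => //.
exact: chom_cocycle1.
Qed.

End Cochains.

(** * Jennings bases and words in the group algebra *)

Section Straightening.
Variables (p : nat) (gT : finGroupType) (Gs : nat -> {group gT}).
Hypotheses (p_pr : prime p)
  (Gs_le : forall i j, (0 < i <= j)%N -> Gs j \subset Gs i)
  (Gs_comm : forall i j x y, (0 < i)%N -> (0 < j)%N -> x \in Gs i -> y \in Gs j ->
     [~ x, y]%g \in Gs (i + j)%N)
  (Gs_exp : forall i x, (0 < i)%N -> x \in Gs i -> (x ^+ p)%g \in Gs (p * i)%N).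
Implicit Types (x y g h : gT) (H : {group gT}).

(** One letter of a Jennings basis: [H] is [H'] extended by [y], of weight [w], with index p. By
    [chain_wt] no element of [H] outside [H'] is deeper in the filtration [Gs] than [y]. *)
Record chain_step y w H' H : Prop := ChainStep {
  chain_w : (0 < w)%N;
  chain_y : y \in Gs w;
  chain_H : y \in H;
  chain_sub : H' \subset H;
  chain_comm : forall h, h \in H' -> [~ h, y]%g \in H';
  chain_exp : (y ^+ p)%g \in H';
  chain_dec : forall h, h \in H -> exists i h',
    [/\ (i < p)%N, h' \in H' & h = (y ^+ i * h')%g];
  chain_wt : forall v i h', (0 < i < p)%N -> h' \in H' -> (y ^+ i * h')%g \in Gs v -> (v <= w)%N;
  chain_card : #|H| = (p * #|H'|)%N }.

Inductive chain : seq (gT * nat) -> {group gT} -> Prop :=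
| chain0 : chain [::] 1%G
| chainS y w l H' H : chain l H' -> chain_step y w H' H -> chain ((y, w) :: l) H.

Fixpoint exps (l : seq (gT * nat)) : seq (seq nat) :=
  if l is _ :: l' then [seq i :: e | i <- iota 0 p, e <- exps l'] else [:: [::]].

Fixpoint wt (l : seq (gT * nat)) (e : seq nat) : nat :=
  match l, e with x :: l', i :: e' => i * x.2 + wt l' e' | _, _ => 0 end.

Lemma chain_cardE l H : chain l H -> #|H| = (p ^ size l)%N.
Proof.
elim=> [|y w {}l H' {}H _ IH]; first by rewrite cards1 expn0.
by case=> _ _ _ _ _ _ _ _ ->; rewrite IH expnS.
Qed.

(** The section of [Gs w] by [Gs w.+1] is elementary abelian, since commutators fall into
    [Gs (w + w)] and p-th powers into [Gs (p * w)]. So any element outside [H] adds one factor of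
    order p. *)
Lemma chain_step_exists y w H : (0 < w)%N -> Gs w.+1 \subset H -> H \subset Gs w ->
  y \in Gs w -> y \notin H -> exists2 H2 : {group gT}, chain_step y w H H2 & H2 \subset Gs w.
Proof.
move=> w0 GH HG Gy nHy; pose H2 := (<[y]> <*> H)%G.
have comm h : h \in Gs w -> [~ h, y]%g \in H.
  move=> Gh; apply: (fintype.subsetP GH); apply: (fintype.subsetP (Gs_le _)) (Gs_comm w0 w0 Gh Gy).
  by rewrite /=; lia.
have nHY : y \in ('N(H))%g.
  rewrite inE; apply/fintype.subsetP => _ /imsetP[h Hh ->].
  have hG := fintype.subsetP HG _ Hh.
  by rewrite -(groupMl _ (groupVr Hh)) -commgEl comm.
have yp : (y ^+ p)%g \in H.
  apply: (fintype.subsetP GH); apply: (fintype.subsetP (Gs_le _)) (Gs_exp w0 Gy).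
  by have := prime_gt1 p_pr; rewrite /=; nia.
have oy : #[coset H y]%g = p.
  have dvp : (#[coset H y]%g %| p)%N by rewrite order_dvdn -morphX //; apply/eqP/coset_id.
  have /primeP[_ /(_ _ dvp) /orP[|/eqP//]] := p_pr.
  by rewrite order_eq1 => /eqP /coset_idr => /(_ nHY) Hy; rewrite Hy in nHy.
have nYH : (<[y]> \subset 'N(H))%g by rewrite cycle_subG.
have H2E : H2 = (<[y]> * H)%g :> {set gT} by rewrite /= norm_joinEl.
exists H2; last by rewrite join_subG cycle_subG Gy HG.
split => //.
- by rewrite mem_gen // inE cycle_id.
- exact: joing_subr.
- by move=> h /(fintype.subsetP HG); exact: comm.
- move=> h; rewrite -[h \in _]/(h \in (H2 : {set gT})) H2E => /mulsgP[_ h' /cycleP[k ->] Hh' ->].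
  exists (k %% p)%N, (y ^+ (p * (k %/ p)) * h')%g.
  split; first by rewrite ltn_mod prime_gt0.
    by rewrite groupM // expgnA groupX.
  by rewrite mulgA -expgnDr addnC mulnC -divn_eq.
- move=> v i h' ip Hh' Gv; rewrite leqNgt; apply/negP => wv.
  have : (y ^+ i)%g \in H.
    rewrite -(groupMr _ Hh'); apply: (fintype.subsetP GH).
    by apply: (fintype.subsetP (Gs_le _)) Gv; rewrite /=; lia.
  move/coset_id; rewrite morphX // => /eqP; rewrite -order_dvdn oy => /dvdn_leq.
  by move: ip => /andP[i0 ip] /(_ i0); rewrite leqNgt ip.
- rewrite -(Lagrange (joing_subr <[y]> H)) mulnC -card_quotient; last first.
    by rewrite join_subG nYH normG.
  by rewrite quotientYidr // quotient_cycle // -orderE oy.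
Qed.

Lemma chain_fill w H l : (0 < w)%N -> Gs w.+1 \subset H -> H \subset Gs w -> chain l H ->
  exists2 k, chain (k ++ l) (Gs w) & all (fun x : gT * nat => x.2 == w) k.
Proof.
move=> w0; move mE : (#|Gs w| - #|H|)%N => m.
elim/ltn_ind: m => m IH in H l mE *; move=> GH HG cl.
have [GwH|] := boolP (Gs w \subset H).
  exists nil => //=; have -> // : Gs w = H.
  by apply/val_inj/eqP; rewrite finset.eqEsubset GwH HG.
case/fintype.subsetPn => y Gy nHy.
have [H2 st H2G] := chain_step_exists w0 GH HG Gy nHy.
have HH2 : H \proper H2.
  by apply/properP; split; [exact: chain_sub st|exists y => //; exact: chain_H st].
have lt1 := proper_card HH2; have le2 := subset_leq_card H2G.
have [||k ck ak] := IH _ _ H2 ((y, w) :: l) erefl (fintype.subset_trans GH (proper_sub HH2)) H2G.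
- by rewrite -mE; lia.
- exact: chainS cl st.
exists (k ++ [:: (y, w)]); first by rewrite -catA.
by rewrite all_cat ak /= eqxx.
Qed.

Lemma chain_exists n : Gs n = 1%G -> forall w, (0 < w <= n)%N ->
  exists l, [/\ chain l (Gs w), all (fun x : gT * nat => w <= x.2 < n)%N l &
    forall v, (w <= v <= n)%N -> #|Gs w| = (p ^ count (fun x : gT * nat => x.2 < v)%N l * #|Gs v|)%N].
Proof.
move=> Gn w /andP[w0 wn]; move kE : (n - w)%N => k.
elim: k w w0 wn kE => [|k IH] w w0 wn kE.
  have -> : w = n by lia.
  exists nil; rewrite Gn; split => //; first exact: chain0.
  by move=> v vn; have -> : v = n by [lia]; rewrite Gn mul1n.
have [|||l [cl al ml]] := IH w.+1; [by []|lia|lia|].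
have [|k' ck ak] := chain_fill w0 (subxx _) _ cl; first by apply: Gs_le; rewrite w0 /=.
exists (k' ++ l); split=> //.
  rewrite all_cat; apply/andP; split.
    by apply: sub_all ak => x /eqP ->; rewrite leqnn /=; lia.
  by apply: sub_all al => x; lia.
have szk : #|Gs w| = (p ^ size k' * #|Gs w.+1|)%N.
  by rewrite (chain_cardE ck) (chain_cardE cl) size_cat expnD.
move=> v /andP[wv vn]; rewrite count_cat.
have [vw|wv'] := leqP v w.
  have -> : v = w by lia.
  rewrite (@eq_in_count _ _ pred0) ?count_pred0; last by move=> x /(allP ak)/eqP ->; rewrite ltnn.
  rewrite (@eq_in_count _ _ pred0) ?count_pred0 ?mul1n // => x /(allP al) /=; lia.
rewrite szk (ml v) ?wv' // mulnA -expnD; congr (p ^ (_ + _) * _)%N.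
rewrite (@eq_in_count _ _ predT) ?count_predT // => x /(allP ak)/eqP -> /=.
by rewrite wv'.
Qed.

Lemma size_exps l : size (exps l) = (p ^ size l)%N.
Proof. by elim: l => //= x l IH; rewrite size_allpairs size_iota IH expnS. Qed.

Variables (R : pzRingType) (rho : gT -> R).
Hypotheses (rhoM : forall x y, rho (x * y)%g = rho x * rho y) (rho1 : rho 1%g = 1)
  (R_char : p%:R = 0 :> R).

(** The weight filtration on the image of the group algebra of [H], where [rho g - 1] has weight [w]
    when [g] is in [Gs w]. The inductive form makes sense over any ring and gives the induction used
    for rewriting. *)
Inductive J (H : {group gT}) : nat -> R -> Prop :=
| J0 m : J H m 0
| JD m a b : J H m a -> J H m b -> J H m (a + b)
| JN m a : J H m a -> J H m (- a)
| J1 : J H 0 1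
| JM g w m a : g \in H -> g \in Gs w -> (0 < w)%N -> J H m a -> J H (w + m) ((rho g - 1) * a)
| Jle m m' a : (m' <= m)%N -> J H m a -> J H m' a.

Fixpoint mono (l : seq (gT * nat)) (e : seq nat) : R :=
  match l, e with x :: l', i :: e' => (rho x.1 - 1) ^+ i * mono l' e' | _, _ => 1 end.

Lemma J_mul H m m' a b : J H m a -> J H m' b -> J H (m + m') (a * b).
Proof.
move=> Ja Jb; elim: Ja => {m a}.
- by move=> m; rewrite mul0r; exact: J0.
- by move=> m a c _ IHa _ IHc; rewrite mulrDl; exact: JD.
- by move=> m a _ IH; rewrite mulNr; exact: JN.
- by rewrite mul1r add0n.
- by move=> g w m a Hg Gg w0 _ IH; rewrite -mulrA -addnA; exact: JM.
- by move=> m n a nm _; apply: Jle; rewrite leq_add2r.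
Qed.

Lemma J_gen H g w : g \in H -> g \in Gs w -> (0 < w)%N -> J H w (rho g - 1).
Proof.
by move=> Hg Gg w0; rewrite -[rho g - 1]mulr1 -[w]addn0; apply: JM => //; exact: J1.
Qed.

Lemma J_rho H g : g \in H -> g \in Gs 1 -> J H 0 (rho g).
Proof.
move=> Hg Gg; rewrite -(subrK 1 (rho g)); apply: JD; last exact: J1.
by apply: Jle (J_gen Hg Gg _).
Qed.

(** The inner binomial coefficients vanish in characteristic p. The sign of the last term is also
    right for p = 2, where -1 = 1. *)
Lemma Frobenius_rho y : (rho y - 1) ^+ p = rho (y ^+ p)%g - 1.
Proof.
have rhoX n : rho (y ^+ n)%g = rho y ^+ n.
  by elim: n => [|n IH]; rewrite ?expg0 ?expr0 // expgS rhoM IH exprS.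
rewrite rhoX exprBn_comm; last exact: commr1.
have [q pq] : exists q, p = q.+1 by case: (p) p_pr => // q _; exists q.
rewrite [in RHS]pq [in LHS]pq big_ord_recl big_ord_recr /= -pq.
rewrite big1 => [|i _]; last first.
  rewrite /bump /= add1n.
  have /dvdnP[k ->] : (p %| 'C(p, i.+1))%N by apply: prime_dvd_bin => //; rewrite /= pq ltnS ltn_ord.
  by rewrite mulrnA -(mulr_natr (_ *+ k)) R_char mulr0.
rewrite bin0 !expr0 mul1r subn0 mulr1 mulr1n add0r /bump /= add1n -pq binn subnn.
rewrite expr0 !mulr1 expr1n mulr1 mulr1n; congr (_ + _).
have [p2|p_odd] := even_prime p_pr; last by rewrite -signr_odd p_odd expr1.
by rewrite p2 sqrrN expr1n; apply/eqP; rewrite -subr_eq0 opprK -[X in X == _]/(2%:R) -p2 R_char.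
Qed.

Section Step.
Variables (y : gT) (w : nat) (H' H : {group gT}).
Hypothesis (st : chain_step y w H' H).
Local Notation Y := (rho y - 1).

(** Normal form at the outermost letter: powers of [Y] below p on the left, coefficients from [H']
    carrying the weight that [Y ^+ i] leaves over. Truncated subtraction asks only weight 0 once
    [i * w] reaches [m]. *)
Definition Jst m a := exists2 c : nat -> R, forall i, J H' (m - i * w) (c i) &
  a = \sum_(i < p) Y ^+ i * c i.

Lemma Jst_le m n a : (m <= n)%N -> Jst n a -> Jst m a.
Proof.
move=> mn [c cJ ->]; exists c => // i; apply: Jle (cJ i); exact: leq_sub2r.
Qed.

Lemma Jst0 m : Jst m 0.
Proof.
exists (fun _ => 0) => [i|]; first exact: J0.
by rewrite big1 // => i _; rewrite mulr0.
Qed.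

Lemma JstD m a b : Jst m a -> Jst m b -> Jst m (a + b).
Proof.
move=> [c cJ ->] [d dJ ->]; exists (fun i => c i + d i) => [i|]; first exact: JD.
by rewrite -big_split; apply: eq_bigr => i _; rewrite mulrDr.
Qed.

Lemma JstN m a : Jst m a -> Jst m (- a).
Proof.
move=> [c cJ ->]; exists (fun i => - c i) => [i|]; first exact: JN.
by rewrite -sumrN; apply: eq_bigr => i _; rewrite mulrN.
Qed.

Lemma Jst_J m a : J H' m a -> Jst m a.
Proof.
move=> Ja; exists (fun i => if i == 0%N then a else 0) => [i|].
  by case: eqP => [->|_]; [rewrite mul0n subn0|exact: J0].
case: (p) p_pr => // q _; rewrite big_ord_recl /= mul1r big1 ?addr0 // => i _.
by rewrite mulr0.
Qed.

Lemma Jst_Y m a : Jst m a -> Jst (m + w) (Y * a).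
Proof.
move=> [c cJ ->]; have [q pq] : exists q, p = q.+1 by case: (p) p_pr => // q _; exists q.
exists (fun i => if i is k.+1 then c k else (rho (y ^+ p)%g - 1) * c q).
  case=> [|i]; last by apply: Jle (cJ i); rewrite mulSn; lia.
  apply: Jle (JM (chain_exp st) (Gs_exp (chain_w st) (chain_y st)) _ (cJ q)).
    by rewrite pq mulSn; lia.
  by rewrite muln_gt0 prime_gt0 // (chain_w st).
rewrite -Frobenius_rho mulr_sumr [in LHS]pq [in RHS]pq big_ord_recr big_ord_recl /= -pq.
rewrite expr0 mul1r addrC; congr (_ + _); first by rewrite mulrA -exprS -pq.
by apply: eq_bigr => i _; rewrite /bump /= add1n exprS mulrA.
Qed.

Lemma Jst_rhoy m a : Jst m a -> Jst m (rho y * a).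
Proof.
move=> Ra; rewrite -(subrK 1 (rho y)) mulrDl mul1r; apply: JstD => //.
by apply: Jst_le (Jst_Y Ra); exact: leq_addr.
Qed.

Definition cj (a : R) := rho y^-1%g * a * rho y.

(** Moving [Y] to the left past [a] replaces [a] by its conjugate and leaves the error [cj a - a].
    The error gains weight [w] because the conjugate of [g] is [g] times [[~ g, y]], and this
    commutator gains weight [w]. *)
Lemma J_cj m a : J H' m a -> J H' m (cj a) /\ J H' (m + w) (cj a - a).
Proof.
have rVy : rho y^-1%g * rho y = 1 by rewrite -rhoM mulVg.
have ryV : rho y * rho y^-1%g = 1 by rewrite -rhoM mulgV.
elim=> {m a}.
- by move=> m; rewrite /cj mulr0 mul0r subrr; split; exact: J0.
- move=> m a b _ [a1 a2] _ [b1 b2]; rewrite /cj mulrDr mulrDl; split; first exact: JD.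
  by rewrite opprD addrACA; exact: JD.
- move=> m a _ [a1 a2]; rewrite /cj mulrN mulNr; split; first exact: JN.
  by rewrite -opprD; exact: JN.
- by rewrite /cj mulr1 rVy subrr; split; [exact: J1|exact: J0].
- move=> g v m a Hg Gg v0 Ja [a1 a2].
  have Hgy := chain_comm st Hg; have Ggy := Gs_comm v0 (chain_w st) Gg (chain_y st).
  have Egy : (g ^ y = g * [~ g, y])%g by rewrite commgEl mulVKg.
  have Hc : (g ^ y)%g \in H' by rewrite Egy groupM.
  have Gc : (g ^ y)%g \in Gs v.
    rewrite Egy groupM //; apply: (fintype.subsetP (Gs_le _)) Ggy.
    by rewrite v0 leq_addr.
  have Ecj : cj ((rho g - 1) * a) = (rho (g ^ y)%g - 1) * cj a.
    rewrite /cj !mulrA; congr (_ * a * _).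
    rewrite mulrBr mulr1 mulrBl mul1r; congr (_ - _).
    by rewrite conjgE !rhoM -!mulrA ryV mulr1.
  rewrite Ecj; split; first exact: JM.
  have -> : (rho (g ^ y)%g - 1) * cj a - (rho g - 1) * a =
      (rho (g ^ y)%g - 1) * (cj a - a) + rho g * ((rho [~ g, y]%g - 1) * a).
    rewrite mulrBr -addrA; congr (_ + _); rewrite mulrA mulrBr mulr1 -rhoM -Egy.
    by rewrite -!mulNr -mulrDl; congr (_ * a); rewrite !opprB addrA subrK.
  apply: JD; first by rewrite -addnA; exact: JM.
  rewrite -[(v + m + w)%N]add0n; apply: J_mul.
    by apply: J_rho => //; apply: (fintype.subsetP (Gs_le _)) Gg.
  by rewrite addnAC; apply: JM => //; rewrite addn_gt0 v0.
- move=> m n a nm _ [a1 a2]; split; first exact: Jle a1.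
  by apply: Jle a2; rewrite leq_add2r.
Qed.

Lemma Jst_cYe i : forall m n c e, J H' m c -> J H' n e -> Jst (m + n + i * w) (c * Y ^+ i * e).
Proof.
elim: i => [|i IH] m n c e Jc Je.
  by rewrite expr0 mulr1 mul0n addn0; apply: Jst_J; exact: J_mul.
have [c1 c2] := J_cj Jc.
have key : c * Y = Y * cj c + (cj c - c).
  rewrite [Y * cj c]mulrBl mul1r /cj !mulrA -rhoM mulgV rho1 mul1r.
  by rewrite mulrBr mulr1 addrA subrK.
have -> : c * Y ^+ i.+1 * e = Y * (cj c * Y ^+ i * e) + (cj c - c) * Y ^+ i * e.
  by rewrite exprS mulrA key !mulrDl !mulrA.
apply: JstD.
  by apply: Jst_le (Jst_Y (IH _ _ _ _ c1 Je)); rewrite mulSn; lia.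
by apply: Jst_le (IH _ _ _ _ c2 Je); rewrite mulSn; lia.
Qed.

Lemma Jst_mulJ v m c a : J H' v c -> Jst m a -> Jst (v + m) (c * a).
Proof.
move=> Jc [d dJ ->]; rewrite mulr_sumr; elim/big_ind: _ => [||i _].
- exact: Jst0.
- exact: JstD.
by rewrite mulrA; apply: Jst_le (Jst_cYe i Jc (dJ i)); lia.
Qed.

(** A factor [rho g - 1] with [g = y ^+ i * h] is rewritten through [Y] and [rho h - 1]. If i > 0,
    [chain_wt] bounds the weight of [g] by [w]; hence [y] and [h] are as deep as [g] and no weight
    is lost. *)
Lemma J_step m a : J H m a -> Jst m a.
Proof.
elim=> {m a}.
- exact: Jst0.
- by move=> m a b _ Ra _; exact: JstD.
- by move=> m a _; exact: JstN.
- by apply: Jst_J; exact: J1.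
- move=> g v m a Hg Gg v0 _ Ra.
  have [i [h [ip H'h gE]]] := chain_dec st Hg.
  case: i ip gE => [|i] ip gE.
    apply: Jst_mulJ => //; apply: J_gen => //.
    by rewrite gE expg0 mul1g.
  have vw : (v <= w)%N by apply: (chain_wt st (i := i.+1) (h' := h)) => //; rewrite -gE.
  have Gy : y \in Gs v by apply: (fintype.subsetP (Gs_le _)) (chain_y st); rewrite v0.
  have Gh : h \in Gs v.
    have -> : h = ((y ^+ i.+1)^-1 * g)%g by rewrite gE mulKg.
    by rewrite groupM // groupV groupX.
  have rX n : rho (y ^+ n)%g = rho y ^+ n.
    by elim: n => [|n IH]; rewrite ?expg0 ?expr0 // expgS rhoM IH exprS.
  have -> : (rho g - 1) * a = Y * (\sum_(k < i.+1) rho y ^+ k) * (rho h * a) + (rho h - 1) * a.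
    rewrite -subrX1 gE rhoM rX !mulrBl !mul1r mulrA; by rewrite addrA subrK.
  have Rh : Jst m (rho h * a).
    rewrite -[m]add0n; apply: Jst_mulJ => //; apply: J_rho => //.
    by apply: (fintype.subsetP (Gs_le _)) Gh.
  apply: JstD; last by apply: Jst_mulJ => //; exact: J_gen.
  rewrite -mulrA; apply: (@Jst_le _ (m + w)); first by lia.
  apply: Jst_Y; rewrite mulr_suml; elim/big_ind: _ => [||k _].
  - exact: Jst0.
  - exact: JstD.
  by elim: (nat_of_ord k) => [|n IH]; rewrite ?expr0 ?mul1r // exprS -mulrA; exact: Jst_rhoy.
- by move=> m n a nm _; exact: Jst_le.
Qed.

End Step.

Definition add_closed (P : R -> Prop) := [/\ P 0, forall a b, P a -> P b -> P (a + b) &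
  forall a, P a -> P (- a)].

Lemma add_closed_sum P I (s : seq I) (F : I -> R) : add_closed P ->
  (forall i, P (F i)) -> P (\sum_(i <- s) F i).
Proof. by move=> [P0 PD _] PF; elim/big_ind: _. Qed.

Lemma J_trivial m a : J 1%G m a -> (0 < m)%N -> a = 0.
Proof.
elim=> {m a} //.
- by move=> m a b _ IHa _ IHb m0; rewrite IHa // IHb // addr0.
- by move=> m a _ IH m0; rewrite IH // oppr0.
- by move=> g w m a /set1P -> _ _ _ _ _; rewrite rho1 subrr mul0r.
- by move=> m n a nm _ IH n0; apply: IH; exact: leq_trans n0 nm.
Qed.

Lemma J_trivial0 P m a : J 1%G m a -> add_closed P -> P 1 -> P a.
Proof.
move=> Ja [P0 PD PN] P1; elim: Ja => {m a} //.
- by move=> m a b _ Pa _; exact: PD.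
- by move=> m a _; exact: PN.
- by move=> g w m a /set1P -> *; rewrite rho1 subrr mul0r.
Qed.

(** Spanning by ordered monomials is tested on an arbitrary additive predicate [P]; the induction
    along the chain applies it to left multiples by powers of the outermost letter. *)
Lemma straightening l H : chain l H -> forall m a P, J H m a -> add_closed P ->
  (forall e, e \in exps l -> (m <= wt l e)%N -> P (mono l e)) -> P a.
Proof.
elim=> [|y w {}l H' {}H _ IH st] m a P Ja addP Pe.
  case: m Ja Pe => [|m] Ja Pe.
    by apply: J_trivial0 Ja addP _; exact: (Pe [::]).
  by rewrite (J_trivial Ja) //; case: addP.
have [c cJ ->] := J_step st Ja; apply: add_closed_sum => // i.
have [P0 PD PN] := addP.
apply: (IH _ _ (fun b => P ((rho y - 1) ^+ i * b)) (cJ i)).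
  split; first by rewrite mulr0.
  - by move=> b b' Pb Pb'; rewrite mulrDr; exact: PD.
  - by move=> b Pb; rewrite mulrN; exact: PN.
move=> e el me; apply: (Pe (nat_of_ord i :: e)) => /=; last by lia.
by apply/allpairsP; exists (nat_of_ord i, e); split => //=; rewrite mem_iota ltn_ord.
Qed.

End Straightening.

(** * Words in weighted generators and the word bound *)

Section Words.
Variables (I : eqType) (gens : seq I) (f : I -> nat).

Fixpoint words k : seq (seq I) :=
  if k is k'.+1 then [seq x :: s | x <- gens, s <- words k'] else [:: [::]].

Definition weight (s : seq I) : nat := sumn (map f s).

(** Lengths below [n] are enough because the letters will have positive weight. *)
Definition words_lt n : seq (seq I) :=
  [seq s <- flatten [seq words k | k <- iota 0 n] | (weight s < n)%N].

Lemma mem_words s : (s \in words (size s)) = all [in gens] s.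
Proof.
elim: s => //= x s <-; apply/allpairsP/andP => [[[y t] /= [yg ts [xy st]]]|[xg ss]].
  by rewrite xy {1}st.
by exists (x, s).
Qed.

Hypothesis f_gt0 : forall x, x \in gens -> (0 < f x)%N.

Lemma size_weight s : all [in gens] s -> (size s <= weight s)%N.
Proof.
by elim: s => //= x s IH /andP[/f_gt0 fx /IH sw]; rewrite /weight /= -/(weight s); lia.
Qed.

Lemma mem_words_lt n s : all [in gens] s -> (weight s < n)%N -> s \in words_lt n.
Proof.
move=> sg sn; rewrite mem_filter sn /=; apply/flatten_mapP; exists (size s).
  by rewrite mem_iota /= (leq_ltn_trans _ sn) // size_weight.
by rewrite mem_words.
Qed.

End Words.

Section WordBound.
Variables (p : nat) (gT : finGroupType) (Gs : nat -> {group gT}) (n b : nat).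
Hypotheses (p_pr : prime p)
  (Gs_le : forall i j, (0 < i <= j)%N -> Gs j \subset Gs i)
  (Gs_comm : forall i j x y, (0 < i)%N -> (0 < j)%N -> x \in Gs i -> y \in Gs j ->
     [~ x, y]%g \in Gs (i + j)%N)
  (Gs_exp : forall i x, (0 < i)%N -> x \in Gs i -> (x ^+ p)%g \in Gs (p * i)%N)
  (n_gt0 : (0 < n)%N) (Gs_n : Gs n = 1%G)
  (I : eqType) (gens : seq I) (f : I -> nat) (y : I -> gT)
  (f_gt0 : forall x, x \in gens -> (0 < f x)%N)
  (y_Gs : forall x, x \in gens -> y x \in Gs (f x))
  (y_gen : Gs 1 \subset <<[set g | has (fun x => y x == g) gens]%SET>>%g)
  (cardG : #|Gs 1| = (p ^ b)%N).

Local Notation R := 'M['F_p]_#|gT|.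

Definition regular_mx (g : gT) : R :=
  \matrix_(i, j) (enum_val j == enum_val i * g)%g%:R.

Lemma regular_mxM g h : regular_mx (g * h)%g = regular_mx g * regular_mx h.
Proof.
apply/matrixP => i j; rewrite !mxE (bigD1 (enum_rank (enum_val i * g)%g)) //=.
rewrite big1 ?addr0 => [|k ki]; first by rewrite !mxE enum_rankK eqxx mul1r mulgA.
rewrite !mxE; case: eqP => [kg|_]; last by rewrite mul0r.
by rewrite -kg enum_valK eqxx in ki.
Qed.

Lemma regular_mx1 : regular_mx 1%g = 1.
Proof.
by apply/matrixP => i j; rewrite !mxE mulg1 (inj_eq enum_val_inj) eq_sym.
Qed.

Definition point (g : gT) : 'rV['F_p]_#|gT| := delta_mx 0 (enum_rank g).

Lemma point_regular g : point 1%g *m regular_mx g = point g.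
Proof.
rewrite -rowE; apply/rowP => j; rewrite !mxE enum_rankK mul1g eqxx /=.
by rewrite -(inj_eq enum_val_inj) enum_rankK.
Qed.

Definition wordmx (s : seq I) : R := \prod_(x <- s) (regular_mx (y x) - 1).

Lemma matrix_pchar : p%:R = 0 :> R.
Proof.
apply/matrixP => i j; rewrite mulmxnE !mxE -mulrnA mulnC mulrnA.
by rewrite -[X in X *+ _]mulr_natr pchar_Fp_0 // mulr0 mul0rn.
Qed.

(** The zero sequence and the sequences with a single exponent 1 are light, as every letter has
    weight below [n]. The strict inequality produced by the zero sequence is what makes the
    dimension count in [word_bound] work. *)
Lemma light_count l : all (fun x : gT * nat => x.2 < n)%N l ->
  (size l < count (fun e => wt l e < n)%N (exps p l))%N.
Proof.
elim: l => [|x l IH] /=; first by rewrite n_gt0.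
move=> /andP[xn /IH sl].
have [q pq] : exists q, p = q.+2.
  by case: (p) (prime_gt1 p_pr) => [|[|q]] // _; exists q.
rewrite [in iota _ _]pq /= !count_cat !count_map.
rewrite (eq_count (a2 := fun e => (wt l e < n)%N)) //.
apply: leq_ltn_trans sl _; rewrite -[X in (X < _)%N]addn0 ltn_add2l addn_gt0; apply/orP; left.
rewrite -has_count; apply/hasP; exists (nseq (size l) 0%N).
  elim: (l) => //= x' l' IH'; apply/allpairsP; exists (0%N, nseq (size l') 0%N).
  by rewrite mem_iota /= prime_gt0.
rewrite /= mul1n; suff -> : wt l (nseq (size l) 0%N) = 0%N by rewrite addn0.
by elim: (l) => //= x' l' ->.
Qed.

Lemma wordmx_J s : all [in gens] s -> J Gs regular_mx (Gs 1) (weight f s) (wordmx s).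
Proof.
rewrite /wordmx; elim: s => [|x s IH] /=; first by rewrite big_nil => _; exact: J1.
move=> /andP[xg sg]; rewrite big_cons /weight /=; apply: JM; [|exact: y_Gs|exact: f_gt0|exact: IH].
by apply: (fintype.subsetP (Gs_le _)) (y_Gs xg); rewrite f_gt0.
Qed.

(** Modulo weight [n], the span of light words is stable under left multiplication by each
    [regular_mx (y x) - 1], hence by the subgroup generated; inverses cost nothing in a finite
    group. Spans are again replaced by additive predicates. *)
Lemma regular_words g : g \in Gs 1 -> forall Q : R -> Prop, add_closed Q ->
  (forall s, s \in words_lt gens f n -> Q (wordmx s)) ->
  (forall a, J Gs regular_mx (Gs 1) n a -> Q a) -> Q (regular_mx g).
Proof.
pose X a := forall Q : R -> Prop, add_closed Q ->
  (forall s, s \in words_lt gens f n -> Q (wordmx s)) ->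
  (forall a, J Gs regular_mx (Gs 1) n a -> Q a) -> Q a.
have XD a c : X a -> X c -> X (a + c).
  by move=> Xa Xc Q addQ Qw QJ; have [_ QD _] := addQ; apply: QD; [exact: Xa|exact: Xc].
have X1 : X 1.
  move=> Q addQ Qw QJ; have := Qw nil; rewrite /wordmx big_nil; apply.
  exact: mem_words_lt.
have XM x a : x \in gens -> X a -> X ((regular_mx (y x) - 1) * a).
  move=> xg Xa Q addQ Qw QJ; have [Q0 QD QN] := addQ.
  have Gx : y x \in Gs 1 by apply: (fintype.subsetP (Gs_le _)) (y_Gs xg); rewrite f_gt0.
  apply: (Xa (fun c => Q ((regular_mx (y x) - 1) * c))).
  - split; first by rewrite mulr0.
    + by move=> c d Qc Qd; rewrite mulrDr; exact: QD.
    + by move=> c Qc; rewrite mulrN; exact: QN.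
  - move=> s; rewrite mem_filter => /andP[sn /flatten_mapP[k _ sk]].
    have sg : all [in gens] s.
      elim: k s sk {sn} => [|k IH] s /=; first by rewrite inE => /eqP ->.
      by case/allpairsP => -[z t] /= [zg tk ->] /=; rewrite zg; exact: IH.
    have xsg : all [in gens] (x :: s) by rewrite /= xg.
    have -> : (regular_mx (y x) - 1) * wordmx s = wordmx (x :: s).
      by rewrite /wordmx big_cons.
    have [lt|ge] := ltnP (weight f (x :: s)) n; first by apply: Qw; exact: mem_words_lt.
    by apply: QJ; apply: (Jle ge); exact: wordmx_J.
  - move=> c Jc; apply: QJ; apply: (@Jle _ _ _ _ _ (f x + n)); first exact: leq_addl.
    by apply: JM => //; [exact: y_Gs|exact: f_gt0].
move=> Gg; suff : X (regular_mx g) by apply.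
pose S := [set h | `[< forall a, X a -> X (regular_mx h * a) >]]%SET.
have SP h : reflect (forall a, X a -> X (regular_mx h * a)) (h \in S).
  by rewrite inE; exact: asboolP.
have gS : group_set S.
  apply/group_setP; split; first by apply/SP => a; rewrite regular_mx1 mul1r.
  by move=> h k /SP Sh /SP Sk; apply/SP => a Xa; rewrite regular_mxM -mulrA; exact: Sh _ (Sk _ Xa).
rewrite -[regular_mx g]mulr1; apply: (SP g _) => //.
rewrite -[S]/(gval (Group gS)); apply: (fintype.subsetP _ _ Gg); apply: (fintype.subset_trans y_gen).
rewrite gen_subG; apply/fintype.subsetP => h; rewrite inE => /hasP[x xg /eqP <-].
apply/SP => a Xa; rewrite -(subrK 1 (regular_mx (y x))) mulrDl mul1r.
by apply: XD => //; exact: XM.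
Qed.

Lemma point_free (A : {set gT}) : free [seq point g | g <- enum A].
Proof.
rewrite -[X in free X]/(tval [tuple of [seq point g | g <- enum A]]).
apply/freeP => k; move=> sum0 i.
have /rowP/(_ (enum_rank (nth 1%g (enum A) i))) := sum0; rewrite !mxE summxE (bigD1 i) //=.
have si : (i < size (enum A))%N by rewrite -cardE.
rewrite (nth_map 1%g) // !mxE !eqxx mulr1 big1 ?addr0 // => j ji.
have sj : (j < size (enum A))%N by rewrite -cardE.
rewrite (nth_map 1%g) // !mxE (inj_eq enum_rank_inj) nth_uniq ?enum_uniq //=.
case: eqP => [ij|_]; last by rewrite mulr0.
by case/eqP: ji; apply: val_inj; rewrite /= ij.
Qed.

(* The words of weight [< n] in the [y x - 1] and the ordered monomials of weight [>= n] in the chain span the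
   group algebra, of dimension [p ^ b]; more than [b] ordered monomials have weight [< n]. *)
Lemma word_bound : (b <= size (words_lt gens f n))%N.
Proof.
have [l [cl al _]] := chain_exists p_pr Gs_le Gs_comm Gs_exp Gs_n (w := 1%N) n_gt0.
have bl : b = size l.
  by apply/eqP; rewrite -(eqn_exp2l _ _ (prime_gt1 p_pr)) -cardG (chain_cardE cl).
pose heavy := [seq e <- exps p l | (n <= wt l e)%N].
have szl : (b < count (fun e => wt l e < n)%N (exps p l))%N.
  by rewrite bl; apply: light_count; apply: sub_all al => x /andP[].
have szh : (size heavy + count (fun e => wt l e < n)%N (exps p l) = p ^ b)%N.
  rewrite bl -size_exps size_filter -(count_predC (fun e => (n <= wt l e)%N)); congr addn.
  by apply: eq_count => e /=; rewrite ltnNge.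
pose U := <<[seq point 1%g *m wordmx s | s <- words_lt gens f n] ++
            [seq point 1%g *m mono regular_mx l e | e <- heavy]>>%VS.
pose P (a : R) := point 1%g *m a \in U.
have addP : add_closed P.
  split; first by rewrite /P mulmx0 mem0v.
  - by move=> a c Pa Pc; rewrite /P mulmxDr memvD.
  - by move=> a Pa; rewrite /P mulmxN memvN.
have PG g : g \in Gs 1 -> point g \in U.
  move=> Gg; rewrite -point_regular; apply: (regular_words Gg addP).
    by move=> s sw; rewrite /P; apply: memv_span; rewrite mem_cat (map_f (fun s => point 1%g *m wordmx s)).
  move=> a Ja; apply: (straightening p_pr Gs_le Gs_comm Gs_exp regular_mxM regular_mx1 matrix_pchar cl Ja addP).
  move=> e el ne; rewrite /P; apply: memv_span; rewrite mem_cat; apply/orP; right.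
  by apply: (map_f (fun e => point 1%g *m mono regular_mx l e)); rewrite mem_filter ne.
have : (#|Gs 1| <= \dim U)%N.
  have /eqP dimE := point_free (Gs 1); rewrite size_map -cardE in dimE.
  rewrite -dimE; apply: dimvS; apply/span_subvP => _ /mapP[g Gg ->].
  by apply: PG; rewrite mem_enum in Gg.
have := dim_span ([seq point 1%g *m wordmx s | s <- words_lt gens f n] ++
            [seq point 1%g *m mono regular_mx l e | e <- heavy]).
rewrite size_cat !size_map -/U cardG => ? ?; lia.
Qed.

End WordBound.

(** * Polynomial functions *)

Section PolynomialFunctions.
Variables (p : nat) (G : groupType).
Implicit Types (f : G -> 'F_p) (g h x : G).

Definition dif g f : G -> 'F_p := fun x => f (x * g)%g - f x.

(* Functions of degree < n: annihilated by the n-th power of the augmentation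
   ideal of the group algebra. *)
Fixpoint Pol n f : Prop :=
  if n is m.+1 then forall g, Pol m (dif g f) else forall x, f x = 0.

Lemma Pol_zero n : Pol n (fun _ => 0).
Proof.
elim: n => // n IH g /=; rewrite (_ : dif _ _ = fun=> 0) //.
by apply: funext => x; rewrite /dif subrr.
Qed.

Lemma PolD n f f' : Pol n f -> Pol n f' -> Pol n (fun x => f x + f' x).
Proof.
elim: n f f' => [|n IH] f f' Pf Pf'; first by move=> x; rewrite Pf Pf' addr0.
move=> g; rewrite (_ : dif _ _ = fun x => dif g f x + dif g f' x); first exact: IH.
by apply: funext => x; rewrite /dif opprD addrACA.
Qed.

Lemma PolZ n a f : Pol n f -> Pol n (fun x => a * f x).
Proof.
elim: n f => [|n IH] f Pf; first by move=> x; rewrite Pf mulr0.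
move=> g; rewrite (_ : dif _ _ = fun x => a * dif g f x); first exact: IH.
by apply: funext => x; rewrite /dif mulrBr.
Qed.

Lemma PolN n f : Pol n f -> Pol n (fun x => - f x).
Proof.
by move=> /(PolZ (-1)); congr Pol; apply: funext => x; rewrite mulN1r.
Qed.

Lemma PolB n f f' : Pol n f -> Pol n f' -> Pol n (fun x => f x - f' x).
Proof. by move=> Pf /PolN; exact: PolD. Qed.

Lemma Pol_right n f h : Pol n f -> Pol n (fun x => f (x * h)%g).
Proof.
elim: n f => [|n IH] f Pf //= g.
have -> : dif g (fun x => f (x * h)%g) = fun x => dif (g ^ h)%g f (x * h)%g.
  by apply: funext => x; rewrite /dif conjgE !mulgA mulgK.
exact: IH.
Qed.

Lemma Pol_left n f h : Pol n f -> Pol n (fun x => f (h * x)%g).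
Proof.
elim: n f => [|n IH] f Pf //= g.
have -> : dif g (fun x => f (h * x)%g) = fun x => dif g f (h * x)%g.
  by apply: funext => x; rewrite /dif mulgA.
exact: IH.
Qed.

Lemma PolS n f : Pol n f -> Pol n.+1 f.
Proof. by move=> Pf g; apply: PolB => //; exact: Pol_right. Qed.

Lemma Pol_le m n f : (m <= n)%N -> Pol m f -> Pol n f.
Proof.
move=> /subnK <-; elim: (n - m)%N => [|k IH] //.
by move=> /IH; exact: PolS.
Qed.

Lemma Pol1_const f x y : Pol 1 f -> f x = f y.
Proof.
by move=> Pf; have := Pf (x^-1 * y)%g x; rewrite /dif mulVKg => /eqP; rewrite subr_eq0 => /eqP.
Qed.

(** Left translations commute with right differences, so the claim descends to functions of degree
    below 1, which are constant. *)
Lemma Pol_left_sub n f h : Pol n.+1 f -> Pol n (fun x => f (h * x)%g - f x).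
Proof.
elim: n f => [|n IH] f Pf; first by move=> x; rewrite (Pol1_const (h * x)%g x Pf) subrr.
move=> g; rewrite (_ : dif _ _ = fun x => dif g f (h * x)%g - dif g f x).
  by apply: IH; exact: Pf.
by apply: funext => x; rewrite /dif !mulgA; ring.
Qed.

Lemma dif_expand f x y k :
  f (y * x ^+ k)%g = \sum_(j < k.+1) iter j (dif x) f y *+ 'C(k, j).
Proof.
elim: k f => [|k IH] f; first by rewrite expg0 mulg1 big_ord1.
have -> : f (y * x ^+ k.+1)%g = dif x f (y * x ^+ k)%g + f (y * x ^+ k)%g.
  by rewrite /dif expgSr mulgA subrK.
pose D j := iter j (dif x) f y.
have E1 : \sum_(j < k.+1) D j *+ 'C(k, j) = D 0%N + \sum_(j < k.+1) D j.+1 *+ 'C(k, j.+1).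
  by rewrite big_ord_recl bin0 [in RHS]big_ord_recr /= bin_small // mulr0n addr0.
have -> : f (y * x ^+ k)%g = D 0%N + \sum_(j < k.+1) D j.+1 *+ 'C(k, j.+1) by rewrite IH E1.
rewrite IH [in RHS]big_ord_recl bin0 addrCA; congr (_ + _).
rewrite -big_split; apply: eq_bigr => j _ /=.
by rewrite binS mulrnDr addrC -iterSr.
Qed.

Lemma dif_expand_prime f x y : prime p -> f (y * x ^+ p)%g = f y + iter p (dif x) f y.
Proof.
move=> p_pr; rewrite dif_expand big_ord_recr /= binn mulr1n.
have [q pq] : exists q, p = q.+1 by case: (p) p_pr => // q _; exists q.
suff -> : \sum_(i < p) iter i (dif x) f y *+ 'C(p, i) = f y by [].
rewrite (bigD1 (Ordinal (prime_gt0 p_pr))) //= bin0 mulr1n big1 ?addr0 // => i i0.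
have /dvdnP[k ->] : (p %| 'C(p, i))%N.
  by apply: prime_dvd_bin => //; rewrite ltn_ord lt0n andbT.
by rewrite mulrnA -(mulr_natr (_ *+ k)) pchar_Fp_0 // mulr0.
Qed.

End PolynomialFunctions.

Section ZassenhausPol.
Variables (p : nat) (G : topologicalGroupType).
Hypotheses (p_pr : prime p) (G_profinite : profinite G).
Local Notation Z := (zassenhaus G p).
Implicit Types (f : G -> 'F_p).

Lemma locally_constant_dif g f : locally_constant f -> locally_constant (dif g f).
Proof.
move=> cf; apply: (locally_constant2 (fun a b : 'F_p => a - b)) => //.
exact: locally_constantMr.
Qed.

Lemma closed_subgroup_dif n f : locally_constant f ->
  closed_subgroup [set g | Pol n (dif g f)].
Proof.
move=> [U [oU nU] fU]; set K := [set g | _].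
have sK : subgroup K.
  have KM g h : K g -> K h -> K (g * h)%g.
    move=> Kg Kh; rewrite /K /= (_ : dif _ _ = fun x => dif h f (x * g)%g + dif g f x).
      by apply: PolD => //; exact: Pol_right.
    by apply: funext => x; rewrite /dif mulgA; ring.
  split; first by rewrite /K /= (_ : dif _ _ = fun=> 0); [exact: Pol_zero|apply: funext => x; rewrite /dif mulg1 subrr].
  move=> g h Kg Kh; apply: KM => //.
  rewrite /K /= (_ : dif _ _ = fun x => - dif h f (x * h^-1)%g).
    by apply: PolN; exact: Pol_right.
  by apply: funext => x; rewrite /dif mulgKV opprB.
split=> //; apply: open_subgroup_closed => //; apply: (open_subgroup oU nU.1 sK).
move=> u Uu; rewrite /K /= (_ : dif _ _ = fun=> 0); first exact: Pol_zero.
by apply: funext => x; rewrite /dif fU // subrr.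
Qed.

(** The dual of the fact that [g - 1] lies in the w-th power of the augmentation ideal for [g] in
    [Z w]. Elements lowering degrees by w form a closed subgroup, so p-th powers and commutators
    suffice; for the former, a p-fold difference is the difference along the p-th power. *)
Lemma Pol_zassenhaus w m f g : (0 < w)%N -> locally_constant f -> Pol m f ->
  Z w g -> Pol (m - w) (dif g f).
Proof.
have p1 := prime_gt1 p_pr.
elim/ltn_ind: w m f g => w IH m f g w0 cf Pf Zg.
have [w1|w1] := leqP w 1.
  have -> : w = 1%N by lia.
  case: m Pf => [|m] Pf; last by rewrite subn1.
  by move=> x; rewrite /dif !Pf subrr.
suff : Z w `<=` [set g | Pol (m - w) (dif g f)] by apply.
apply: (zassenhaus_sub p1 w1); first exact: closed_subgroup_dif.
- move=> x Zx /=; set c := ceil_div w p in Zx.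
  have c0 : (0 < c)%N by rewrite /c /ceil_div divn_gt0; lia.
  have it j : Pol (m - j * c) (iter j (dif x) f) /\ locally_constant (iter j (dif x) f).
    elim: j => [|j [Pj cj]]; first by rewrite mul0n subn0.
    split => /=; last exact: locally_constant_dif.
    have -> : (m - j.+1 * c = m - j * c - c)%N by rewrite mulSn; lia.
    by apply: IH => //; exact: ceil_div_lt.
  have [Pp _] := it p; apply: (@Pol_le _ _ (m - p * c)).
    rewrite leq_sub2l // /c /ceil_div.
    have := divn_eq (w + p.-1) p; have := @ltn_pmod (w + p.-1) p (ltnW p1).
    by move: (_ %/ _)%N (_ %% _)%N => q r; nia.
  rewrite (_ : dif _ _ = iter p (dif x) f) //.
  by apply: funext => y; rewrite /dif dif_expand_prime // addrAC subrr add0r.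
- move=> j a b jw Za Zb /=.
  (* In the group algebra, [[a, b] - 1] is [a^-1 b^-1] times the commutator of [a - 1] and
     [b - 1]. *)
  have -> : dif [~ a, b]%g f = fun x => (fun z => dif a (dif b f) z - dif b (dif a f) z) (x * (a^-1 * b^-1))%g.
    apply: funext => x; rewrite /dif commgEl conjgE.
    rewrite -!mulgA !mulKg; rewrite !mulgA; rewrite -(mulgA _ b^-1%g b) mulVg mulg1 -(mulgA _ a^-1%g a) mulVg mulg1.
    by ring.
  apply: (Pol_right (f := fun z => dif a (dif b f) z - dif b (dif a f) z)); apply: PolB.
    have -> : (m - w = m - (w - j) - j)%N by lia.
    by apply: (IH) => //; try lia; [exact: locally_constant_dif|apply: IH => //; lia].
  have -> : (m - w = m - j - (w - j))%N by lia.
  by apply: (IH) => //; try lia; [exact: locally_constant_dif|apply: IH => //; lia].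
Qed.

Lemma Pol_invariant m f z : locally_constant f -> Pol m f -> (0 < m)%N -> Z m z ->
  forall x, f (x * z)%g = f x.
Proof.
move=> cf Pf m0 Zz x; have := Pol_zassenhaus m0 cf Pf Zz.
by rewrite subnn => /(_ x) /eqP; rewrite subr_eq0 => /eqP.
Qed.

Lemma Pol_generators n f (X : set G) : locally_constant f ->
  (forall K, closed_subgroup K -> X `<=` K -> K = setT) ->
  (forall x, X x -> Pol n (dif x f)) -> Pol n.+1 f.
Proof.
move=> cf Xgen Xf g.
have KT := Xgen _ (closed_subgroup_dif n cf) Xf.
by have : [set g | Pol n (dif g f)] g by rewrite KT.
Qed.

End ZassenhausPol.

(** * The Golod-Shafarevich inequality *)

Section LinearAlgebra.
Variable K : fieldType.

Lemma linear_hom (V W : vectType K) (f : V -> W) : linear f ->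
  exists h : 'Hom(V, W), forall v, h v = f v.
Proof.
move=> fL; pose fM := GRing.isLinear.Build _ _ _ _ f fL.
pose fl : {linear _ -> _} := HB.pack f fM.
by exists (linfun fl) => v; rewrite (lfunE fl).
Qed.

Lemma vspace_of_pred (V : vectType K) (S : V -> Prop) : S 0 ->
  (forall a u v, S u -> S v -> S (a *: u + v)) ->
  exists U : {vspace V}, forall v, v \in U <-> S v.
Proof.
move=> S0 SL; pose Q k := `[< exists2 U : {vspace V}, (forall v, v \in U -> S v) & \dim U = k >].
have exQ : exists k, Q k.
  exists 0%N; apply/asboolP; exists 0%VS; last exact: dimv0.
  by move=> v; rewrite memv0 => /eqP ->.
have ubQ k : Q k -> (k <= dim V)%N.
  by move=> /asboolP[U _ <-]; rewrite -dimvf; apply: dimvS; exact: subvf.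
have [k /asboolP[U US dU] kmax] := ex_maxnP exQ ubQ.
exists U => v; split=> [|Sv]; first exact: US.
apply: contrapT => /negP nUv.
have : Q (\dim (U + <[v]>)%VS).
  apply/asboolP; exists (U + <[v]>)%VS => // w /memv_addP[u Uu [_ /vlineP[a ->] ->]].
  by rewrite addrC; apply: SL => //; exact: US.
move=> /kmax; rewrite leqNgt -dU => /negP; apply.
rewrite ltnNge; apply/negP => le.
have /eqP UE : U == (U + <[v]>)%VS by rewrite eqEdim addvSl.
by case/negP: nUv; rewrite UE; apply: (subvP (addvSr U <[v]>)); exact: memv_line.
Qed.

Lemma dim_le_linear (V W : vectType K) (U T : {vspace V}) (W' : {vspace W}) (f : V -> W) :
  linear f -> (forall u, u \in U -> f u \in W') ->
  (forall u, u \in U -> f u = 0 -> u \in T) -> (\dim U <= \dim T + \dim W')%N.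
Proof.
move=> /linear_hom[h hf] fW fT; rewrite -(limg_ker_dim h U); apply: leq_add; apply: dimvS.
  by apply/subvP => u; rewrite memv_cap memv_ker hf => /andP[Uu /eqP]; exact: fT.
by apply/subvP => _ /memv_imgP[u Uu ->]; rewrite hf; exact: fW.
Qed.

Lemma functional_sep (V : vectType K) (T : {vspace V}) (v0 : V) : v0 \notin T ->
  exists l : V -> K, [/\ linear (l : V -> K^o), forall t, t \in T -> l t = 0 & l v0 != 0].
Proof.
move=> nTv; pose pr := daddv_pi T^C T.
have cap0 : (T^C :&: T = 0)%VS by rewrite capvC capv_compl.
have addf : (T^C + T)%VS = fullv by rewrite addvC addv_complf.
have dec w : pr w + daddv_pi T T^C w = w by rewrite daddv_pi_add // addf memvf.
have prT t : t \in T -> pr t = 0.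
  move=> Tt; have := dec t; rewrite (daddv_pi_id _ Tt) ?capv_compl //.
  by move/(congr1 (fun u => u - t)); rewrite addrK subrr.
pose co j := coord (vbasis {:V}) j.
have [j vj] : exists j, co j (pr v0) != 0.
  apply: contrapT => nj; case/negP: nTv; rewrite -(dec v0).
  suff -> : pr v0 = 0 by rewrite add0r memv_pi.
  rewrite (coord_vbasis (memvf (pr v0))) big1 // => j _.
  suff -> : coord (vbasis {:V}) j (pr v0) = 0 by rewrite scale0r.
  by apply/eqP/negPn/negP => vj; apply: nj; exists j.
exists (fun w => co j (pr w)); split => //.
  by move=> a u w; rewrite /co !linearD !linearZ.
by move=> t /prT ->; rewrite /co linear0.
Qed.

End LinearAlgebra.

(** * Polynomial functions on a finite quotient *)

Section FinitePol.
Variables (p : nat) (G : topologicalGroupType) (N : nat).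
Hypotheses (p_pr : prime p) (G_profinite : profinite G).
Local Notation Z := (zassenhaus G p).
Hypothesis Z_open : open (Z N).
Variables (gT : finGroupType) (pi : G -> gT).
Hypothesis qpi : quotient_map (Z N) pi.
Local Notation V := {ffun gT -> ('F_p)^o}.

Let nZ := zassenhaus_normal G_profinite (prime_gt1 p_pr) N.

Lemma locally_constant_pi (A : Type) (f : gT -> A) : locally_constant (f \o pi).
Proof.
exists (Z N); first by split.
by move=> x u /(qm_ker qpi) Uu /=; rewrite (qmM qpi) Uu mulg1.
Qed.

Definition fpol n (f : V) : Prop := Pol n (f \o pi).

Lemma exists_polspace n : exists U : {vspace V}, forall f, f \in U <-> fpol n f.
Proof.
apply: vspace_of_pred.
  rewrite /fpol (_ : _ \o _ = fun=> 0); first exact: Pol_zero.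
  by apply: funext => x /=; rewrite ffunE.
move=> a f g Pf Pg; rewrite /fpol (_ : _ \o _ = fun x => a * f (pi x) + g (pi x)).
  by apply: PolD => //; exact: PolZ.
by apply: funext => x /=; rewrite !ffunE.
Qed.

Definition polspace n : {vspace V} := projT1 (cid (exists_polspace n)).

Lemma polspaceP n f : f \in polspace n <-> fpol n f.
Proof. by rewrite /polspace; case: cid. Qed.

Definition lift_fun (f : G -> 'F_p) : V := [ffun y => f (projT1 (cid (qm_surj qpi y)))].

Lemma lift_funE f : (forall x z, Z N z -> f (x * z)%g = f x) -> lift_fun f \o pi = f.
Proof.
move=> fZ; apply: funext => x /=; rewrite ffunE; case: cid => y /= /(qm_eq qpi) yx.
by rewrite -(mulVKg y x) fZ.
Qed.

(** Functions of degree below n are invariant under [Z n], so for n <= N nothing is lost by passing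
    to the quotient by [Z N]. *)
Lemma lift_pol n f : (0 < n <= N)%N -> locally_constant f -> Pol n f ->
  lift_fun f \o pi = f /\ lift_fun f \in polspace n.
Proof.
move=> /andP[n0 nN] cf Pf.
have E : lift_fun f \o pi = f.
  apply: lift_funE => x z Zz; apply: (Pol_invariant p_pr cf Pf n0).
  exact: (zassenhaus_le G_profinite (prime_gt1 p_pr) n0 nN).
by split=> //; apply/polspaceP; rewrite /fpol E.
Qed.

Lemma pol_pi_inj (f g : V) : f \o pi = g \o pi -> f = g.
Proof.
move=> fg; apply/ffunP => y; have [x <-] := qm_surj qpi y.
exact: (congr1 (fun h => h x) fg).
Qed.

Lemma polspace0 : polspace 0 = 0%VS.
Proof.
apply/eqP; rewrite -subv0; apply/subvP => f /polspaceP Pf; rewrite memv0; apply/eqP.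
apply: pol_pi_inj; apply: funext => x /=; rewrite ffunE; exact: Pf.
Qed.

Lemma dim_polspace_le n : (\dim (polspace n) <= #|gT|)%N.
Proof.
apply: leq_trans (dimvS (subvf _)) _; rewrite dimvf.
by rewrite /dim /= muln1.
Qed.

Definition fdif (y : gT) (f : V) : V := [ffun t => f (t * y)%g - f t].

Lemma fdif_pi g f : fdif (pi g) f \o pi = dif g (f \o pi).
Proof. by apply: funext => x; rewrite /= /dif ffunE /= (qmM qpi). Qed.

Lemma fdif_linear y : linear (fdif y).
Proof. by move=> a f g; apply/ffunP => x; rewrite !ffunE scalerBr opprD addrACA. Qed.

Lemma polspace_zassenhaus w m f g : (0 < w)%N -> Z w g -> f \in polspace m ->
  fdif (pi g) f \in polspace (m - w).
Proof.
move=> w0 Zg /polspaceP Pf; apply/polspaceP; rewrite /fpol fdif_pi.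
by apply: (Pol_zassenhaus p_pr w0 _ Pf Zg); exact: locally_constant_pi.
Qed.

Section GolodShafarevich.
Variables (d : nat) (x : 'I_d -> G) (n : nat).
Hypotheses (n_lt : (n.+2 <= N)%N)
  (x_gen : forall K : set G, closed_subgroup K -> (forall i, K (x i)) -> K = setT)
  (x_dual : forall c : 'I_d -> 'F_p, exists2 f : G -> 'F_p, chom f & forall i, f (x i) = c i)
  (cls : (G -> G -> 'F_p) -> 'F_p)
  (clsP : forall a b (c : 'F_p), cocycle_pair a -> cocycle_pair b ->
      cls a = c * cls b -> coboundary_pair (fun x y => a x y - c * b x y)).
Local Notation E := {ffun 'I_d -> V}.

(** Dual to the map from d copies of the group algebra onto the augmentation ideal given by the
    generators; its kernel consists of the constants. *)
Definition diffs (f : V) : E := [ffun i => fdif (pi (x i)) f].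

Lemma diffs_linear : linear diffs.
Proof. by move=> a f g; apply/ffunP => i; rewrite !ffunE fdif_linear. Qed.

Definition ltrans (g : gT) (v : E) : E := [ffun i => [ffun t => v i (g^-1 * t)%g]].

Lemma ltrans_linear g : linear (ltrans g).
Proof. by move=> a u v; apply/ffunP => i; apply/ffunP => t; rewrite !ffunE. Qed.

Lemma ltrans1 v : ltrans 1%g v = v.
Proof. by apply/ffunP => i; apply/ffunP => t; rewrite !ffunE invg1 mul1g. Qed.

Lemma ltransM g h v : ltrans (g * h)%g v = ltrans g (ltrans h v).
Proof. by apply/ffunP => i; apply/ffunP => t; rewrite !ffunE invMg mulgA. Qed.

Definition pol_tuple m (v : E) := forall i, fpol m (v i).

Lemma pol_tuple_ltrans m v g : pol_tuple m v -> pol_tuple m (ltrans g v).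
Proof.
move=> Pv i; have [h <-] := qm_surj qpi g; rewrite /fpol.
rewrite (_ : _ \o _ = fun t => (v i \o pi) (h^-1 * t)%g); first exact: (Pol_left _ (Pv i)).
by apply: funext => t /=; rewrite !ffunE (qmM qpi) (qmV qpi).
Qed.

Lemma pol_tuple_ltransB m v g : pol_tuple m.+1 v -> pol_tuple m (ltrans g v - v).
Proof.
move=> Pv i; have [h <-] := qm_surj qpi g; rewrite /fpol.
rewrite (_ : _ \o _ = fun t => (v i \o pi) (h^-1 * t)%g - (v i \o pi) t).
  exact: (Pol_left_sub _ (Pv i)).
by apply: funext => t /=; rewrite !ffunE (qmM qpi) (qmV qpi).
Qed.

Lemma exists_tuplespace m : exists U : {vspace E}, forall v, v \in U <-> pol_tuple m v.
Proof.
apply: vspace_of_pred => [i|a u v Pu Pv i].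
  by rewrite ffunE; apply/polspaceP; exact: mem0v.
by rewrite !ffunE; apply/polspaceP; apply: memvD; [apply: memvZ|]; apply/polspaceP.
Qed.

Lemma diffs_pol m v f : (m < N)%N -> pol_tuple m v -> locally_constant f ->
  (forall i, dif (x i) f = v i \o pi) -> exists2 f' : V, f' \in polspace m.+1 & diffs f' = v.
Proof.
move=> mN Pv cf fv.
have Pf : Pol m.+1 f.
  apply: (Pol_generators cf (X := range x)).
    by move=> K cK xK; apply: x_gen => // i; apply: xK; exists i.
  by move=> _ [i _ <-]; rewrite fv; exact: Pv.
have [E' Pf'] := lift_pol (n := m.+1) mN cf Pf.
exists (lift_fun f) => //; apply/ffunP => i; rewrite ffunE; apply: pol_pi_inj.
by rewrite fdif_pi E' fv.
Qed.

Lemma const_diffs v : pol_tuple 1 v -> exists2 f' : V, f' \in polspace 2 & diffs f' = v.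
Proof.
move=> Pv; have [f [fM cf] fx] := x_dual (fun i => v i 1%g).
apply: (diffs_pol _ Pv cf); first by lia.
move=> i; apply: funext => t; rewrite /dif fM addrAC subrr add0r fx.
by rewrite -(qm1 qpi); exact: (Pol1_const 1%g t (Pv i)).
Qed.

Definition invariant_mod (v : E) := forall g, exists f, ltrans g v - v = diffs f.

Lemma diffs_ker f y : diffs f = 0 -> f y = f 1%g.
Proof.
move=> f0; have [t <-] := qm_surj qpi y.
have cf := locally_constant_pi f.
have P1 : Pol 1 (f \o pi).
  apply: (Pol_generators cf (X := range x)).
    by move=> K cK xK; apply: x_gen => // i; apply: xK; exists i.
  move=> _ [i _ <-] s; rewrite -fdif_pi /=.
  by have /ffunP/(_ i) := f0; rewrite !ffunE => /ffunP/(_ (pi s)); rewrite !ffunE.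
by rewrite -(qm1 qpi); exact: (Pol1_const t 1%g P1).
Qed.

(** Dimension shifting by hand. If [ltrans g v - v = diffs (f g)], the coboundary of [f] is constant
    in [t], as [diffs] kills only constants, and is a 2-cocycle. Since H^2 is a line, a combination
    of the cocycles of [v] and [v'] is the coboundary of some [e]; corrected by [e], the same
    combination of [f] and [f'] is a 1-cocycle with values in functions, hence trivial. *)
Lemma socle_dim1 v v' : pol_tuple n.+1 v -> pol_tuple n.+1 v' ->
  invariant_mod v -> invariant_mod v' ->
  exists c c' : 'F_p, (c, c') <> (0, 0) /\
    exists2 f : V, f \in polspace n.+2 & diffs f = c *: v + c' *: v'.
Proof.
move=> Pv Pv' iv iv'.
have defect (u : E) : invariant_mod u -> exists (f : gT -> V) (a : G -> G -> 'F_p),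
    [/\ forall g, ltrans g u - u = diffs (f g), cocycle_pair a & forall g h t,
      a g h = f (pi g) t + f (pi h) ((pi g)^-1 * t)%g - f (pi (g * h)%g) t].
  move=> iu; pose f g := projT1 (cid (iu g)).
  have fE g : ltrans g u - u = diffs (f g) by rewrite /f; case: cid.
  pose a g h : 'F_p := f (pi g) 1%g + f (pi h) (pi g)^-1%g - f (pi (g * h)%g) 1%g.
  exists f, a.
  have aE g h t : a g h = f (pi g) t + f (pi h) ((pi g)^-1 * t)%g - f (pi (g * h)%g) t.
    pose F : V := f (pi g) + [ffun s => f (pi h) ((pi g)^-1 * s)%g] - f (pi (g * h)%g).
    have F0 : diffs F = 0.
      have -> : diffs F = diffs (f (pi g)) + ltrans (pi g) (diffs (f (pi h))) - diffs (f (pi (g * h)%g)).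
        apply/ffunP => i; apply/ffunP => s; rewrite !ffunE !mulgA; ring.
      rewrite -!fE (qmM qpi) ltransM.
      have lB : ltrans (pi g) (ltrans (pi h) u - u) = ltrans (pi g) (ltrans (pi h) u) - ltrans (pi g) u.
        by apply/ffunP => i; apply/ffunP => s; rewrite !ffunE.
      rewrite lB; apply/ffunP => i; apply/ffunP => s; rewrite !ffunE; ring.
    by have := diffs_ker t F0; rewrite !ffunE mulg1 => ->.
  split=> //; split.
    exists (Z N); first by split.
    move=> g h s t /(qm_ker qpi) s1 /(qm_ker qpi) t1.
    by rewrite /a !(qmM qpi) s1 t1 !mulg1.
  move=> g h k.
  rewrite (aE h k (pi g)^-1%g) (aE g (h * k)%g 1%g) (aE (g * h)%g k 1%g) (aE g h 1%g).
  rewrite !mulg1 !mulgA (qmM qpi g h) invMg; ring.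
have [f [a [fE ca aE]]] := defect v iv; have [f' [a' [fE' ca' aE']]] := defect v' iv'.
have [c [c' [cc' [e ce eE]]]] : exists c c' : 'F_p, (c, c') <> (0, 0) /\
    coboundary_pair (fun g h => c * a g h + c' * a' g h).
  have [a0|a0] := eqVneq (cls a') 0.
    exists 0, 1; split; first by case=> /eqP; rewrite oner_eq0.
    have := clsP ca' ca (c := 0); rewrite a0 mul0r => /(_ erefl)[e ce eE].
    by exists e => // g h; rewrite -eE; ring.
  exists 1, (- (cls a / cls a')); split; first by case=> /eqP; rewrite oner_eq0.
  have := clsP ca ca' (c := cls a / cls a'); rewrite divfK // => /(_ erefl)[e ce eE].
  by exists e => // g h; rewrite -eE; ring.
exists c, c'; split => //; pose w := c *: v + c' *: v'.
pose fh g t := c * f (pi g) t + c' * f' (pi g) t - e g.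
have fhM g h t : fh (g * h)%g t = fh g t + fh h ((pi g)^-1 * t)%g.
  have := eE g h; rewrite (aE g h t) (aE' g h t) /fh => /eqP; rewrite -subr_eq0 => /eqP E0.
  by apply/eqP; rewrite -subr_eq0; apply/eqP; rewrite -[RHS]oppr0 -E0; ring.
(* Evaluation at 1 trivialises the 1-cocycle [fh]. The result is a function on [G], since [e] need
   not factor through [pi]; [diffs_pol] brings it back to the finite quotient. *)
pose F g := fh g^-1%g 1%g.
have FE g t : F (g^-1 * t)%g = F t + fh g (pi t).
  by rewrite /F invgM invgK fhM (qmV qpi) invgK mulg1.
have cF : locally_constant F.
  apply: (locally_constantV (f := fun g => fh g 1%g)).
  apply: (locally_constant2 (fun u w : 'F_p => u - w)) => //.
  exact: (locally_constant_pi (fun g => c * f g 1%g + c' * f' g 1%g)).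
have Pw : pol_tuple n.+1 w.
  move=> i; rewrite !ffunE; apply/polspaceP.
  by apply: memvD; apply: memvZ; apply/polspaceP.
(* The discrepancy between [w] and the differences of [F] is left invariant, hence constant, and a
   character with prescribed values on the generators absorbs it. *)
pose u i t := w i (pi t) - dif (x i) F t.
have uconst i t : u i t = u i 1%g.
  have inv g s : u i (g^-1 * s)%g = u i s.
    have fi : fh g (pi (s * x i)%g) - fh g (pi s) = w i (pi (g^-1 * s)%g) - w i (pi s).
      have /ffunP/(_ i)/ffunP/(_ (pi s)) := fE (pi g); rewrite !ffunE => e1.
      have /ffunP/(_ i)/ffunP/(_ (pi s)) := fE' (pi g); rewrite !ffunE => e2.
      rewrite /fh !(qmM qpi) (qmV qpi) /GRing.scale /=.
      transitivity (c * (f (pi g) (pi s * pi (x i))%g - f (pi g) (pi s)) +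
        c' * (f' (pi g) (pi s * pi (x i))%g - f' (pi g) (pi s))); first by ring.
      by rewrite -e1 -e2 /=; ring.
    rewrite /u /dif -mulgA !FE.
    apply/eqP; rewrite -subr_eq0; apply/eqP.
    transitivity (w i (pi (g^-1 * s)%g) - w i (pi s) - (fh g (pi (s * x i)%g) - fh g (pi s))); first by ring.
    by rewrite fi subrr.
  by rewrite -(inv t t) mulVg.
have [chi [chiM cchi] chix] := x_dual (fun i => u i 1%g).
have [|||f0 Pf0 f0w] := @diffs_pol n.+1 w (fun t => F t + chi t) _ Pw.
- by lia.
- exact: (locally_constant2 (fun a b : 'F_p => a + b)).
- move=> i; apply: funext => t /=.
  transitivity (dif (x i) F t + chi (x i)); last by rewrite chix -(uconst i t) /u; ring.
  by rewrite /dif chiM; ring.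
by exists f0.
Qed.

(* Modulo the tuples of differences [diffs f], the invariant classes of the [d]-tuples of functions of degree
   [< n + 1] embed into H^2, a line; so a single linear form detects them, and its translates map the quotient
   injectively into [polspace n]. *)
Lemma golod_shafarevich :
  (1 + d * \dim (polspace n.+1) <= \dim (polspace n.+2) + \dim (polspace n))%N.
Proof.
have [En EnP] := exists_tuplespace n.+1.
have dimEn : (d * \dim (polspace n.+1) <= \dim En)%N.
  pose emb (u : {ffun 'I_d -> subvs_of (polspace n.+1)}) : E := [ffun i => vsval (u i)].
  have embL : linear emb by move=> a u w; apply/ffunP => i; rewrite !ffunE.
  have := @dim_le_linear _ _ _ fullv 0%VS En emb embL.
  rewrite dimv0 add0n dimvf => h.
  suff : (dim {ffun 'I_d -> subvs_of (polspace n.+1)} <= \dim En)%N.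
    by rewrite {1}/dim /= card_ord.
  apply: h => u _; first by apply/EnP => i; rewrite ffunE; apply/polspaceP; exact: subvsP.
  move=> e0; rewrite memv0; apply/eqP/ffunP => i; apply: val_inj.
  by have /ffunP/(_ i) := e0; rewrite !ffunE.
have [th thE] := linear_hom diffs_linear.
pose T := (th @: polspace n.+2)%VS.
have TP v : reflect (exists2 f : V, f \in polspace n.+2 & diffs f = v) (v \in T).
  by apply: (iffP memv_imgP) => [[f Pf ->]|[f Pf <-]]; exists f => //; rewrite thE.
have dimT : (1 + \dim T <= \dim (polspace n.+2))%N.
  rewrite -(limg_ker_dim th (polspace n.+2)) leq_add2r.
  pose one : V := [ffun=> 1].
  have one0 : one != 0 by apply/eqP => /ffunP/(_ 1%g); rewrite !ffunE => /eqP; rewrite oner_eq0.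
  have -> : 1%N = \dim <[one]>%VS by rewrite dim_vline one0.
  apply: dimvS; rewrite -memvE memv_cap memv_ker thE; apply/andP; split.
    apply/polspaceP; apply: (Pol_le (m := 1) (n := n.+2) (f := one \o pi)) => // g s.
    by rewrite /dif /= !ffunE subrr.
  by apply/eqP/ffunP => i; apply/ffunP => s; rewrite !ffunE subrr.
have Tpol v : v \in T -> pol_tuple n.+1 v.
  move=> /TP[f Pf <-] i; rewrite ffunE /fpol fdif_pi.
  by move/polspaceP: Pf; apply.
have Tconst v : pol_tuple 1 v -> v \in T.
  move=> /const_diffs[f Pf fv]; apply/TP; exists f => //.
  by apply/polspaceP; apply: (Pol_le (m := 2) (n := n.+2) (f := f \o pi)) => //; exact: (polspaceP _ _).1 Pf.
have [l [lL lT lS]] : exists l : E -> 'F_p, [/\ linear (l : E -> ('F_p)^o),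
    forall t, t \in T -> l t = 0 &
    forall v, v \in En -> invariant_mod v -> l v = 0 -> v \in T].
  have [[v0 [Ev0 iv0 nTv0]]|no] := pselect (exists v0, [/\ v0 \in En, invariant_mod v0 & v0 \notin T]).
    have [l [lL lT lv0]] := functional_sep nTv0; exists l; split=> // v Ev iv lv.
    have [c [c' [cc' [f Pf fE]]]] := socle_dim1 ((EnP _).1 Ev) ((EnP _).1 Ev0) iv iv0.
    have Tc : c *: v + c' *: v0 \in T by apply/TP; exists f.
    have := lT _ Tc; rewrite (lL c v (c' *: v0)).
    have -> : l (c' *: v0) = c' * l v0.
      have := lL c' v0 0; rewrite addr0 => ->.
      by have := lT _ (mem0v T); move=> ->; rewrite addr0.
    rewrite lv scaler0 add0r => /eqP; rewrite mulf_eq0 (negPf lv0) orbF => /eqP c'0.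
    move: Tc; rewrite c'0 scale0r addr0 => Tc.
    have c0 : c != 0 by apply/eqP => c0; apply: cc'; rewrite c0 c'0.
    by rewrite -(scalerK c0 v) memvZ.
  exists (fun _ => 0); split => //.
    by move=> a u v; rewrite scaler0 addr0.
  by move=> v Ev iv _; apply/negPn/negP => nTv; apply: no; exists v.
pose Th (v : E) : V := [ffun g => l (ltrans g v)].
have ThL : linear Th.
  by move=> a u v; apply/ffunP => g; rewrite !ffunE ltrans_linear lL.
have lB u v : l (u - v) = l u - l v.
  by have [L' L'E] := linear_hom lL; rewrite -!L'E linearB.
(* The degree drops by one because constant tuples come from characters and are killed by [l]. *)
have ThP m v : pol_tuple m.+1 v -> Pol m (Th v \o pi).
  elim: m v => [|m IH] v Pv.
    move=> g /=; rewrite ffunE; apply: lT; apply: Tconst.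
    exact: pol_tuple_ltrans.
  move=> h; rewrite (_ : dif _ _ = Th (ltrans (pi h) v - v) \o pi).
    by apply: IH; exact: pol_tuple_ltransB.
  apply: funext => g; rewrite /dif /= !ffunE -lB (qmM qpi) ltransM; congr l.
  by apply/ffunP => i; apply/ffunP => s; rewrite !ffunE.
(* Left differences of an element of the kernel are again in the kernel and of lower degree, hence
   in [T] by induction. The element is then invariant modulo [T], and [l] alone decides. *)
have ker k v : v \in En -> pol_tuple k v -> Th v = 0 -> v \in T.
  elim: k v => [|k IH] v Ev Pv Th0.
    have -> : v = 0; last exact: mem0v.
    by apply/ffunP => i; rewrite ffunE; apply: pol_pi_inj; apply: funext => s; rewrite [LHS](Pv i) /= ffunE.
  apply: lS => //.
    move=> g; suff /TP[f _ <-] : ltrans g v - v \in T by exists f.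
    apply: IH; [|exact: pol_tuple_ltransB|].
      apply/EnP; have Pn := (EnP _).1 Ev.
      have Pg := pol_tuple_ltrans g Pn.
      by move=> i; rewrite !ffunE; apply/polspaceP; apply: memvB; apply/polspaceP; [have := Pg i; rewrite ffunE|exact: Pn].
    apply/ffunP => h; rewrite !ffunE.
    have -> : ltrans h (ltrans g v - v) = ltrans (h * g)%g v - ltrans h v.
      by rewrite ltransM; apply/ffunP => i; apply/ffunP => s; rewrite !ffunE.
    have /ffunP t0 := Th0; have := t0 (h * g)%g; have := t0 h; rewrite !ffunE lB => -> ->.
    by rewrite subrr.
  by have /ffunP/(_ 1%g) := Th0; rewrite !ffunE ltrans1.
have h1 u : u \in En -> Th u \in polspace n.
  by move=> /EnP Pu; apply/polspaceP; exact: ThP.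
have h2 u : u \in En -> Th u = 0 -> u \in T.
  by move=> Eu; apply: (ker n.+1) => //; apply/EnP.
have h3 := dim_le_linear ThL h1 h2.
apply: (@leq_trans (1 + (\dim T + \dim (polspace n)))).
  by rewrite leq_add2l (leq_trans dimEn).
by rewrite addnA leq_add2r.
Qed.

End GolodShafarevich.

(** * Ordered monomials bound the dimension from above *)

Section PBWBound.
Variable n : nat.
Hypotheses (n_gt0 : (0 < n)%N).
Variables (Gs : nat -> {group gT}) (l : seq (gT * nat)) (H : {group gT}).
Hypotheses (cl : chain p Gs l H) (HT : H = [set: gT]%SET :> {set gT})
  (GsP : forall w y, (0 < w)%N -> y \in Gs w -> exists2 g, Z w g & pi g = y).

Fixpoint fmono (l : seq (gT * nat)) (e : seq nat) (f : V) : V :=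
  match l, e with x :: l', i :: e' => iter i (fdif x.1) (fmono l' e' f) | _, _ => f end.

Lemma fdif_expand (y : gT) k (f : V) t :
  f (t * y ^+ k)%g = \sum_(j < k.+1) iter j (fdif y) f t *+ 'C(k, j).
Proof.
have [g <-] := qm_surj qpi y; have [s <-] := qm_surj qpi t.
rewrite -(qmX qpi) -(qmM qpi); have := dif_expand (f \o pi) g s k; rewrite /= => ->.
apply: eq_bigr => j _; congr (_ *+ _); rewrite -[RHS]/((iter j (fdif (pi g)) f \o pi) s).
congr (_ s); elim: (nat_of_ord j) => //= i IH.
by rewrite fdif_pi IH.
Qed.

(** The linear form [L] is general so that the induction can absorb the differences along the outer
    letters into it. *)
Lemma fmono_determines l' H' (L : V -> 'F_p) (f : V) : chain p Gs l' H' ->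
  linear (L : V -> ('F_p)^o) -> (forall e, e \in exps p l' -> L (fmono l' e f) = 0) ->
  forall h, h \in H' -> L [ffun t => f (t * h)%g] = 0.
Proof.
move=> cl'; elim: cl' L => [|y w {}l' H1 {}H' _ IH st] L LL L0 h Hh.
  move/set1P: Hh => ->; rewrite (_ : [ffun t => _] = f); first exact: (L0 [::]).
  by apply/ffunP => t; rewrite ffunE mulg1.
have [i [h' [ip Hh' ->]]] := chain_dec st Hh.
pose u : V := [ffun t => f (t * h')%g].
have Lsum k (F : 'I_k -> V) : L (\sum_(j < k) F j) = \sum_(j < k) L (F j).
  have [L' L'E] := linear_hom LL; rewrite -L'E linear_sum.
  by apply: eq_bigr => j _; exact: L'E.
have LMn (v : V) k : L (v *+ k) = L v *+ k.
  by have [L' L'E] := linear_hom LL; rewrite -!L'E linearMn.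
have -> : [ffun t => f (t * (y ^+ i * h'))%g] = \sum_(j < i.+1) (iter j (fdif y) u) *+ 'C(i, j).
  apply/ffunP => t; rewrite ffunE sum_ffunE mulgA.
  have := fdif_expand y i u t; rewrite {1}/u ffunE => ->.
  by apply: eq_bigr => j _; rewrite ffunMnE.
rewrite Lsum big1 // => j _; rewrite LMn.
suff -> : L (iter j (fdif y) u) = 0 by rewrite mul0rn.
apply: (IH (fun v => L (iter j (fdif y) v))) Hh'.
  move=> a v v'; rewrite -LL; congr L; elim: (nat_of_ord j) => //= k ->.
  exact: fdif_linear.
move=> e el; apply: (L0 (nat_of_ord j :: e)) => /=.
apply/allpairsP; exists (nat_of_ord j, e); split => //=.
by rewrite mem_iota /= add0n (leq_ltn_trans _ ip) // -ltnS.
Qed.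

Lemma fmono_polspace l' H' e m f : chain p Gs l' H' -> f \in polspace m ->
  fmono l' e f \in polspace (m - wt l' e).
Proof.
move=> cl'; elim: cl' e => [|y w {}l' H1 {}H' _ IH st] [|i e] /= Pf; rewrite ?subn0 //.
have [g Zg <-] := GsP (chain_w st) (chain_y st).
elim: i => [|i IHi] /=; first exact: IH.
have -> : (m - (i.+1 * w + wt l' e) = m - (i * w + wt l' e) - w)%N by rewrite mulSn; lia.
apply: polspace_zassenhaus Zg IHi; exact: chain_w st.
Qed.

(** A function of degree below n is determined by its iterated differences at 1 along ordered
    exponents, and the heavy ones vanish. *)
Lemma pbw_bound : (\dim (polspace n) <= count (fun e => wt l e < n)%N (exps p l))%N.
Proof.
pose light := [seq e <- exps p l | (wt l e < n)%N].
rewrite -size_filter -/light.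
pose Phi (f : V) : {ffun 'I_(size light) -> ('F_p)^o} :=
  [ffun i => fmono l (nth [::] light (nat_of_ord i)) f 1%g].
have PhiL : linear Phi.
  move=> a f g; apply/ffunP => i; rewrite !ffunE.
  suff -> : fmono l (nth [::] light i) (a *: f + g) = a *: fmono l (nth [::] light i) f + fmono l (nth [::] light i) g.
    by rewrite !ffunE.
  elim: (l) (nth _ _ _) => [|x l' IH] [|k e] //=.
  rewrite IH; elim: k => //= k ->; exact: fdif_linear.
have dimW : \dim {: {ffun 'I_(size light) -> ('F_p)^o}} = size light.
  by rewrite dimvf /dim /= card_ord muln1.
have := @dim_le_linear _ _ _ (polspace n) 0%VS fullv Phi PhiL.
rewrite dimv0 add0n dimW; apply.
  by move=> u _; exact: memvf.
move=> f Pf Phi0; rewrite memv0; apply/eqP/ffunP => h; rewrite ffunE.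
have Hh : h \in H by rewrite HT inE.
have := @fmono_determines l H (fun v : V => v 1%g) f cl _ _ h Hh.
rewrite ffunE mul1g; apply; first by move=> a u v; rewrite !ffunE.
move=> e el; have [lt|ge] := ltnP (wt l e) n.
  have el' : e \in light by rewrite mem_filter lt.
  have ie : (index e light < size light)%N by rewrite index_mem.
  by have /ffunP/(_ (Ordinal ie)) := Phi0; rewrite !ffunE /= nth_index.
have := fmono_polspace e cl Pf; have -> : (n - wt l e = 0)%N by lia.
by rewrite polspace0 memv0 => /eqP ->; rewrite ffunE.
Qed.

End PBWBound.
End FinitePol.

Local Close Scope ring_scope.

(** * Openness of the Zassenhaus series *)

Section QuotientPreimage.
Variables (G : topologicalGroupType) (U : set G) (gT : finGroupType) (pi : G -> gT).
Hypotheses (qpi : quotient_map U pi) (oU : open U).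

Lemma closed_subgroup_preim (X : {group gT}) : closed_subgroup (pi @^-1` [set` X]).
Proof.
have sX : subgroup (pi @^-1` [set` X]).
  split=> [|a b] /=; first by rewrite (qm1 qpi) group1.
  by move=> Xa Xb; rewrite (qmM qpi) (qmV qpi) groupM ?groupV.
split=> //; apply: open_subgroup_closed => //.
apply: (open_subgroup oU) => //; last by move=> x /(qm_ker qpi) /= ->; exact: group1.
split=> [|a b]; first by apply/(qm_ker qpi); exact: qm1 qpi.
by move=> /(qm_ker qpi) a1 /(qm_ker qpi) b1; apply/(qm_ker qpi); rewrite (qmM qpi) (qmV qpi) a1 b1 mulgV.
Qed.

End QuotientPreimage.

Section OpenZassenhaus.
Variables (p : nat) (G : topologicalGroupType).
Hypotheses (p_pr : prime p) (G_prop : pro_p_group p G).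
Local Notation Z := (zassenhaus G p).
Let p_gt1 := prime_gt1 p_pr.
Let G_profinite := pro_p_profinite G_prop.

(** [word_bound] for the filtration of [K] by its intersections with [Z w], not for the Zassenhaus
    series of [K] itself: the generators count with their depth in [G], which is what makes long
    commutators cheap. *)
Lemma quotient_word_bound (U : set G) (gT : finGroupType) (pi : G -> gT) (n : nat)
  (I : eqType) (gens : seq I) (f : I -> nat) (x : I -> G) (K : set G) :
  open U -> quotient_map U pi -> p.-group [set: gT]%SET -> (0 < n)%N -> Z n `<=` U ->
  (forall i, i \in gens -> (0 < f i)%N) -> (forall i, i \in gens -> Z (f i) (x i)) ->
  subgroup K -> (forall i, i \in gens -> K (x i)) ->
  (forall H, closed_subgroup H -> (forall i, i \in gens -> H (x i)) -> K `<=` H) ->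
  (#|qimg pi K| <= p ^ size (words_lt gens f n))%N.
Proof.
move=> oU qpi pgT n0 ZU f0 Zx sK Kx genK.
have sKZ w : subgroup (K `&` Z w) by apply: subgroupI => //; exact: zassenhaus_subgroup.
pose Gs w := Group (group_set_qimg qpi (sKZ w)).
have Gs1 : Gs 1%N = qimg pi K :> {set gT} by rewrite /= zassenhaus1 setIT.
have [b cb] : exists b, #|qimg pi K| = (p ^ b)%N.
  have /p_natP[b cb] : p.-group (Gs 1%N) by exact: pgroupS (finset.subsetT _) pgT.
  by exists b; rewrite -cb Gs1.
rewrite cb leq_exp2l //; apply: (@word_bound p gT Gs n b p_pr _ _ _ n0 _ _ _ _ (pi \o x)) => //.
- by move=> i j /andP[i0 ij]; apply: qimgS => z [Kz Zz]; split => //; exact: zassenhaus_le Zz.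
- move=> i j _ _ i0 j0 /qimgP[a [Ka Za] <-] /qimgP[c [Kc Zc] <-].
  rewrite -(qmR qpi); apply: mem_qimg; split; last exact: zassenhaus_commg.
  by rewrite /commg /conjg; do !apply: subgroupM => //; exact: subgroupV.
- move=> i _ i0 /qimgP[a [Ka Za] <-]; rewrite -(qmX qpi); apply: mem_qimg.
  by split; [exact: subgroupX|exact: zassenhaus_expg].
- apply/val_inj/trivgP/fintype.subsetP => _ /qimgP[a [Ka /ZU Ua] <-].
  by rewrite inE; apply/eqP/(qm_ker qpi).
- by move=> i ig /=; apply: mem_qimg; split; [exact: Kx|exact: Zx].
- rewrite Gs1; set S := finset _; apply/fintype.subsetP => _ /qimgP[a Ka <-].
  apply: (genK _ (closed_subgroup_preim qpi oU <<S>>%G)) Ka => i ig.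
  by rewrite /preimage /=; apply: mem_gen; rewrite inE; apply/hasP; exists i => /=.
- by rewrite Gs1.
Qed.

(** [X] realises every joint value of the finitely many characters, so a character vanishing on [X]
    is zero; a proper closed subgroup containing [X] would be killed by a nonzero one. *)
Lemma finitely_generated (fin_H1 : finite_set [set f : G -> 'F_p | chom f]) :
  exists X : seq G, forall H, closed_subgroup H -> (forall x, x \in X -> H x) -> H = setT.
Proof.
have [/= cs csE] : exists cs : seq (G -> 'F_p), [set f | chom f] = [set` cs].
  by case/finite_seqP: fin_H1 => cs ->; exists cs.
pose v (g : G) : 'rV['F_p]_(size cs) := (\row_i (nth (fun=> 0%R) cs i) g)%R.
have [X XP] : exists X : seq G, forall g, exists2 x, x \in X & v x = v g.
  have : finite_set [set v g | g in setT] by exact: finite_finset.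
  case/finite_seqP => V VE.
  have VP u : exists g, u \in V -> v g = u.
    have [uV|] := boolP (u \in V); last by exists 1.
    have : [set v g | g in setT] u by rewrite VE.
    by case=> g _ gu; exists g.
  have /choice[c cP] := VP.
  exists (map c V) => g; have gV : v g \in V.
    have : [set v h | h in setT] (v g) by exists g.
    by rewrite VE.
  by exists (c (v g)); [exact: map_f|exact: cP].
exists X => H cH HX; apply/seteqP; split=> // x _; apply: contrapT => nHx.
have [|f [fM fH [y _ fy] [U oU fU]]] := closed_proper_hom p_pr G_prop cH (@subgroupT G) (@subsetT _ H).
  by move/(_ x I).
have cf : chom f by split; [move=> a b; exact: fM|exists U].
have : [set f | chom f] f by []. rewrite csE /= => fcs.
have [z zX /rowP/(_ (Ordinal (etrans (index_mem f cs) fcs)))] := XP y.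
rewrite !mxE /= nth_index // => fzy; move: fy; rewrite -fzy fH ?eqxx //; exact: HX.
Qed.

Lemma quotient_card_le (U W : set G) (gU gW : finGroupType) (piU : G -> gU) (piW : G -> gW) :
  quotient_map U piU -> quotient_map W piW -> W `<=` U -> (#|gW| <= #|gU|)%N -> U `<=` W.
Proof.
move=> qU qW WU le.
pose s (y : gU) := piW (projT1 (cid (qm_surj qU y))).
have sE x : exists2 y, y = piU x & forall z, s z = piW x -> z = y.
  exists (piU x) => // z; rewrite /s; case: cid => t /= <- /(qm_eq qW) /WU.
  by move/(qm_eq qU).
have si : injective s.
  move=> y z yz; have [x xz] := qm_surj qW (s z); have [t _ tP] := sE x.
  transitivity t; first by apply: tP; rewrite yz.
  by apply/esym; apply: tP.
have [s' _ ss'] := inj_card_bij si le.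
move=> x Ux; apply/(qm_ker qW).
have [_ -> /(_ (s' (piW x)))] := sE x; rewrite ss' => /(_ erefl) E.
have [_ -> /(_ (s' (piW 1)))] := sE 1; rewrite ss' => /(_ erefl) E1.
move/(qm_ker qU): Ux => Ux.
by rewrite -(ss' (piW x)) E Ux -(qm1 qU) -E1 ss' (qm1 qW).
Qed.

(* By the word bound, the quotients of [G] by the open normal subgroups containing [Z n] have bounded order; a
   subgroup whose quotient is largest lies in all the others. *)
Lemma zassenhaus_open (fin_H1 : finite_set [set f : G -> 'F_p | chom f]) n : (0 < n)%N ->
  open (Z n).
Proof.
move=> n0; have [X genX] := finitely_generated fin_H1.
pose card (U : set G) b := exists (gT : finGroupType) (pi : G -> gT),
  [/\ quotient_map U pi, p.-group [set: gT]%SET & #|gT| = b].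
have card_le U b : open_normal U -> Z n `<=` U -> card U b ->
    (b <= p ^ size (words_lt X (fun=> 1%N) n))%N.
  move=> oU ZU [gT [pi [qpi pgT <-]]]; rewrite -cardsT -(qimgT qpi).
  apply: (quotient_word_bound oU.1 qpi pgT n0 ZU (x := id)) => //.
  by move=> H cH /(genX H cH) ->.
have ex_card U : open_normal U -> exists b, card U b.
  move=> oU; have [gT [pi [qpi pgT]]] := pro_p_quotient p_pr G_prop oU.
  by exists #|gT|, gT, pi.
pose P b := `[< exists2 U, open_normal U /\ Z n `<=` U & card U b >].
have exP : exists b, P b.
  by have [b cb] := ex_card setT (open_normalT G); exists b; apply/asboolP; exists setT => //; split => //; exact: open_normalT.
have bP b : P b -> (b <= p ^ size (words_lt X (fun=> 1%N) n))%N.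
  by move=> /asboolP[U [oU ZU] cU]; exact: card_le cU.
have [b /asboolP[U [oU ZU] [gT [pi [qpi _ cU]]]] bmax] := ex_maxnP exP bP.
suff -> : Z n = U by exact: oU.1.
apply/seteqP; split=> // x Ux; apply: contrapT => nZx.
have [V oV nZVx] := closed_subgroup_sep G_profinite (zassenhaus_closed G_profinite p_gt1 (i := n)) nZx.
have nZ := zassenhaus_normal G_profinite p_gt1 n.
have oW : open_normal (U `&` prodset (Z n) V).
  apply: open_normalI => //; split; last exact: normal_prodset nZ oV.2.
  apply: (open_subgroup oV.1 oV.2.1); last by apply: prodset_subr; exact: nZ.1.
  exact: (normal_prodset nZ oV.2).1.
have ZW : Z n `<=` U `&` prodset (Z n) V.
  by move=> z Zz; split; [exact: ZU|apply: prodset_subl => //; exact: oV.2.1].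
have [c cW] := ex_card _ oW.
have cb : (c <= b)%N by apply: bmax; apply/asboolP; exists (U `&` prodset (Z n) V).
have [gW [piW [qW _ cc]]] := cW; rewrite -cc -cU in cb.
by have [] := quotient_card_le qpi qW (@subIsetl _ _ _) cb Ux.
Qed.

End OpenZassenhaus.

Local Open Scope ring_scope.

(** * A character onto the p-adic integers *)

Section Chom.
Variables (p : nat) (G : topologicalGroupType) (f : G -> 'F_p).
Hypothesis cf : chom f.

Lemma chom1 : f 1%g = 0.
Proof. by apply: (addrI (f 1%g)); rewrite -cf.1 mulg1 addr0. Qed.

Lemma chomV x : f x^-1%g = - f x.
Proof. by apply: (addrI (f x)); rewrite -cf.1 mulgV chom1 subrr. Qed.

Lemma chomX x n : f (x ^+ n)%g = f x *+ n.
Proof. by elim: n => [|n IH]; rewrite ?expg0 ?chom1 // expgS cf.1 IH mulrS. Qed.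

Lemma chomJ x y : f (x ^ y)%g = f x.
Proof. by rewrite /conjg !cf.1 chomV addrC addrK. Qed.

End Chom.

Section PadicCharacter.
Variables (p : nat) (G : topologicalGroupType).
Hypothesis (p_pr : prime p).
Implicit Types (phi : G -> int) (m : nat).

Local Notation q m := (p%:Z ^+ m).
Local Notation defect phi x y := (phi x + phi y - phi (x * y)%g).

(** A character modulo [p ^ m] is represented by an integer-valued function, so that characters for
    all moduli share one type and can be compared. *)
Definition hom_mod m phi := locally_constant phi /\ forall x y, (q m %| defect phi x y)%Z.

(** The connecting cocycle of the extension of Z/p^m by Z/p with middle term Z/p^(m+1): the
    obstruction to lifting [phi]. *)
Definition bockstein m phi (x y : G) : 'F_p := ((defect phi x y %/ q m)%Z)%:~R.

Let q_neq0 m : q m != 0.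
Proof. by rewrite expf_neq0 // -[0]/(0%N%:Z) eqz_nat -lt0n prime_gt0. Qed.

Let bockP m phi x y : hom_mod m phi -> defect phi x y = (defect phi x y %/ q m)%Z * q m.
Proof. by case=> _ hm; rewrite divzK. Qed.

Lemma dvdz_Fp (z : int) : (p %| z)%Z = (z%:~R == 0 :> 'F_p).
Proof. exact: (dvdz_pcharf (pchar_Fp p_pr)). Qed.

Lemma hom_mod_le m k phi : (k <= m)%N -> hom_mod m phi -> hom_mod k phi.
Proof. by move=> km [lc h]; split=> // x y; apply: dvdz_trans (h x y); exact: dvdz_exp2l. Qed.

Lemma bockstein_cocycle m phi : hom_mod m phi -> cocycle_pair (bockstein m phi).
Proof.
move=> hm; have [[U [oU nU] phiU] _] := hm; split.
  exists U => // g h u v Uu Uv; rewrite /bockstein (phiU g u) // (phiU h v) //.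
  have -> : (g * u * (h * v) = g * h * (u ^ h * v))%g by rewrite !mulgA -(mulgA g u h) (conjgC u) !mulgA.
  suff -> : phi (g * h * (u ^ h * v))%g = phi (g * h)%g by [].
  by apply: phiU; apply: subgroupM => //; [exact: nU.1|exact: nU.2].
move=> g h k; rewrite /bockstein -!rmorphD /=; congr (_ %:~R).
apply: (mulIf (q_neq0 m)); rewrite !mulrDl -!bockP // mulgA; ring.
Qed.

Lemma hom_mod_lift m phi : hom_mod m phi -> coboundary_pair (bockstein m phi) ->
  exists phi', hom_mod m.+1 phi' /\ forall x, (q m %| phi' x - phi x)%Z.
Proof.
move=> hm [e le eE]; pose e' x : int := (e x : nat)%:Z.
have e'E x : (e' x)%:~R = e x by rewrite /e' /= -pmulrn natr_Zp.
exists (fun x => phi x - q m * e' x); split; last first.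
  by move=> x; rewrite addrAC subrr add0r -mulrN dvdz_mulr.
split; first exact: (locally_constant2 (fun (a : int) (b : 'F_p) => a - q m * (b : nat)%:Z) hm.1 le).
move=> x y.
have -> : phi x - q m * e' x + (phi y - q m * e' y) - (phi (x * y)%g - q m * e' (x * y)%g)
  = q m * ((defect phi x y %/ q m)%Z - (e' x + e' y - e' (x * y)%g)).
  by rewrite mulrBr (mulrC (q m) (_ %/ _)%Z) -bockP //; ring.
rewrite exprSr dvdz_mul2l // dvdz_Fp rmorphB /= -[X in X - _]/(bockstein m phi x y) eE.
by rewrite rmorphB rmorphD /= !e'E subrr.
Qed.

Lemma hom_mod_add m k phi psi (c : int) : (k <= m)%N -> hom_mod m phi -> hom_mod k psi ->
  let phi' x := phi x + c * q (m - k) * psi x in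
  hom_mod m phi' /\ forall x y, bockstein m phi' x y = bockstein m phi x y + c%:~R * bockstein k psi x y.
Proof.
move=> km hm hk phi'.
have E x y : defect phi' x y = q m * ((defect phi x y %/ q m)%Z + c * (defect psi x y %/ q k)%Z).
  rewrite mulrDr (mulrC (q m) (_ %/ _)%Z) -bockP //.
  have := bockP x y hk; set w := (_ %/ _)%Z => E.
  have -> : q m * (c * w) = c * q (m - k) * (w * q k).
    by rewrite -[in LHS](subnK km) exprD; ring.
  by rewrite -E /phi'; ring.
split.
  split; last by move=> x y; rewrite E dvdz_mulr.
  exact: (locally_constant2 (fun (a b : int) => a + c * q (m - k) * b) hm.1 hk.1).
by move=> x y; rewrite /bockstein E mulKz // rmorphD rmorphM.
Qed.

Lemma chom_hom_mod (f : G -> 'F_p) : chom f -> hom_mod 1 (fun x => (f x : nat)%:Z).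
Proof.
move=> [fM lf]; split; first exact: (locally_constant1 (fun a : 'F_p => (a : nat)%:Z) lf).
move=> x y; rewrite expr1 dvdz_Fp rmorphB rmorphD /= -!pmulrn !natr_Zp fM.
by rewrite subrr.
Qed.

Lemma hom_mod_chom phi : hom_mod 1 phi -> chom (fun x => (phi x)%:~R : 'F_p).
Proof.
move=> [lphi h]; split; last exact: (locally_constant1 (fun a : int => a%:~R : 'F_p) lphi).
move=> x y; apply/eqP; rewrite eq_sym -subr_eq0 -rmorphD -rmorphB /= -dvdz_Fp.
by have := h x y; rewrite expr1.
Qed.

Variable cls : (G -> G -> 'F_p) -> 'F_p.
Hypothesis clsP : forall a b (c : 'F_p), cocycle_pair a -> cocycle_pair b ->
  cls a = c * cls b -> coboundary_pair (fun x y => a x y - c * b x y).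
Hypothesis two_chom : forall g : G, exists f : G -> 'F_p, [/\ chom f, f g = 0 & exists x, f x != 0].

Lemma coboundary_pair_add (a b : G -> G -> 'F_p) c :
  coboundary_pair a -> coboundary_pair b -> coboundary_pair (fun x y => a x y + c * b x y).
Proof.
move=> [e le eE] [f lf fE]; exists (fun x => e x + c * f x).
  exact: (locally_constant2 (fun u v => u + c * v)).
by move=> g h; rewrite eE fE; ring.
Qed.

Lemma hom_mod_adjust m k phi psi : (k <= m)%N -> hom_mod m phi -> hom_mod k psi ->
  ~ coboundary_pair (bockstein k psi) ->
  exists (c : int) phi', hom_mod m.+1 phi' /\
    forall x, (q m %| phi' x - (phi x + c * q (m - k) * psi x))%Z.
Proof.
move=> km hm hk nb.
have cb := bockstein_cocycle hk; have ca := bockstein_cocycle hm.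
have cls0 : cls (bockstein k psi) != 0.
  apply/eqP => cls0; apply: nb.
  have := @clsP _ _ 0 cb cb; rewrite cls0 mulr0 => /(_ erefl)[e le eE].
  by exists e => // g h; rewrite -eE mul0r subr0.
pose c : 'F_p := - (cls (bockstein m phi) / cls (bockstein k psi)).
have [hm' bE] := hom_mod_add (c : nat)%:Z km hm hk.
have [|phi' [h' E]] := hom_mod_lift hm'.
  have := @clsP _ _ (- c) ca cb; rewrite opprK divfK // => /(_ erefl)[e le eE].
  exists e => // g h; rewrite -eE bE -mulNr -/c; congr (_ + _ * _).
  by rewrite -pmulrn natr_Zp.
by exists (c : nat)%:Z, phi'.
Qed.

(** [Phi j] is built as a character modulo [p ^ (j + k0)] but agrees with [Phi j.+1] only modulo
    [p ^ j]: corrections by a fixed character cost a bounded number of digits. [P] carries an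
    invariant along. *)
Lemma padic_sequence k0 (P : (G -> int) -> Prop) (phi0 : G -> int) : (0 < k0)%N ->
  hom_mod k0 phi0 -> P phi0 ->
  (forall m phi, hom_mod (m + k0) phi -> P phi -> exists phi', [/\ hom_mod (m + k0).+1 phi', P phi' &
     forall x, (q m %| phi' x - phi x)%Z]) ->
  exists Phi : nat -> G -> int, forall j, [/\ hom_mod j (Phi j), P (Phi j) &
     forall x, (q j %| Phi j.+1 x - Phi j x)%Z].
Proof.
move=> k0_gt0 h0 P0 step.
have st (mp : nat * (G -> int)) : exists phi' : G -> int, hom_mod (mp.1 + k0) mp.2 -> P mp.2 ->
  [/\ hom_mod (mp.1 + k0).+1 phi', P phi' & forall x, (q mp.1 %| phi' x - mp.2 x)%Z].
  have [h|] := pselect (hom_mod (mp.1 + k0) mp.2 /\ P mp.2); last first.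
    by move=> n; exists phi0 => a b; case: n.
  by have [phi' H] := step _ _ h.1 h.2; exists phi'.
have [s sP] := choice st.
pose Phi := fix F n : G -> int := if n is n'.+1 then s (n', F n') else phi0.
have PhiP j : hom_mod (j + k0) (Phi j) /\ P (Phi j).
  by elim: j => [|j [h1 h2]] //=; have [] := sP (j, Phi j) h1 h2.
exists Phi => j; have [h1 h2] := PhiP j; split=> //; first exact: hom_mod_le (leq_addr _ _) h1.
by have [] := sP (j, Phi j) h1 h2.
Qed.

Lemma congr_Fp m (a b : int) : (0 < m)%N -> (q m %| a - b)%Z -> a%:~R = b%:~R :> 'F_p.
Proof.
move=> m0 h; apply/eqP; rewrite -subr_eq0 -rmorphB /= -dvdz_Fp.
by apply: dvdz_trans h; rewrite -[X in (X %| _)%Z]expr1; exact: dvdz_exp2l.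
Qed.

(* A character modulo [p ^ m] lifts when its Bockstein class vanishes.  If some [psi] modulo [p ^ k] does not lift,
   its class spans H^2, and adding a multiple of [p ^ (m - k) psi] makes any character modulo [p ^ m] liftable. *)
Theorem padic_character : exists Phi : nat -> G -> int,
  (forall j, hom_mod j (Phi j) /\ forall x, (q j %| Phi j.+1 x - Phi j x)%Z) /\
  exists x, forall j, (0 < j)%N -> ~~ (p %| Phi j x)%Z.
Proof.
pose nz x (phi : G -> int) := (phi x)%:~R != 0 :> 'F_p.
suff [k0 [phi0 [x [h0 nz0 step]]]] : exists k0 phi0 x, [/\ hom_mod k0.+1 phi0, nz x phi0 &
    forall m phi, hom_mod (m + k0.+1) phi -> exists phi', hom_mod (m + k0.+1).+1 phi' /\
      forall x, (q m.+1 %| phi' x - phi x)%Z].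
  have [] := @padic_sequence k0.+1 (nz x) phi0 (ltn0Sn _) h0 nz0.
    move=> m phi /step[phi' [h' E]] nzphi; exists phi'; split=> // [|y].
      by rewrite /nz (congr_Fp _ (E x)).
    by apply: dvdz_trans (E y); exact: dvdz_exp2l.
  move=> Phi PhiP; exists Phi; split; first by move=> j; have [] := PhiP j.
  by exists x => j _; rewrite dvdz_Fp; have [] := PhiP j.
pose bad k := `[< exists psi, hom_mod k psi /\ ~ coboundary_pair (bockstein k psi) >].
have [exbad|nob] := pselect (exists k, bad k); last first.
  have [f [cf _ [x fx]]] := two_chom 1%g.
  exists 0%N, (fun x => (f x : nat)%:Z), x; split; first exact: chom_hom_mod.
    by rewrite /nz -pmulrn natr_Zp.
  move=> m phi hm; have [|phi' [h' E]] := hom_mod_lift hm.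
    by apply: contrapT => nb; apply: nob; exists (m + 1)%N; apply/asboolP; exists phi.
  by exists phi'; split=> //; rewrite -[m.+1]addn1.
have [k /asboolP[psi [hk nb]] kmin] := ex_minnP exbad.
have k_gt0 : (0 < k)%N.
  rewrite lt0n; apply/eqP => k0; apply: nb; rewrite k0; exists (fun x => (psi x)%:~R).
    exact: (locally_constant1 (fun a : int => a%:~R : 'F_p) hk.1).
  by move=> g h; rewrite /bockstein expr0 divz1 rmorphB rmorphD.
have ph := hom_mod_chom (hom_mod_le k_gt0 hk).
(* The first correction adds a multiple of [psi] that may be prime to p, so [f] must be nonzero at a
   point where [psi] vanishes modulo p. A power of [x] moves [y] to such a point without changing
   the value of [f]. *)
have [f [cf [x fx]]] : exists f : G -> 'F_p, chom f /\ exists x, forall c : int, f x + c%:~R * (psi x)%:~R != 0.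
  have [[x psix]|psi0] := pselect (exists x, (psi x)%:~R != 0 :> 'F_p).
    have [f [cf fx [y fy]]] := two_chom x; exists f; split=> //.
    have [psiy|psiy] := eqVneq ((psi y)%:~R : 'F_p) 0.
      by exists y => c; rewrite psiy mulr0 addr0.
    have [a aE] : exists a : nat, (psi (y * x ^+ a)%g)%:~R = 0 :> 'F_p.
      pose a : 'F_p := - ((psi y)%:~R / (psi x)%:~R); exists a.
      by rewrite (ph.1 y) (chomX ph x) -[_ *+ _]mulr_natl natr_Zp mulNr divfK // subrr.
    exists (y * x ^+ a)%g => c; rewrite aE mulr0 addr0 cf.1 (chomX cf x) fx mul0rn addr0.
    exact: fy.
  have [f [cf _ [x fx]]] := two_chom 1%g; exists f; split=> //; exists x => c.
  have [->|psix] := eqVneq ((psi x)%:~R : 'F_p) 0; first by rewrite mulr0 addr0.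
  by case: psi0; exists x.
(* No character below the minimal bad exponent [k] is obstructed, so [f] lifts up to modulus
   [p ^ k]. *)
have [phi hphi phiE] : exists2 phi, hom_mod k phi & forall x, (phi x)%:~R = f x.
  suff L j : (j < k)%N -> exists2 phi, hom_mod j.+1 phi & forall x, (phi x)%:~R = f x.
    by have := L k.-1; rewrite prednK // => /(_ (leqnn _)).
  elim: j => [|j IH] jk.
    exists (fun x => (f x : nat)%:Z); first exact: chom_hom_mod.
    by move=> y; rewrite -pmulrn natr_Zp.
  have [phi hphi phiE] := IH (ltnW jk).
  have [|phi' [h' E]] := hom_mod_lift hphi.
    by apply: contrapT => nb'; move: jk; rewrite ltnNge kmin //; apply/asboolP; exists phi.
  by exists phi' => // y; rewrite -phiE (congr_Fp _ (E y)).
have [c [phi0 [h0 E0]]] := hom_mod_adjust (leqnn k) hphi hk nb.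
exists k, phi0, x; split=> //.
  by rewrite /nz (congr_Fp k_gt0 (E0 x)) subnn expr0 mulr1 rmorphD rmorphM /= phiE.
(* From here on the corrections are multiples of [p ^ m.+1]: they preserve the values modulo p and
   make the sequence converge. *)
move=> m phi' hm; have [|d [phi'' [h'' E]]] := hom_mod_adjust _ hm hk nb.
  by rewrite addnS leqW // leq_addl.
exists phi''; split=> // y; move: (E y).
have -> : (m + k.+1 - k = m.+1)%N by lia.
move=> Ey; have -> : phi'' y - phi' y = (phi'' y - (phi' y + d * q m.+1 * psi y)) + d * q m.+1 * psi y by ring.
apply: rpredD; last by rewrite dvdz_mulr // dvdz_mull.
by apply: dvdz_trans Ey; apply: dvdz_exp2l; rewrite addnS ltnS leq_addr.
Qed.

End PadicCharacter.

Section HomMod.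
Variables (p : nat) (G : topologicalGroupType) (m : nat) (phi : G -> int).
Hypothesis hphi : hom_mod p m phi.
Local Notation q m := (p%:Z ^+ m).

Lemma hom_mod1 : (q m %| phi 1%g)%Z.
Proof. by have := hphi.2 1%g 1%g; rewrite mulg1 addrK. Qed.

Lemma hom_modM x y : (q m %| phi (x * y)%g - (phi x + phi y))%Z.
Proof. by rewrite -opprB rpredN; exact: hphi.2. Qed.

Lemma hom_modX x n : (q m %| phi (x ^+ n)%g - phi x *+ n)%Z.
Proof.
elim: n => [|n IH]; first by rewrite expg0 mulr0n subr0 hom_mod1.
have -> : phi (x ^+ n.+1)%g - phi x *+ n.+1 =
    (phi (x ^+ n.+1)%g - (phi x + phi (x ^+ n)%g)) + (phi (x ^+ n)%g - phi x *+ n).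
  by rewrite mulrS; ring.
by apply: rpredD IH; rewrite expgS hom_modM.
Qed.

Definition kernel_mod : set G := [set x | (q m %| phi x)%Z].

Lemma kernel_modM x y : kernel_mod x -> kernel_mod (x * y)%g = kernel_mod y.
Proof.
rewrite /kernel_mod /= => hx; apply/propext.
have E : phi (x * y)%g = (phi (x * y)%g - (phi x + phi y)) + phi x + phi y by ring.
have h : (q m %| (phi (x * y)%g - (phi x + phi y)) + phi x)%Z by apply: rpredD hx; exact: hom_modM.
by rewrite E; split; rewrite (rpredDl _ h).
Qed.

Lemma hom_modV x : (q m %| phi x^-1%g + phi x)%Z.
Proof.
have -> : phi x^-1%g + phi x = phi 1%g - (phi (x^-1 * x)%g - (phi x^-1%g + phi x)).
  by rewrite mulVg; ring.
by apply: rpredB hom_mod1 _; exact: hom_modM.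
Qed.

Lemma kernel_mod_comm x y : kernel_mod [~ x, y]%g.
Proof.
rewrite /kernel_mod /= /commg /conjg.
have -> : phi (x^-1 * (y^-1 * (x * y)))%g =
    (phi (x^-1 * (y^-1 * (x * y)))%g - (phi x^-1%g + phi (y^-1 * (x * y))%g)) +
    (phi (y^-1 * (x * y))%g - (phi y^-1%g + phi (x * y)%g)) +
    (phi (x * y)%g - (phi x + phi y)) + (phi x^-1%g + phi x) + (phi y^-1%g + phi y) by ring.
do 2![apply: rpredD; last exact: hom_modV].
by do 2![apply: rpredD; last exact: hom_modM]; exact: hom_modM.
Qed.

Lemma kernel_mod_normal : normal_subgroup kernel_mod.
Proof.
split; last by move=> x g Kx; rewrite -(mulVKg x (x ^ g)%g) kernel_modM //; exact: kernel_mod_comm.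
split=> [|x y Kx Ky]; first exact: hom_mod1.
rewrite kernel_modM // /kernel_mod /= -(addrK (phi y) (phi y^-1%g)).
by apply: rpredB Ky; exact: hom_modV.
Qed.

Lemma kernel_mod_open : open_normal kernel_mod.
Proof.
split; last exact: kernel_mod_normal.
have [U [oU nU] phiU] := hphi.1.
apply: (open_subgroup oU nU.1 kernel_mod_normal.1) => u /phiU E.
by have := E 1%g; rewrite mul1g /kernel_mod /= => ->; exact: hom_mod1.
Qed.

End HomMod.

Section PadicKernel.
Variables (p : nat) (G : topologicalGroupType) (Phi : nat -> G -> int) (tau : G).
Hypotheses (p_pr : prime p) (G_prop : pro_p_group p G)
  (PhiP : forall j, hom_mod p j (Phi j) /\ forall x, (p%:Z ^+ j %| Phi j.+1 x - Phi j x)%Z)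
  (tauP : forall j, (0 < j)%N -> ~~ (p %| Phi j tau)%Z).
Local Notation q m := (p%:Z ^+ m).
Let G_profinite := pro_p_profinite G_prop.
Let hPhi j := (PhiP j).1.
Let M j := kernel_mod p j (Phi j).

Definition padic_kernel : set G := \bigcap_j kernel_mod p j (Phi j).
Local Notation N := padic_kernel.

Lemma padic_kernel_normal : normal_subgroup N.
Proof.
split=> [|x g Nx j _]; last by apply: (kernel_mod_normal (hPhi j)).2; exact: Nx.
by split=> [j _|x y Nx Ny j _]; [exact: hom_mod1|apply: (kernel_mod_normal (hPhi j)).1.2; [exact: Nx|exact: Ny]].
Qed.

Lemma padic_kernel_closed : closed N.
Proof.
apply: closed_bigI => j _; have [oM nM] := kernel_mod_open (hPhi j).
exact: open_subgroup_closed oM nM.1.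
Qed.

Lemma padic_kernel_comm x y : N [~ x, y]%g.
Proof. by move=> j _; exact: kernel_mod_comm. Qed.

Lemma kernel_modS j k : (j <= k)%N -> M k `<=` M j.
Proof.
move/subnKC <-; elim: {k}(_ - _)%N => [|k IH]; first by rewrite addn0.
apply: subset_trans IH => x; rewrite addnS /M /kernel_mod /= => h.
rewrite -(subrKC (Phi (j + k).+1 x) (Phi _ x)); apply: rpredD.
  by apply: dvdz_trans h; exact: dvdz_exp2l.
by rewrite -opprB rpredN; exact: (PhiP _).2.
Qed.

Lemma kernel_mod_sub (U : set G) : open_normal U -> exists m, M m `<=` prodset N U.
Proof.
move=> oU.
have oNU : open (prodset N U).
  apply: (open_subgroup oU.1 oU.2.1); first exact: (normal_prodset padic_kernel_normal oU.2).1.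
  by apply: prodset_subr; exact: padic_kernel_normal.1.
have [|||||_ [m _ <-] MO] := @compact_directed _ [set M m | m in setT] (prodset N U) (profinite_compact G_profinite) => //.
- by exists (M 0%N), 0%N.
- by move=> _ [m _ <-]; have [oM nM] := kernel_mod_open (hPhi m); exact: open_subgroup_closed oM nM.1.
- move=> _ _ [m _ <-] [k _ <-]; exists (M (maxn m k)); first by exists (maxn m k).
  by move=> x Mx; split; apply: kernel_modS Mx; rewrite ?leq_maxl ?leq_maxr.
- move=> x Nx; apply: prodset_subl; first exact: oU.2.1.
  by move=> j _; apply: Nx; exists j.
by exists m.
Qed.

Lemma tau_expg_mod m a : (0 < m)%N -> M m (tau ^+ a)%g -> (p ^ m %| a)%N.
Proof.
move=> m0 h; have : (q m %| Phi m tau *+ a)%Z.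
  rewrite -(subKr (Phi m (tau ^+ a)%g) (_ *+ _)); apply: rpredB h _; exact: hom_modX.
rewrite -mulr_natr Gauss_dvdzr; last first.
  rewrite coprimezE abszX absz_nat coprime_pexpl // prime_coprime //.
  by have := tauP m0; rewrite dvdzE.
by rewrite dvdzE abszX natz !absz_nat.
Qed.

Lemma tau_expg_unit m : M m (tau ^+ (p ^ m))%g.
Proof.
rewrite /M /kernel_mod /= -(subrK (Phi m tau *+ p ^ m) (Phi m _)); apply: rpredD; first exact: hom_modX.
by rewrite -mulr_natr natrX natz dvdz_mull.
Qed.

Lemma tau_coset m x : (0 < m)%N -> exists a, M m (x * tau ^- a)%g.
Proof.
move=> m0; have cop : coprimez (Phi m tau) (q m).
  rewrite coprimez_sym coprimezE abszX absz_nat coprime_pexpl // prime_coprime //.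
  by have := tauP m0; rewrite dvdzE.
have [u [v uv]] := Bezoutz (Phi m tau) (q m).
rewrite /coprimez in cop; rewrite (eqP cop) in uv.
have q0 : q m != 0 by rewrite expf_neq0 // -[0]/(0%N%:Z) eqz_nat -lt0n prime_gt0.
have [a aE] : exists a : nat, a%:Z = ((Phi m x * u) %% q m)%Z.
  by exists (absz (((Phi m x * u) %% q m)%Z)); rewrite gez0_abs // modz_ge0.
have h : (q m %| Phi m x - Phi m tau *+ a)%Z.
  rewrite -mulr_natr natz aE.
  have -> : Phi m x - Phi m tau * ((Phi m x * u) %% q m)%Z =
     q m * (Phi m x * v + Phi m tau * ((Phi m x * u) %/ q m)%Z).
    rewrite {1}/modz; apply/eqP; rewrite -subr_eq0; apply/eqP.
    transitivity (Phi m x * (1 - (u * Phi m tau + v * q m))); first by ring.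
    by rewrite uv subrr mulr0.
  exact: dvdz_mulr.
exists a; rewrite /M /kernel_mod /=.
have -> : Phi m (x * tau ^- a)%g = (Phi m (x * tau ^- a)%g - (Phi m x + Phi m (tau ^- a)%g)) +
   (Phi m (tau ^- a)%g + Phi m (tau ^+ a)%g) - (Phi m (tau ^+ a)%g - Phi m tau *+ a) +
   (Phi m x - Phi m tau *+ a) by ring.
apply: rpredD h; apply: rpredB; last exact: hom_modX.
by apply: rpredD; [exact: hom_modM|exact: hom_modV].
Qed.

(** [m] is large enough both for [tau ^+ (p ^ m)] to lie in [U] and for the level-m kernel to lie in
    [N U]. Every [x] is then n u tau^a, with a determined modulo [p ^ m] because [U1] lies in that
    kernel. *)
Lemma padic_decomposition (U : set G) : open_normal U -> exists m U1,
  [/\ (0 < m)%N, open_normal U1, U1 `<=` U /\ U1 `<=` M m, U1 (tau ^+ (p ^ m))%g &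
      forall x, exists na : G * nat, N na.1 /\ U1 (na.1^-1 * x * tau ^- na.2)%g].
Proof.
move=> oU; have [m1 sub1] := kernel_mod_sub oU.
have [m0 Um0] : exists m0, U (tau ^+ (p ^ m0))%g.
  have [gT [pi [qpi /p_natP[m0 c]]]] := pro_p_quotient p_pr G_prop oU.
  by exists m0; apply/(qm_ker qpi); rewrite (qmX qpi) -c expg_cardG ?inE.
pose m := (maxn m0 m1).+1; exists m, (U `&` M m).
have oM := kernel_mod_open (hPhi m).
split=> //; first exact: open_normalI.
  split; last exact: tau_expg_unit.
  have -> : (p ^ m = p ^ m0 * p ^ (m - m0))%N.
    by rewrite -expnD subnKC // /m ltnW // ltnS leq_maxl.
  by rewrite expgnA; apply: subgroupX => //; exact: oU.2.1.
move=> x; have [a Ma] := tau_coset x (ltn0Sn (maxn m0 m1)).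
have [n Nn [u Uu nu]] : prodset N U (x * tau ^- a)%g.
  by apply: sub1; apply: kernel_modS Ma; rewrite /m leqW // leq_maxr.
exists (n, a); split=> //=; rewrite -mulgA; split; first by rewrite nu mulKg.
by apply: subgroupM => //; [exact: oM.2.1|apply: subgroupV; [exact: oM.2.1|exact: Nn]].
Qed.

End PadicKernel.

(** * Generators of the kernel *)

Section KernelGenerated.
Variables (p : nat) (G : topologicalGroupType) (Phi : nat -> G -> int) (tau : G).
Hypotheses (p_pr : prime p) (G_prop : pro_p_group p G)
  (PhiP : forall j, hom_mod p j (Phi j) /\ forall x, (p%:Z ^+ j %| Phi j.+1 x - Phi j x)%Z)
  (tauP : forall j, (0 < j)%N -> ~~ (p %| Phi j tau)%Z).
Local Notation N := (padic_kernel p Phi).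
Let G_profinite := pro_p_profinite G_prop.

Definition chi1 (x : G) : 'F_p := (Phi 1%N x)%:~R.

Lemma chom_chi1 : chom chi1.
Proof. by apply: hom_mod_chom => //; exact: (PhiP 1).1. Qed.

Lemma chi1_tau : chi1 tau != 0.
Proof. by rewrite -dvdz_Fp // tauP. Qed.

Lemma chi1_kernel_mod m x : (0 < m)%N -> kernel_mod p m (Phi m) x -> chi1 x = 0.
Proof.
move=> m0 /(kernel_modS PhiP m0); rewrite /kernel_mod /= expr1 => h.
by apply/eqP; rewrite -dvdz_Fp.
Qed.

Lemma chi1_kernel x : N x -> chi1 x = 0.
Proof. by move=> Nx; apply: (@chi1_kernel_mod 1) => //; exact: Nx. Qed.

Lemma chom_scale (f : G -> 'F_p) c : chom f -> chom (fun x => c * f x).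
Proof.
by move=> [fM lf]; split; [move=> x y; rewrite fM mulrDr|exact: (locally_constant1 (fun a => c * a) lf)].
Qed.

Lemma chom_add (f g : G -> 'F_p) : chom f -> chom g -> chom (fun x => f x + g x).
Proof.
move=> [fM lf] [gM lg]; split; last exact: (locally_constant2 (fun a b => a + b)).
by move=> x y; rewrite fM gM addrACA.
Qed.

(* [theta (n u tau ^ a) = psi n] for [n] in [N] and [u] in a small open normal subgroup. *)
Lemma kernel_extension (psi chi : G -> 'F_p) : chom chi -> chi tau = 0 ->
  (forall x y, N x -> N y -> psi (x * y)%g = psi x + psi y) -> locally_constant psi ->
  (forall n, N n -> psi (n ^ tau)%g = psi n + chi n) ->
  exists theta : G -> 'F_p, [/\ locally_constant theta, forall n, N n -> theta n = psi n,
    theta tau = 0 & forall g h, theta g + theta h - theta (g * h)%g = chi1 g / chi1 tau * chi h].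
Proof.
move=> cchi chit psiM [U0 oU0 psiU0] psit.
have [U' oU' chiU'] := cchi.2.
have [m [U [m0 [oU nU] [UU UM] Utau dec]]] :=
  padic_decomposition p_pr G_prop PhiP tauP (open_normalI oU0 oU').
have psiU x u : U u -> psi (x * u)%g = psi x by move/UU => -[/psiU0 ->].
have chiU u : U u -> chi u = 0.
  by move/UU => -[_ /chiU' E]; rewrite -(mul1g u) E chom1.
have psi1 : psi 1%g = 0.
  by apply: (addrI (psi 1%g)); rewrite -psiM ?mulg1 ?addr0 //; exact: (padic_kernel_normal PhiP).1.1.
pose d n a x := N n /\ U (n^-1 * x * tau ^- a)%g.
have dE n a x : d n a x -> exists2 u, U u & x = (n * u * tau ^+ a)%g.
  by move=> [_ Uu]; exists (n^-1 * x * tau ^- a)%g => //; rewrite mulgA mulVKg mulgVK.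
have sN := (padic_kernel_normal PhiP).1; have nN := (padic_kernel_normal PhiP).2.
have sU := nU.1.
have dchi1 n a x : d n a x -> chi1 x = a%:R * chi1 tau.
  move=> dx; have [u Uu ->] := dE _ _ _ dx.
  rewrite !chom_chi1.1 (chi1_kernel dx.1) (chi1_kernel_mod m0 (UM _ Uu)) !add0r.
  by rewrite (chomX chom_chi1) mulr_natl.
have dchi n a x : d n a x -> chi x = chi n.
  move=> dx; have [u Uu ->] := dE _ _ _ dx.
  by rewrite !cchi.1 (chiU _ Uu) (chomX cchi) chit mul0rn !addr0.
(* Two decompositions of [x] differ by a power of [tau] in the level-m kernel. Its exponent is a
   multiple of [p ^ m], so that power lies in [U], to which [psi] is blind. *)
have uniq n n' a b x : d n a x -> d n' b x -> psi n = psi n'.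
  wlog ab : n n' a b / (a <= b)%N.
    move=> W; case: (leqP a b) => [|/ltnW] ab dx dx'; first exact: (W n n' a b).
    by apply/esym; exact: (W n' n b a).
  move=> dx dx'; have [Nn _] := dx; have [Nn' _] := dx'.
  have [u Uu xu] := dE _ _ _ dx; have [v Uv xv] := dE _ _ _ dx'.
  have nuv : (n * u = n' * v * tau ^+ (b - a))%g.
    by apply: (@mulIg _ (tau ^+ a)%g); rewrite -xu xv -[in LHS](subnK ab) expgnDr !mulgA.
  have nM := kernel_mod_normal (PhiP m).1.
  have Mx : kernel_mod p m (Phi m) (tau ^+ (b - a))%g.
    have -> : (tau ^+ (b - a) = (n' * v)^-1 * (n * u))%g by rewrite nuv mulKg.
    by apply: (subgroupM nM.1); [apply: (subgroupV nM.1)|]; apply: (subgroupM nM.1);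
      [exact: Nn'|exact: UM|exact: Nn|exact: UM].
  have /dvdnP[c cE] := tau_expg_mod p_pr PhiP tauP m0 Mx.
  have Ut : U (tau ^+ (b - a))%g by rewrite cE mulnC expgnA; exact: subgroupX.
  have : U (n^-1 * n')%g.
    have -> : (n^-1 * n' = u * (v * tau ^+ (b - a))^-1)%g.
      by apply: (@mulgI _ n); rewrite mulVKg mulgA nuv -(mulgA n') mulgK.
    by apply: subgroupM => //; apply: subgroupV => //; apply: subgroupM.
  by move/(psiU n); rewrite mulVKg.
have [D DP] := choice dec.
pose theta x := psi (D x).1.
have thetaE n a x : d n a x -> theta x = psi n.
  by move=> dx; apply: uniq dx; exact: DP.
have psiJ n a : N n -> psi (n ^ (tau ^+ a))%g = psi n + a%:R * chi n.
  move=> Nn; elim: a => [|a IH]; first by rewrite expg0 conjg1 mul0r addr0.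
  rewrite expgSr conjgM psit; last exact: nN.
  by rewrite IH (chomJ cchi) -addrA -[X in _ * _ + X]mul1r -mulrDl -natr1.
exists theta; split.
- exists U => // x u Uu; have [Nn Ux] := DP x.
  apply: (thetaE _ (D x).2); split=> //.
  have -> : ((D x).1^-1 * (x * u) * tau ^- (D x).2 =
     (D x).1^-1 * x * tau ^- (D x).2 * u ^ (tau ^- (D x).2))%g.
    by rewrite /conjg invgK !mulgA mulgVK.
  by apply: subgroupM => //; apply: nU.2.
- by move=> n Nn; apply: (thetaE n 0%N); split=> //; rewrite mulVg expg0 invg1 mulg1; exact: subgroup1.
- rewrite -psi1; apply: (thetaE 1%g 1%N); split; first exact: subgroup1.
  by rewrite expg1 invg1 mul1g mulgV; exact: subgroup1.
- move=> g h; have dg := DP g; have dh := DP h.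
  move: dg dh; rewrite /theta; move: (D g) (D h) => [n a] [n' b] /= dg dh.
  have dgh : d (n * n' ^ (tau ^- a))%g (a + b)%N (g * h)%g.
    split; first exact: (subgroupM sN dg.1 (nN _ _ dh.1)).
    have [u Uu ->] := dE _ _ _ dg; have [v Uv ->] := dE _ _ _ dh.
    have -> : ((n * n' ^ (tau ^- a))^-1 * (n * u * tau ^+ a * (n' * v * tau ^+ b)) * tau ^- (a + b)
       = u ^ (n' ^ (tau ^- a)) * v ^ (tau ^- a))%g.
      rewrite expgnDr invgM /conjg !invgM !invgK !mulgA.
      by rewrite !(mulgK, mulgVK).
    by apply: subgroupM => //; apply: nU.2.
  rewrite -/(theta _) (thetaE _ _ _ dgh) psiM; [|exact: dg.1|by apply: nN; exact: dh.1].
  have := psiJ (n' ^ (tau ^- a))%g a (nN _ _ dh.1); rewrite -conjgM mulVg conjg1 => ->.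
  rewrite (chomJ cchi) (dchi _ _ _ dh) (dchi1 _ _ _ dg) mulfK ?chi1_tau //; ring.
Qed.

Section Generation.
Variables (I : Type) (chi2 : G -> 'F_p) (x2 : G) (xs : I -> G).
Hypotheses (cchi2 : chom chi2) (chi2_tau : chi2 tau = 0) (chi2_x2 : chi2 x2 = 1)
  (chi2_xs : forall i, chi2 (xs i) = 0) (N_x2 : N x2) (N_xs : forall i, N (xs i))
  (chom_gen : forall f : G -> 'F_p, chom f -> f tau = 0 -> f x2 = 0 ->
     (forall i, f (xs i) = 0) -> forall x, f x = 0)
  (cup12 : ~ coboundary_pair (fun x y => chi1 x * chi2 y)).

Local Notation c := (fun y : G => [~ y, tau]%g).

(* For a nonzero character [psi] of [N] killing the generators, [T psi = psi [_, tau]] is nilpotent.  Its last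
   nonzero iterate extends to a multiple of [chi2]; extending the iterate before exhibits the cup product of
   [chi1] and [chi2] as a coboundary. *)
Theorem kernel_generated (H : set G) : closed_subgroup H -> H x2 ->
  (forall i j, H (iter j c (xs i))) -> N `<=` H.
Proof.
move=> [sH cH] Hx2 Hxs; apply: contrapT => nNH.
have nN := padic_kernel_normal PhiP; have sN := nN.1.
have N1 := subgroup1 sN.
have NJ x y : N x -> N (x ^ y)%g by exact: nN.2.
have cF : closed_subgroup (H `&` N).
  by split; [exact: subgroupI|apply: closedI => //; exact: padic_kernel_closed].
have [|f [fM fF [x0 Nx0 fx0] [U [oU nU] fU]]] := closed_proper_hom p_pr G_prop cF sN (@subIsetr _ _ _).
  by move=> NF; apply: nNH => x /NF[].
pose T j n := f (iter j c n).
have Nc j n : N n -> N (iter j c n) by case: j => [|j] //= _; exact: padic_kernel_comm.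
have f1 : f 1%g = 0 by apply: (addrI (f 1%g)); rewrite -fM ?mulg1 ?addr0.
have addJ (h : G -> 'F_p) : (forall x y, N x -> N y -> h (x * y)%g = h x + h y) ->
    forall x y, N x -> N y -> h (x ^ y)%g = h x.
  move=> hM x y Nx Ny; have := hM y (x ^ y)%g Ny (NJ _ _ Nx).
  by rewrite -conjgC hM // addrC => /addrI.
have TS j n : T j.+1 n = T j [~ n, tau]%g by rewrite /T iterSr.
have TM j : forall x y, N x -> N y -> T j (x * y)%g = T j x + T j y.
  elim: j => [|j IH] x y Nx Ny; first exact: fM.
  have Ncxt z : N [~ z, tau]%g by exact: padic_kernel_comm.
  (* Commutation with [tau] is multiplicative up to conjugation by an element of [N], which a
     homomorphism on [N] does not see. *)
  have -> : T j.+1 (x * y)%g = T j ([~ x, tau] ^ y * [~ y, tau])%g.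
    by rewrite TS; congr (T j _); rewrite /commg /conjg !invgM !mulgA !(mulgK, mulgVK).
  by rewrite IH ?(addJ _ IH) -?TS //; exact: NJ.
have [gT [pi [qpi pgT]]] := pro_p_quotient p_pr G_prop (conj oU nU).
have f_pi a b : pi a = pi b -> f b = f a.
  by move/(qm_eq qpi) => Uab; rewrite -(fU a _ Uab) mulVKg.
have pi_iter j n : pi (iter j c n) = iter j (fun y => [~ y, pi tau]%g) (pi n).
  by elim: j => //= j <-; rewrite (qmR qpi).
have TU j : locally_constant (T j).
  exists U => // x u Uu; apply/f_pi; rewrite !pi_iter (qmM qpi).
  by move/(qm_ker qpi): Uu => ->; rewrite mulg1.
have Ttau j n : N n -> T j (n ^ tau)%g = T j n + T j.+1 n.
  move=> Nn; rewrite /T iterSr -!/(T j _) -TM //; first by rewrite mulVKg.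
  exact: padic_kernel_comm.
(* Iterated commutators with [tau] descend the lower central series of the finite p-group through
   which [f] factors. *)
have [K KP] : exists K, forall n, N n -> T K n = 0.
  exists (nil_class [set: gT]%G) => n _; rewrite -f1; apply: f_pi; rewrite (qm1 qpi) pi_iter.
  have L j : iter j (fun y => [~ y, pi tau]%g) (pi n) \in 'L_j.+1([set: gT]%G)%g.
    by elim: j => [|j IH]; [rewrite lcn1 inE|rewrite lcnSn mem_commg ?inE].
  have /(lcn_nil_classP _ (pgroup_nil pgT)) E := leqnn (nil_class [set: gT]%G).
  by have := L (nil_class [set: gT]%G); rewrite E => /set1P ->.
pose vanish K := `[< forall n, N n -> T K n = 0 >].
have exK : exists K, vanish K by exists K; apply/asboolP.
have [[|L] /asboolP TL Lmin] := ex_minnP exK; first by move: fx0; rewrite -[f x0]/(T 0%N x0) TL ?eqxx.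
have [y Ny Ty] : exists2 y, N y & T L y != 0.
  apply: contrapT => nex; have : vanish L.
    by apply/asboolP => n Nn; apply: contrapT => /eqP Tn; apply: nex; exists n.
  by move/Lmin; rewrite ltnn.
have chom0 : chom (fun _ : G => 0 : 'F_p).
  by split; [move=> *; rewrite addr0|exact: locally_constant_cst].
have [|chi [lchi chiT chit chiM]] := kernel_extension chom0 erefl (TM L) (TU L).
  by move=> n Nn; rewrite Ttau // TL.
have cchi : chom chi.
  by split=> // g h; have /eqP := chiM g h; rewrite mulr0 subr_eq0 => /eqP.
have chiE x : chi x = chi x2 * chi2 x.
  apply/eqP; rewrite -subr_eq0; apply/eqP; rewrite -mulNr.
  apply: (chom_gen (chom_add cchi (chom_scale (- chi x2) cchi2))).
  - by rewrite chit chi2_tau mulr0 addr0.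
  - by rewrite chi2_x2 mulr1 subrr.
  - by move=> i; rewrite chi2_xs mulr0 addr0 chiT // /T; apply: fF; split; [exact: Hxs|exact: Nc].
have chix2 : chi x2 != 0.
  by apply: contra_neq Ty => chix2; rewrite -chiT // chiE chix2 mul0r.
(* If the last nonzero iterate were [f] itself, [chi] would extend [f] and vanish at [x2]. So an
   earlier iterate exists. *)
case: L TL Lmin Ty chiT => [|L] TL Lmin Ty chiT.
  by move: chix2; rewrite chiT // /T /= fF ?eqxx.
have [|theta [ltheta _ _ thetaM]] := kernel_extension cchi chit (TM L) (TU L).
  by move=> n Nn; rewrite Ttau // chiT.
apply: cup12; exists (fun x => chi1 tau / chi x2 * theta x).
  exact: (locally_constant1 (fun a => chi1 tau / chi x2 * a)).
move=> g h; rewrite -mulrDr -mulrBr thetaM (chiE h).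
have := chi1_tau; move: (chi1 tau) (chi x2) chix2 => a b b0 a0.
by field; rewrite b0 a0.
Qed.

End Generation.
End KernelGenerated.

(** * Consequences of non-solubility *)

Section Soluble.
Variables (p : nat) (G : topologicalGroupType).
Hypotheses (p_pr : prime p) (G_prop : pro_p_group p G).
Let G_profinite := pro_p_profinite G_prop.
Let closed1 : closed [set (1 : G)%g] := (closed_normal_set1 G_profinite).1.

Lemma comm_eq1 (x y : G) : [~ x, y]%g = 1%g <-> (x * y = y * x)%g.
Proof.
split=> [E|E]; first by rewrite commgC E mulg1.
by apply: (@mulgI _ (y * x)%g); rewrite -commgC mulg1.
Qed.

Lemma closed_centraliser (g : G) : closed_subgroup [set y | [~ y, g]%g = 1%g].
Proof.
split.
  split=> [|x y /= /comm_eq1 xg /comm_eq1 yg]; first by rewrite /= comm1g.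
  apply/comm_eq1; rewrite mulgA -xg -!mulgA; congr (x * _)%g.
  by apply: (@mulgI _ y); rewrite mulVKg mulgA yg mulgK.
apply: (@closed_preim _ (fun y => [~ y, g]%g) [set 1%g] _ closed1).
move=> y; apply: cvgMg; first exact: invg_continuous.
exact: continuousJ.
Qed.

Lemma procyclic_comm (g x y : G) : closed_generated [set g] x -> closed_generated [set g] y ->
  [~ x, y]%g = 1%g.
Proof.
move=> gx gy; suff : closed_generated [set g] `<=` [set z | [~ z, y]%g = 1%g] by apply.
apply: closed_generated_min; first exact: closed_centraliser.
move=> _ ->; suff : closed_generated [set g] `<=` [set z | [~ z, g]%g = 1%g].
  by move=> /(_ _ gy) /= /comm_eq1 E; apply/comm_eq1.
apply: closed_generated_min; first exact: closed_centraliser.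
by move=> _ -> /=; apply/comm_eq1.
Qed.

(** The closure of a cyclic group is abelian, so the second derived subgroup is trivial. *)
Lemma procyclic_commutator_soluble (g : G) : (forall x y : G, closed_generated [set g] [~ x, y]%g) ->
  soluble G.
Proof.
move=> gK; exists 2%N; apply/seteqP; split; last first.
  by move=> _ ->; exact: (closed_generated_closed_subgroup _).1.1.
apply: closed_generated_min.
  by split; [exact: (normal_subgroup1 G).1|].
have d1 : derived G 1 `<=` closed_generated [set g].
  apply: closed_generated_min; first exact: closed_generated_closed_subgroup.
  by move=> _ [x _ [y _ ->]]; exact: gK.
by move=> _ [x /d1 gx [y /d1 gy ->]]; exact: (procyclic_comm gx gy).
Qed.

(** Otherwise [G] would be the closure of a cyclic group, hence soluble. In particular H^1 has
    dimension at least 2. *)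
Lemma nonsoluble_chom : ~ soluble G -> forall g : G,
  exists f : G -> 'F_p, [/\ chom f, f g = 0 & exists x, f x != 0].
Proof.
move=> ns g.
have [|f [fM fH [x _ fx] [U oU fU]]] :=
  closed_proper_hom p_pr G_prop (closed_generated_closed_subgroup [set g]) (@subgroupT G) (@subsetT _ _).
  by move=> gT; apply: ns; apply: (@procyclic_commutator_soluble g) => x y; exact: gT.
exists f; split; last by exists x.
  by split; [move=> a b; exact: fM|exists U].
by apply: fH; exact: sub_closed_generated.
Qed.

End Soluble.

Section SelfCup.
Variables (p : nat) (G : topologicalGroupType) (Phi : nat -> G -> int).
Hypotheses (p_pr : prime p)
  (PhiP : forall j, hom_mod p j (Phi j) /\ forall x, (p%:Z ^+ j %| Phi j.+1 x - Phi j x)%Z).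

(* [x |-> binomial(Phi 2 x, 2)] cobounds the cup square. *)
Lemma cup_self : coboundary_pair (fun x y => chi1 p Phi x * chi1 p Phi y).
Proof.
pose B (a : int) := ((a * (a - 1)) %/ 2)%Z.
have BE a : B a * 2 = a * (a - 1).
  rewrite /B divzK //; have := divz_eq a 2.
  have : (0 <= (a %% 2)%Z < 2) by rewrite modz_ge0 ?ltz_pmod.
  move: (a %/ 2)%Z (a %% 2)%Z => q r hr ->.
  have [->|->] : r = 0 \/ r = 1 by lia.
    by rewrite addr0 -mulrA mulrCA; exact: dvdz_mulr.
  by rewrite addrK mulrCA mulrA; exact: dvdz_mull.
have BD a b : B (a + b) = B a + B b + a * b.
  by apply: (@mulIf _ 2) => //; rewrite !mulrDl !BE; ring.
(* For p = 2 the division by 2 in [B] costs a factor, so [B] modulo p depends on its argument modulo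
   [p ^ 2]. Hence [Phi 2] and not [Phi 1]. *)
have Bp (z : int) : (p %| B (p%:Z ^+ 2 * z))%Z.
  have [p2|p2] := eqVneq p 2%N.
    apply/dvdzP; exists (z * (p%:Z ^+ 2 * z - 1)); apply: (@mulIf _ 2) => //.
    by rewrite BE p2; ring.
  rewrite -(@Gauss_dvdzr p 2); last by rewrite coprimezE coprime_sym prime_coprime // dvdn_prime2 // eq_sym.
  by rewrite mulrC BE expr2 -!mulrA; exact: dvdz_mulr.
have h2 := (PhiP 2).1.
have Bmod (a z : int) : (B (a - p%:Z ^+ 2 * z))%:~R = (B a)%:~R :> 'F_p.
  apply/eqP; rewrite -subr_eq0 -rmorphB /= -dvdz_Fp //.
  rewrite -mulrN BD; set t := _ * - z; have -> : B a + B t + a * t - B a = B t + a * t by ring.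
  apply: rpredD; first exact: Bp.
  by rewrite /t expr2 -mulrA mulrCA; exact: dvdz_mulr.
have chi2E x : (Phi 2%N x)%:~R = chi1 p Phi x.
  by apply: congr_Fp (leqnn 1) _ => //; exact: (PhiP 1).2.
exists (fun x => - (B (Phi 2%N x))%:~R).
  exact: (locally_constant1 (fun a : int => - (B a)%:~R : 'F_p) h2.1).
move=> g h; have /dvdzP[k kE] := h2.2 g h.
have -> : Phi 2%N (g * h)%g = Phi 2%N g + Phi 2%N h - p%:Z ^+ 2 * k by rewrite mulrC -kE; ring.
by rewrite Bmod BD !rmorphD rmorphM /= !chi2E; ring.
Qed.

End SelfCup.

(** * Generators adapted to the character *)

Section Structure.
Variables (p : nat) (G : topologicalGroupType).
Hypotheses (p_pr : prime p) (G_dem : demushkin p G) (G_ns : ~ soluble G).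

(** [tau], [x2] and [xs] are dual to a basis of H^1 adapted to [chi1] and to a character pairing
    nontrivially with it. Without any [xs], [N] would lie in the closure of a cyclic group and
    contain all commutators, against non-solubility; hence their number is written [r.+1] and d = r
    + 3. *)
Theorem demushkin_structure : exists (r : nat) (N : set G) (tau x2 : G) (xs : 'I_r.+1 -> G),
  [/\ normal_subgroup N /\ closed N, N x2, forall i, N (xs i),
      forall U, open_normal U -> forall x, exists a, prodset N U (x * tau ^- a)%g &
      forall H, closed_subgroup H -> H x2 ->
        (forall i j, H (iter j (fun y => [~ y, tau]%g) (xs i))) -> N `<=` H] /\
  exists x : 'I_r.+3 -> G,
    (forall H, closed_subgroup H -> (forall i, H (x i)) -> H = setT) /\
    forall c : 'I_r.+3 -> 'F_p, exists2 f : G -> 'F_p, chom f & forall i, f (x i) = c i.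
Proof.
have [G_prop [_ finH1 H2 nd]] := G_dem.
have G_profinite := pro_p_profinite G_prop.
have [cls clsP] := cohomology2_dim1 G_profinite H2.
have two := nonsoluble_chom p_pr G_prop G_ns.
have [Phi [PhiP [tau tauP]]] := padic_character p_pr clsP two.
pose N := padic_kernel p Phi; pose chi1 := chi1 p Phi.
have cchi1 : chom chi1 := chom_chi1 p_pr PhiP.
have chi1t : chi1 tau != 0 := chi1_tau p_pr tauP.
have chi1N x : N x -> chi1 x = 0 by exact: chi1_kernel.
have nN : normal_subgroup N := padic_kernel_normal PhiP.
have cN : closed N := padic_kernel_closed PhiP.
have dec U : open_normal U -> forall x, exists n a, N n /\ U (n^-1 * x * tau ^- a)%g.
  move=> /(padic_decomposition p_pr G_prop PhiP tauP)[m [V [_ _ [VU _] _ D]]] x.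
  by have [[n a] [Nn Vx]] := D x; exists n, a; split => //; exact: VU.
have decf (f : G -> 'F_p) : chom f -> f tau = 0 -> forall x, exists2 n, N n & f n = f x.
  move=> cf ft x; have [U oU fU] := cf.2; have [n [a [Nn Ux]]] := dec U oU x.
  exists n => //; have := fU 1%g _ Ux; rewrite (chom1 cf) mul1g !cf.1 !(chomV cf) (chomX cf).
  rewrite ft mul0rn subr0 addrC => /eqP; rewrite subr_eq0 => /eqP ->; by [].
have [chi [cchi chit [x2 Nx2 chix2] cup12]] : exists chi : G -> 'F_p, [/\ chom chi, chi tau = 0,
    exists2 x2, N x2 & chi x2 = 1 & ~ coboundary_pair (fun x y => chi1 x * chi y)].
  have [g cg ncup] := cup_nondegenerate_pair G_profinite nd cchi1 (ex_intro _ tau chi1t).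
  (* The cup square of [chi1] vanishes, so a multiple of [chi1] may be subtracted to kill the value
     at [tau] without changing the class of the product with [chi1]. *)
  pose h x := g x + (- (g tau / chi1 tau)) * chi1 x.
  have ch : chom h by apply: chom_add => //; exact: chom_scale.
  have ht : h tau = 0 by rewrite /h mulNr divfK // subrr.
  have nch : ~ coboundary_pair (fun x y => chi1 x * h y).
    move=> cb; apply: ncup.
    have [e le eE] := coboundary_pair_add (g tau / chi1 tau) cb (cup_self p_pr PhiP).
    by exists e => // x y; rewrite -eE /h -/chi1; ring.
  have [y hy] : exists y, h y != 0.
    apply: contrapT => nex; apply: nch; exists (fun=> 0); first exact: locally_constant_cst.
    move=> x y; have [->|hy] := eqVneq (h y) 0; first by rewrite mulr0 subr0 addr0.
    by case: nex; exists y.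
  have [n Nn hn] := decf h ch ht y.
  exists (fun x => (h y)^-1 * h x); split.
  - exact: chom_scale.
  - by rewrite ht mulr0.
  - by exists n => //; rewrite hn mulVf.
  move=> [e le eE]; apply: nch; exists (fun x => h y * e x).
    exact: (locally_constant1 (fun a => h y * a)).
  by move=> a b; rewrite -mulrDr -mulrBr -eE mulrCA mulVKf.
have [fs fsE] : exists fs : seq (G -> 'F_p), [set f | chom f] = [set` fs].
  by case/finite_seqP: (finite_chom finH1) => fs ->; exists fs.
(* All characters at once: the Frattini quotient, embedded in a space with one coordinate per
   character. *)
pose Psi (g : G) : 'rV['F_p]_(size fs) := (\row_i (nth (fun=> 0) fs i) g).
have chom_fs (i : 'I_(size fs)) : chom (nth (fun=> 0) fs i).
  suff : [set f | chom f] (nth (fun=> 0) fs i) by [].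
  by rewrite fsE /=; exact: mem_nth.
have PsiM x y : Psi (x * y)%g = Psi x + Psi y.
  by apply/rowP => i; rewrite !mxE (chom_fs i).1.
have PsiX x a : Psi (x ^+ a)%g = Psi x *+ a.
  by apply/rowP => i; rewrite !mxE (chomX (chom_fs i)) mulmxnE mxE.
have lPsi : locally_constant Psi.
  have lfs i : locally_constant (nth (fun=> 0) fs i).
    have [si|si] := ltnP i (size fs); first exact: (chom_fs (Ordinal si)).2.
    by rewrite nth_default //; exact: locally_constant_cst.
  suff L k : exists2 U, open_normal U & forall i, (i < k)%N -> forall x u, U u ->
      nth (fun=> 0) fs i (x * u)%g = nth (fun=> 0) fs i x.
    by have [U oU fU] := L (size fs); exists U => // x u Uu; apply/rowP => i; rewrite !mxE fU.
  elim: k => [|k [U oU IH]]; first by exists setT => //; exact: open_normalT.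
  have [V oV fV] := lfs k; exists (U `&` V); first exact: open_normalI.
  by move=> i; rewrite ltnS leq_eqVlt => /predU1P[->|ik] x u [Uu Vu]; [exact: fV|exact: IH].
have [K KP] : exists K : {vspace 'rV['F_p]_(size fs)},
    forall v, v \in K <-> exists2 n, N n /\ chi n = 0 & Psi n = v.
  apply: vspace_of_pred.
    exists 1%g; first by split; [exact: subgroup1 nN.1|exact: chom1].
    by apply: (addrI (Psi 1%g)); rewrite -PsiM mulg1 addr0.
  move=> a _ _ [m [Nm chim] <-] [n [Nn chin] <-]; exists (m ^+ a * n)%g.
    split; first by apply: (subgroupM nN.1) => //; apply: (subgroupX _ nN.1).
    by rewrite cchi.1 (chomX cchi) chim mul0rn add0r.
  by rewrite PsiM PsiX -scaler_nat natr_Zp.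
have ex i : exists n, [/\ N n, chi n = 0 & Psi n = (vbasis K)`_i].
  have /KP[n [Nn chin] Pn] : (vbasis K)`_i \in K.
    have [iK|iK] := ltnP i (size (vbasis K)); first by rewrite vbasis_mem // mem_nth.
    by rewrite nth_default // mem0v.
  by exists n.
have [xs xsP] := choice ex.
have chom_gen (f : G -> 'F_p) : chom f -> f tau = 0 -> f x2 = 0 ->
    (forall i : 'I_(\dim K), f (xs i) = 0) -> forall x, f x = 0.
  move=> cf ft fx2 fxs x; have [n Nn <-] := decf f cf ft x.
  have [n' [Nn' chin'] <-] : exists2 n', N n' /\ chi n' = 0 & f n' = f n.
    exists (n * x2 ^- (chi n))%g; last by rewrite cf.1 (chomV cf) (chomX cf) fx2 mul0rn subr0.
    split; last by rewrite cchi.1 (chomV cchi) (chomX cchi) chix2 natr_Zp subrr.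
    by apply: (subgroupM nN.1) => //; apply: (subgroupV nN.1); exact: (subgroupX _ nN.1).
  have fsf : (index f fs < size fs)%N.
    by rewrite index_mem; have : [set f | chom f] f by []; rewrite fsE.
  have fE y : f y = Psi y 0 (Ordinal fsf) by rewrite mxE /= nth_index // -index_mem.
  have /KP/coord_vbasis Kn : exists2 m, N m /\ chi m = 0 & Psi m = Psi n' by exists n'.
  rewrite fE Kn summxE big1 // => i _; rewrite mxE.
  by have [_ _ <-] := xsP i; rewrite -fE fxs mulr0.
have Kgt0 : (0 < \dim K)%N.
  rewrite lt0n; apply/eqP => K0; apply: G_ns.
  apply: (@procyclic_commutator_soluble p _ G_prop x2) => x y.
  have NN : N `<=` closed_generated [set x2].
    apply: (@kernel_generated p G Phi tau p_pr G_prop PhiP tauP 'I_(\dim K) chi x2 xs) => //.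
    - by move=> i; have [] := xsP i.
    - by move=> i; have [] := xsP i.
    - exact: closed_generated_closed_subgroup.
    - exact: sub_closed_generated.
    - by move=> i; have := ltn_ord i; rewrite {2}K0.
  by apply: NN; exact: padic_kernel_comm.
have [r rE] : exists r, \dim K = r.+1 by exists (\dim K).-1; rewrite prednK.
rewrite rE in chom_gen.
exists r, N, tau, x2, xs; split.
  split=> //.
  - by move=> i; have [] := xsP i.
  - move=> U oU x; have [n [a [Nn Ux]]] := dec U oU x; exists a; exists n => //.
    by exists (n^-1 * x * tau ^- a)%g => //; rewrite -mulgA mulVKg.
  - apply: (@kernel_generated p G Phi tau p_pr G_prop PhiP tauP 'I_r.+1 chi x2 xs) => //.
      by move=> i; have [] := xsP i.
    by move=> i; have [] := xsP i.
pose x (i : 'I_r.+3) : G := if i == 0%N :> nat then tau else if i == 1%N :> nat then x2 else xs (i - 2)%N.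
have x_xs (i : 'I_r.+1) : x (rshift 2 i) = xs i by rewrite /x /= addKn.
exists x; split.
  move=> H cH Hx; apply/seteqP; split=> // y _; apply: contrapT => nHy.
  have [|f [fM fH [z _ fz] [U oU fU]]] := closed_proper_hom p_pr G_prop cH (@subgroupT G) (@subsetT _ _).
    by move/(_ y I).
  have cf : chom f by split; [move=> a b; exact: fM|exists U].
  move: fz; rewrite (chom_gen f cf) ?eqxx //.
  - by apply: fH; exact: (Hx ord0).
  - by apply: fH; exact: (Hx (lift ord0 ord0)).
  - by move=> i; apply: fH; rewrite -x_xs.
(* Coordinates on [K] prescribe the values at [xs]. Then [chi1], which vanishes on [N], adjusts the
   value at [tau], and [chi], which vanishes at [tau] and [xs], the value at [x2]. *)
move=> c; pose h (y : G) : 'F_p := \sum_(i < \dim K) c (inord (i + 2)) * coord (vbasis K) i (Psi y).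
have ch : chom h.
  split; last exact: (locally_constant1 (fun v => \sum_(i < \dim K) c (inord (i + 2)) * coord (vbasis K) i v) lPsi).
  move=> y z; rewrite /h -big_split /=; apply: eq_bigr => i _.
  by rewrite PsiM linearD mulrDr.
have hxs (j : 'I_(\dim K)) : h (xs j) = c (inord (j + 2)).
  rewrite /h; have [_ _ ->] := xsP j.
  rewrite (bigD1 j) //= coord_free ?(basis_free (vbasisP K)) // eqxx mulr1 big1 ?addr0 // => i ij.
  by rewrite coord_free ?(basis_free (vbasisP K)) // eq_sym (negPf ij) mulr0.
exists (fun y => h y + (c 0 - h tau) / chi1 tau * chi1 y + (c (inord 1) - h x2) * chi y).
  by apply: chom_add; [apply: chom_add => //|]; exact: chom_scale.
move=> i; rewrite /x; case: eqP => [i0|i0].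
  rewrite chit mulr0 addr0 divfK // addrC subrK; congr c; exact: val_inj.
case: eqP => [i1|i1].
  rewrite (chi1N x2 Nx2) mulr0 addr0 chix2 mulr1 addrC subrK; congr c.
  by apply: val_inj; rewrite /= inordK // i1.
have ik : (i - 2 < \dim K)%N by rewrite rE; have := ltn_ord i; lia.
have [/chi1N -> -> _] := xsP (i - 2)%N; rewrite !mulr0 !addr0 (hxs (Ordinal ik)) /=.
by congr c; apply: val_inj; rewrite /= inordK; have := ltn_ord i; lia.
Qed.

End Structure.

Local Close Scope ring_scope.

(** * Orders modulo the Zassenhaus series *)

Section LogIndex.
Variables (p : nat) (G : topologicalGroupType).
Hypotheses (p_pr : prime p) (G_prop : pro_p_group p G)
  (Z_open : forall n, (0 < n)%N -> open (zassenhaus G p n)).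
Local Notation Z := (zassenhaus G p).
Let p_gt1 := prime_gt1 p_pr.
Let G_profinite := pro_p_profinite G_prop.
Let nZ n : normal_subgroup (Z n) := zassenhaus_normal G_profinite p_gt1 n.
Let sZ n : subgroup (Z n) := (nZ n).1.

Definition lg (H : set G) n := logn p (Defs.index (prodset H (Z n)) (Z n)).

Lemma zassenhaus_quotient n : (0 < n)%N -> exists (gT : finGroupType) (pi : G -> gT),
  quotient_map (Z n) pi /\ p.-group [set: gT]%SET.
Proof. by move=> n0; apply: (pro_p_quotient p_pr G_prop); split; [exact: Z_open|]. Qed.

Section Quotient.
Variables (n : nat) (gT : finGroupType) (pi : G -> gT).
Hypotheses (n_gt0 : (0 < n)%N) (qpi : quotient_map (Z n) pi) (pgT : p.-group [set: gT]%SET).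

Lemma card_qimg (H : set G) : subgroup H -> #|qimg pi H| = (p ^ lg H n)%N.
Proof.
move=> sH; have /p_natP[k kE] : p.-group (Group (group_set_qimg qpi sH)).
  exact: pgroupS (finset.subsetT _) pgT.
by rewrite /lg (index_qimg qpi) // [#|_|]kE pfactorK.
Qed.

Lemma mem_qimg_zassenhaus m x : (0 < m <= n)%N -> (pi x \in qimg pi (Z m)) <-> Z m x.
Proof.
move=> /andP[m0 mn]; rewrite (mem_qimgE qpi) //; split=> [/asboolP|Zx]; last first.
  by apply/asboolP; exact: prodset_subl.
by apply: prodset_sub => //; exact: zassenhaus_le.
Qed.

Lemma card_qimg_le m (H : set G) : (0 < m <= n)%N -> subgroup H ->
  #|qimg pi H| = (p ^ lg H m * #|qimg pi H :&: qimg pi (Z m)|)%N.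
Proof.
move=> mn sH; have m0 : (0 < m)%N by case/andP: mn.
pose Y := Group (group_set_qimg qpi (sZ m)); pose K := Group (group_set_qimg qpi sH).
have NY y : y \in 'N(Y).
  apply/normP/setP => z; have [x <-] := qm_surj qpi y; have [w wz] := qm_surj qpi z.
  rewrite mem_conjg -wz -(qmV qpi) -(qmJ qpi).
  have E := normal_conjE w x^-1 (nZ m).
  by apply/idP/idP => /(mem_qimg_zassenhaus _ mn) h; apply/(mem_qimg_zassenhaus _ mn); rewrite ?E // -E.
have q' : quotient_map (Z m) (coset Y \o pi).
  split=> [x y|y|x] /=.
  - by rewrite (qmM qpi) morphM.
  - by have [z _ ->] := cosetP y; have [x <-] := qm_surj qpi z; exists x.
  - rewrite -(mem_qimg_zassenhaus _ mn); split=> [cY|xY]; first exact: (coset_idr (NY _) cY).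
    exact: coset_id.
have qE : qimg (coset Y \o pi) H = (K / Y)%g.
  apply/setP => y; apply/qimgP/idP => [[x Hx <-]|].
    by apply: mem_quotient; exact: mem_qimg.
  by case/morphimP => z _ /qimgP[x Hx <-] ->; exists x.
have /p_natP[k kE] : p.-group (K / Y)%g by apply: quotient_pgroup; exact: pgroupS (finset.subsetT _) pgT.
have -> : (p ^ lg H m)%N = #|(K / Y)%g|.
  by rewrite /lg (index_qimg q') // qE kE pfactorK.
have KN : K \subset 'N(Y) by apply/fintype.subsetP => y _; exact: NY.
have -> : #|(K / Y)%g| = #|K : Y|%g by rewrite card_quotient.
by have := LagrangeI K Y; rewrite mulnC => <-.
Qed.

End Quotient.

Lemma index_lg (H : set G) n : (0 < n)%N -> subgroup H ->
  Defs.index (prodset H (Z n)) (Z n) = (p ^ lg H n)%N.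
Proof.
move=> n0 sH; have [gT [pi [qpi pgT]]] := zassenhaus_quotient n0.
by rewrite (index_qimg qpi) // (card_qimg qpi).
Qed.

Lemma lgS (H K : set G) n : (0 < n)%N -> subgroup H -> subgroup K -> H `<=` K -> (lg H n <= lg K n)%N.
Proof.
move=> n0 sH sK HK; have [gT [pi [qpi pgT]]] := zassenhaus_quotient n0.
by rewrite -(leq_exp2l _ _ p_gt1) -!(card_qimg qpi) // subset_leq_card // qimgS.
Qed.

Lemma lg1 (H : set G) : subgroup H -> lg H 1 = 0%N.
Proof.
move=> sH; have [gT [pi [qpi pgT]]] := zassenhaus_quotient (ltn0Sn 0).
apply/eqP; rewrite -(eqn_exp2l _ 0 p_gt1) -(card_qimg qpi) // expn0 eqn_leq.
rewrite (leq_trans (subset_leq_card (_ : qimg pi H \subset [set 1]%SET))) ?cards1 //; last first.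
  apply/fintype.subsetP => _ /qimgP[x _ <-]; rewrite inE; apply/eqP/(qm_ker qpi).
  by rewrite zassenhaus1.
by apply/card_gt0P; exists (pi 1); apply: mem_qimg; exact: subgroup1.
Qed.

Lemma lg_eq (H K : set G) n : prodset H (Z n) = prodset K (Z n) -> lg H n = lg K n.
Proof. by rewrite /lg => ->. Qed.

End LogIndex.

Local Open Scope ring_scope.

(** * Growth *)

Section Estimates.
Variable R : realType.
Implicit Types t s : R.

Lemma sum_geometric_le s n : 0 <= s < 1 -> \sum_(i < n) s ^+ i <= (1 - s)^-1.
Proof.
move=> /andP[s0 s1]; have s1' : 0 < 1 - s by rewrite subr_gt0.
rewrite -[leRHS]mul1r ler_pdivlMr // -opprB mulrN mulrC -subrX1 opprB gerBl.
exact: exprn_ge0.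
Qed.

Lemma sum_words (I : eqType) (gens : seq I) (f : I -> nat) t k :
  \sum_(w <- words gens k) t ^+ weight f w = (\sum_(x <- gens) t ^+ f x) ^+ k.
Proof.
elim: k => [|k IH]; first by rewrite big_seq1 expr0.
rewrite /= big_flatten big_map exprS mulr_suml; apply: eq_bigr => x _.
by rewrite big_map -IH mulr_sumr; apply: eq_bigr => w _; rewrite exprD.
Qed.

(** The series of all words is geometric, its ratio being the series of the letters, and a word of
    weight below [n] contributes at least [t ^+ n]. *)
Lemma size_words_lt (I : eqType) (gens : seq I) (f : I -> nat) t n :
  0 < t < 1 -> \sum_(x <- gens) t ^+ f x < 1 ->
  (size (words_lt gens f n))%:R * t ^+ n <= (1 - \sum_(x <- gens) t ^+ f x)^-1.
Proof.
move=> /andP[t0 t1] s1; set s := \sum_(x <- gens) _ in s1 *.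
have s0 : 0 <= s by apply: sumr_ge0 => x _; rewrite exprn_ge0 // ltW.
apply: le_trans (sum_geometric_le n _); last by rewrite s0.
have -> : \sum_(i < n) s ^+ i = \sum_(w <- flatten [seq words gens k | k <- iota 0 n]) t ^+ weight f w.
  have -> : iota 0 n = index_iota 0 n by rewrite /index_iota subn0.
  rewrite big_flatten big_map big_mkord.
  by apply: eq_bigr => k _; rewrite sum_words.
rewrite /words_lt; elim: (flatten _) => [|w l IH]; first by rewrite big_nil mul0r.
rewrite big_cons /=; case: ltnP => wn /=; last first.
  by apply: le_trans IH _; rewrite lerDr exprn_ge0 // ltW.
rewrite -natr1 mulrDl mul1r addrC lerD //.
by apply: ler_wiXn2l; rewrite ?ltW // ltnW.
Qed.

Lemma sum_exps (gT : finGroupType) p (l : seq (gT * nat)) t :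
  \sum_(e <- exps p l) t ^+ wt l e = \prod_(x <- l) \sum_(i < p) t ^+ (i * x.2).
Proof.
elim: l => [|x l IH]; first by rewrite big_seq1 big_nil expr0.
have E : iota 0 p = index_iota 0 p by rewrite /index_iota subn0.
rewrite /= big_flatten big_map big_cons mulr_suml E big_mkord.
by apply: eq_bigr => i _; rewrite big_map -IH mulr_sumr; apply: eq_bigr => e _; rewrite /= exprD.
Qed.

(** In the series of ordered monomials a letter of weight w contributes a factor at most 1 + p t^w,
    hence at most exp (p t^w). *)
Lemma count_exps_lt (gT : finGroupType) p (l : seq (gT * nat)) t n : 0 < t < 1 ->
  (count (fun e => wt l e < n)%N (exps p l))%:R * t ^+ n <= expR (p%:R * \sum_(x <- l) t ^+ x.2).
Proof.
move=> /andP[t0 t1]; apply: (@le_trans _ _ (\sum_(e <- exps p l) t ^+ wt l e)).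
  elim: (exps p l) => [|e s IH]; first by rewrite big_nil mul0r.
  rewrite big_cons /= natrD mulrDl lerD //; case: ltnP => wn /=; last first.
    by rewrite mul0r exprn_ge0 // ltW.
  by rewrite mul1r; apply: ler_wiXn2l; rewrite ?ltW // ltnW.
rewrite sum_exps mulr_sumr expR_sum; apply: ler_prod => x _.
rewrite sumr_ge0 /=; last by move=> i _; rewrite exprn_ge0 // ltW.
case: p => [|p]; first by rewrite big_ord0 expR_ge0.
apply: le_trans (expR_ge1Dx _); rewrite big_ord_recl mul0n expr0 lerD2l.
apply: (@le_trans _ _ (\sum_(i < p) t ^+ x.2)).
  by apply: ler_sum => i _; rewrite /= mulSn; apply: ler_wiXn2l; rewrite ?ltW // leq_addr.
rewrite sumr_const card_ord -[leLHS]mulr_natl; apply: ler_wpM2r.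
  by rewrite exprn_ge0 // ltW.
by rewrite ler_nat.
Qed.

(** There are at most C u^-(w+1) letters of weight w, so for t < u the sum is dominated by a
    geometric series, independently of [n]. *)
Lemma sum_weights (T : Type) (l : seq (T * nat)) t u (C : R) n : 0 < t < u -> 0 <= C ->
  all (fun x : T * nat => x.2 < n)%N l ->
  (forall v, (v <= n)%N -> (count (fun x : T * nat => x.2 < v)%N l)%:R * u ^+ v <= C) ->
  \sum_(x <- l) t ^+ x.2 <= C / u / (1 - t / u).
Proof.
move=> /andP[t0 tu] C0 al lC; have u0 := lt_trans t0 tu.
have -> : \sum_(x <- l) t ^+ x.2 = \sum_(w < n) (count (fun x : T * nat => x.2 == w) l)%:R * t ^+ w.
  elim: l al {lC} => [|x l IH] /=; first by rewrite big_nil big1 // => w _; rewrite mul0r.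
  move=> /andP[xn /IH{}IH]; rewrite big_cons IH (bigD1 (Ordinal xn)) //=.
  rewrite [RHS](bigD1 (Ordinal xn)) //= eqxx natrD mulrDl mul1r addrA; congr (_ + _).
  by apply: eq_bigr => w wx; rewrite natrD (_ : (x.2 == w) = false) ?add0r // eq_sym; apply/negbTE.
apply: (@le_trans _ _ (\sum_(w < n) C / u * (t / u) ^+ w)).
  apply: ler_sum => w _; apply: (@le_trans _ _ ((count (fun x : T * nat => x.2 < w.+1)%N l)%:R * t ^+ w)).
    apply: ler_wpM2r; first by rewrite exprn_ge0 // ltW.
    rewrite ler_nat; apply: sub_count => x /=.
    by move=> /eqP ->.
  have := lC w.+1 (ltn_ord w); rewrite exprS; set c := _%:R => h.
  have -> : C / u * (t / u) ^+ w = C * t ^+ w / (u * u ^+ w).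
    by rewrite expr_div_n invfM; ring.
  rewrite ler_pdivlMr ?mulr_gt0 ?exprn_gt0 //.
  have -> : c * t ^+ w * (u * u ^+ w) = c * (u * u ^+ w) * t ^+ w by ring.
  by rewrite ler_wpM2r // exprn_ge0 // ltW.
rewrite -mulr_sumr; apply: ler_wpM2l; first by rewrite divr_ge0 // ltW.
by apply: sum_geometric_le; rewrite divr_ge0 ?ltW //= ?ltr_pdivrMr // mul1r.
Qed.

End Estimates.

(** [lam] lies between the roots of X^2 - d X + 1, so growth by the ratio [lam] propagates through
    the recursion; the summand 1 starts it from [c 0 = 0]. *)
Lemma gs_growth (R : realFieldType) (d N : nat) (c : nat -> nat) (lam : R) : 0 < lam ->
  lam ^+ 2 + 1 <= d%:R * lam -> c 0%N = 0%N ->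
  (forall n, (n.+2 <= N)%N -> (1 + d * c n.+1 <= c n.+2 + c n)%N) -> (2 <= N)%N ->
  lam ^+ (N - 2) <= (c N)%:R.
Proof.
move=> lam0 lamd c0 gs N2.
have step m : (m.+1 <= N)%N -> lam * (c m)%:R <= (c m.+1)%:R.
  elim: m => [|m IH] mN; first by rewrite c0 mulr0 ler0n.
  have h1 := IH (ltnW mN).
  have : (1 + d%:R * (c m.+1)%:R <= (c m.+2)%:R + (c m)%:R :> R).
    by have := gs m mN; rewrite -(ler_nat R) !natrD natrM.
  rewrite addrC -lerBrDr -addrA -opprB => h2.
  apply: le_trans (_ : d%:R * (c m.+1)%:R - (c m)%:R <= _); last by rewrite lerBlDr; lra.
  rewrite lerBrDr -(ler_pM2l lam0) mulrDr; apply: le_trans (lerD (lexx _) h1) _.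
  have -> : lam * (lam * (c m.+1)%:R) + (c m.+1)%:R = (lam ^+ 2 + 1) * (c m.+1)%:R by rewrite expr2; ring.
  by rewrite mulrA (mulrC lam) ler_wpM2r.
have L j : (j + 2 <= N)%N -> lam ^+ j <= (c (j + 2)%N)%:R.
  elim: j => [|j IH] jN.
    by rewrite expr0 ler1n; have := gs 0%N jN; rewrite c0 addn0; apply: leq_trans; exact: leq_addr.
  rewrite exprS addSn; apply: le_trans (step _ jN).
  by rewrite ler_pM2l // IH // ltnW.
by have := L (N - 2)%N; rewrite subnK // => /(_ (leqnn _)).
Qed.

Section Growth.
Variables (p : nat) (G : topologicalGroupType).
Hypotheses (p_pr : prime p) (G_prop : pro_p_group p G)
  (Z_open : forall n, (0 < n)%N -> open (zassenhaus G p n)).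
Variables (d : nat) (x : 'I_d -> G).
Hypotheses (d_gt2 : (2 < d)%N)
  (x_gen : forall K : set G, closed_subgroup K -> (forall i, K (x i)) -> K = setT)
  (x_dual : forall c : 'I_d -> 'F_p, exists2 f : G -> 'F_p, chom f & forall i, f (x i) = c i)
  (cls : (G -> G -> 'F_p) -> 'F_p)
  (clsP : forall a b (c : 'F_p), cocycle_pair a -> cocycle_pair b ->
      cls a = c * cls b -> coboundary_pair (fun x y => a x y - c * b x y)).
Local Notation Z := (zassenhaus G p).
Local Notation a n := (lg p [set: G] n).
Let p_gt1 := prime_gt1 p_pr.
Let G_profinite := pro_p_profinite G_prop.

Section Level.
Variables (R : realType) (N : nat) (gT : finGroupType) (pi : G -> gT).
Hypotheses (N_gt1 : (1 < N)%N) (qpi : quotient_map (Z N) pi) (pgT : p.-group [set: gT]%SET).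
Let ZN_open := Z_open (ltnW N_gt1).

Lemma dim_polspace_lower (F : realFieldType) (lam : F) : 0 < lam -> lam ^+ 2 + 1 <= d%:R * lam ->
  lam ^+ (N - 2) <= (\dim (polspace p pi N))%:R.
Proof.
move=> lam0 lamd; apply: (@gs_growth _ d N (fun n => \dim (polspace p pi n))) => //.
  by rewrite (polspace0 qpi) // dimv0.
by move=> n nN; exact: (golod_shafarevich p_pr G_profinite ZN_open qpi nN x_gen x_dual clsP).
Qed.

Lemma zassenhaus_growth_level : (2 ^ (N - 2) <= p ^ a N)%N.
Proof.
have h : (2 : rat) ^+ (N - 2) <= (\dim (polspace p pi N))%:R.
  apply: dim_polspace_lower => //; have : (3%:R <= d%:R :> rat) by rewrite ler_nat.
  by rewrite expr2; lra.
have E : #|gT| = (p ^ a N)%N.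
  rewrite -(card_qimg p_pr G_prop qpi pgT); last exact: subgroupT.
  by rewrite (qimgT qpi) cardsT.
rewrite -E; apply: leq_trans (dim_polspace_le p pi N).
by rewrite -(ler_nat rat) natrX.
Qed.

(** The Jennings basis has [a v] letters of weight below v, so a bound on [a] bounds the number of
    light ordered monomials, hence the dimension by [pbw_bound]. *)
Lemma dim_polspace_upper (t u C : R) : 0 < t < u -> t < 1 -> 0 <= C ->
  (forall v, (0 < v)%N -> (a v)%:R * u ^+ v <= C) ->
  (\dim (polspace p pi N))%:R * t ^+ N <= expR (p%:R * (C / u / (1 - t / u))).
Proof.
move=> tu t1 C0 aC.
have sZ w : subgroup (Z w) by exact: zassenhaus_subgroup.
pose Gs w := Group (group_set_qimg qpi (sZ w)).
have N0 : (0 < N)%N := ltnW N_gt1.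
have Gs_le i j : (0 < i <= j)%N -> Gs j \subset Gs i.
  by move=> /andP[i0 ij]; apply: qimgS; exact: zassenhaus_le.
have Gs_comm i j y z : (0 < i)%N -> (0 < j)%N -> y \in Gs i -> z \in Gs j -> [~ y, z]%g \in Gs (i + j)%N.
  move=> i0 j0 /qimgP[g Zg <-] /qimgP[h Zh <-].
  by rewrite -(qmR qpi); apply: mem_qimg; exact: zassenhaus_commg.
have Gs_exp i y : (0 < i)%N -> y \in Gs i -> (y ^+ p)%g \in Gs (p * i)%N.
  by move=> i0 /qimgP[g Zg <-]; rewrite -(qmX qpi); apply: mem_qimg; exact: zassenhaus_expg.
have GsN : Gs N = 1%G.
  apply/val_inj/trivgP/fintype.subsetP => _ /qimgP[g Zg <-].
  by rewrite inE; apply/eqP/(qm_ker qpi).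
have Gs1 : Gs 1%N = [set: gT]%SET :> {set gT} by rewrite /= zassenhaus1 (qimgT qpi).
have [l [cl al lcard]] := chain_exists p_pr Gs_le Gs_comm Gs_exp GsN (w := 1%N) N0.
have lt_l : all (fun x : gT * nat => x.2 < N)%N l by apply: sub_all al => z /andP[].
have sum_l : \sum_(x <- l) t ^+ x.2 <= C / u / (1 - t / u).
  apply: sum_weights (lt_l) _ => // -[|v] vN.
    by rewrite (eq_count (a2 := pred0)) ?count_pred0 ?mul0r.
  have := lcard v.+1 vN; rewrite Gs1 -(qimgT qpi).
  rewrite (card_qimg_le p_pr G_prop qpi pgT (m := v.+1)) //.
  rewrite (qimgT qpi) finset.setTI => /eqP; rewrite eqn_pmul2r ?cardG_gt0 //; last first.
    by have := cardG_gt0 (Gs v.+1).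
  by rewrite eqn_exp2l // => /eqP <-; exact: aC.
have pbw := pbw_bound p_pr G_profinite ZN_open qpi N0 cl Gs1.
have [t0 _] := andP tu.
apply: (@le_trans _ _ ((count (fun e => wt l e < N)%N (exps p l))%:R * t ^+ N)).
  apply: ler_wpM2r; first by rewrite exprn_ge0 // ltW.
  by rewrite ler_nat; apply: pbw => w y w0 /qimgP[g Zg <-]; exists g.
have t01 : 0 < t < 1 by rewrite t0.
apply: le_trans (@count_exps_lt R gT p l t N t01) _.
by rewrite ler_expR ler_wpM2l.
Qed.

End Level.

(** A crude linear bound, to be set against the logarithmic size of the cyclic quotient by [N]. The
    ratio 2 is admissible since 5 <= 2 d, and the dimension is at most the order of the quotient. *)
Lemma zassenhaus_growth n : (n - 2 <= p * a n)%N.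
Proof.
have [n1|n1] := leqP n 1; first by rewrite (_ : (n - 2 = 0)%N) //; lia.
have [gT [pi [qpi pgT]]] := zassenhaus_quotient p_pr G_prop Z_open (ltnW n1).
rewrite -(@leq_exp2l 2) //; apply: leq_trans (zassenhaus_growth_level n1 qpi pgT) _.
rewrite expnM; case: (a n) => // k; rewrite leq_exp2r //.
by apply: ltnW; exact: ltn_expl.
Qed.

Lemma bernoulli (R : realFieldType) (h : R) n : 0 <= h -> 1 + n%:R * h <= (1 + h) ^+ n.
Proof.
move=> h0; elim: n => [|n IH]; first by rewrite mul0r addr0 expr0.
rewrite exprSr; apply: le_trans (ler_wpM2r _ IH); last by rewrite addr_ge0.
have : 0 <= n%:R * h ^+ 2 by rewrite mulr_ge0 // exprn_ge0.
by rewrite -natr1 expr2; nra.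
Qed.

Section Gap.
Variables (R : realType) (I : eqType) (gens : seq I) (f : I -> nat) (y : I -> G) (K : set G).
Hypotheses (f_gt0 : forall i, i \in gens -> (0 < f i)%N)
  (y_Z : forall i, i \in gens -> Z (f i) (y i))
  (sK : subgroup K) (Ky : forall i, i \in gens -> K (y i))
  (K_gen : forall H, closed_subgroup H -> (forall i, i \in gens -> H (y i)) -> K `<=` H).
Variables (t0 t2 : R).
Hypotheses (t0_gt0 : 0 < t0) (t02 : t0 < t2) (t2_lt1 : t2 < 1)
  (t0_root : t0 ^+ 2 + 1 <= d%:R * t0) (sum_lt1 : \sum_(i <- gens) t2 ^+ f i < 1).

Lemma lg_words n : (0 < n)%N -> (lg p K n <= size (words_lt gens f n))%N.
Proof.
move=> n0; have [gT [pi [qpi pgT]]] := zassenhaus_quotient p_pr G_prop Z_open n0.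
rewrite -(leq_exp2l _ _ p_gt1) -(card_qimg p_pr G_prop qpi pgT) //.
exact: (quotient_word_bound p_pr G_prop (Z_open n0) qpi pgT n0 _ f_gt0 y_Z sK Ky K_gen).
Qed.

(* Otherwise [a n = O(t2 ^ -n)], and for [t0 < t < t2] the dimension of [polspace N] is both [O(t ^ -N)], by
   counting ordered monomials, and at least [t0 ^ -(N - 2)]. *)
Lemma growth_gap C n0 : exists2 n, (n0 <= n)%N & (C * lg p K n < a n)%N.
Proof.
apply: contrapT => nex.
have aK n : (n0 <= n)%N -> (a n <= C * lg p K n)%N.
  by move=> nn; rewrite leqNgt; apply/negP => lt; apply: nex; exists n.
have t2_gt0 := lt_trans t0_gt0 t02.
pose s := \sum_(i <- gens) t2 ^+ f i.
(* The second summand absorbs the levels below [n0], where no bound is assumed. *)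
pose M : R := C%:R / (1 - s) + \sum_(v < n0) (a v)%:R.
have s1 : 0 < 1 - s by rewrite subr_gt0.
have aM v : (0 < v)%N -> (a v)%:R * t2 ^+ v <= M.
  move=> v0; have t2v : t2 ^+ v <= 1 by apply: exprn_ile1; rewrite ltW.
  have t2v0 : 0 <= t2 ^+ v by rewrite exprn_ge0 // ltW.
  have sum0 : 0 <= \sum_(v < n0) (a v)%:R :> R by apply: sumr_ge0 => i _; exact: ler0n.
  have [vn|vn] := ltnP v n0.
    apply: (@le_trans _ _ (a v)%:R); first by rewrite ler_piMr.
    rewrite /M (bigD1 (Ordinal vn)) //= addrCA lerDl addr_ge0 //.
      by rewrite divr_ge0 // ltW.
    by apply: sumr_ge0 => i _; exact: ler0n.
  apply: (@le_trans _ _ (C%:R / (1 - s))); last by rewrite lerDl.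
  apply: (@le_trans _ _ (C%:R * ((size (words_lt gens f v))%:R * t2 ^+ v))).
    rewrite mulrA; apply: ler_wpM2r => //; rewrite -natrM ler_nat.
    by apply: leq_trans (aK v vn) _; rewrite leq_mul2l lg_words ?orbT.
  by apply: ler_wpM2l => //; apply: size_words_lt => //; rewrite t2_gt0.
have M0 : 0 <= M.
  rewrite addr_ge0 //; first by rewrite divr_ge0 // ltW.
  by apply: sumr_ge0 => i _; exact: ler0n.
pose t := (t0 + t2) / 2%:R.
have [tt0 tt2'] := midf_lt t02; rewrite -/t in tt0 tt2'.
have t_gt0 := lt_trans t0_gt0 tt0; have t_lt1 := lt_trans tt2' t2_lt1.
have tt2 : 0 < t < t2 by rewrite t_gt0.
pose E := expR (p%:R * (M / t2 / (1 - t / t2))).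
(* Together the two bounds on the dimension keep [(t / t0) ^+ N] bounded, against Bernoulli's
   inequality. *)
pose h := t / t0 - 1.
have h0 : 0 < h by rewrite subr_gt0 ltr_pdivlMr // mul1r.
have bound N : (1 < N)%N -> 1 + N%:R * h <= E / t0 ^+ 2.
  move=> N1; have [gT [pi [qpi pgT]]] := zassenhaus_quotient p_pr G_prop Z_open (ltnW N1).
  have up := dim_polspace_upper N1 qpi pgT tt2 t_lt1 M0 aM.
  have lo : (t0^-1) ^+ (N - 2) <= (\dim (polspace p pi N))%:R.
    apply: dim_polspace_lower => //; first by rewrite invr_gt0.
    rewrite -(ler_pM2r (exprn_gt0 2 t0_gt0)) mulrDl -exprMn mulVf ?gt_eqF // expr1n mul1r addrC.
    by have -> : d%:R / t0 * t0 ^+ 2 = d%:R * t0 by field; rewrite gt_eqF.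
  apply: le_trans (bernoulli N (ltW h0)) _.
  rewrite /h addrC subrK ler_pdivlMr ?exprn_gt0 //; apply: le_trans _ up.
  have -> : (t / t0) ^+ N * t0 ^+ 2 = (t0^-1) ^+ (N - 2) * t ^+ N.
    have t0N : t0^-1 ^+ N = t0^-1 ^+ (N - 2) * t0^-1 ^+ 2 by rewrite -exprD subnK.
    have tt : t0^-1 ^+ 2 * t0 ^+ 2 = 1 by rewrite -exprMn mulVf ?gt_eqF // expr1n.
    transitivity (t ^+ N * t0^-1 ^+ (N - 2) * (t0^-1 ^+ 2 * t0 ^+ 2)).
      by rewrite exprMn t0N !mulrA.
    by rewrite tt mulr1 mulrC.
  by apply: ler_wpM2r => //; rewrite exprn_ge0 // ltW.
have E0 : 0 <= E / t0 ^+ 2 / h.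
  by rewrite !divr_ge0 ?exprn_ge0 ?expR_ge0 ?ltW.
have := archi_boundP E0; set A := Num.bound _; rewrite ltr_pdivrMr // => lt.
have := bound A.+2 isT; apply/negP; rewrite -ltNge; apply: (lt_trans lt).
by rewrite -2!natr1; have := h0; nra.
Qed.

End Gap.
End Growth.

(* The sum [s t] below satisfies (1 - t) (1 - s t) = 1 - d t + t^2 + (r + 1) t^(k+1), with [d = r + 3], which is
   positive slightly to the right of the smaller root of 1 - d t + t^2. *)
Lemma exists_radius (R : realType) (r k : nat) : exists t0 t2 : R,
  [/\ 0 < t0, t0 < t2, t2 < 1, t0 ^+ 2 + 1 <= r.+3%:R * t0 &
      t2 + r.+1%:R * \sum_(j < k) t2 ^+ j.+1 < 1].
Proof.
pose d : R := r.+3%:R; have dr : d = r.+1%:R + 2 by rewrite /d -2!natr1 -addrA.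
have d3 : 3%:R <= d by rewrite ler_nat.
pose s := Num.sqrt (d ^+ 2 - 4%:R).
have ss : s ^+ 2 = d ^+ 2 - 4%:R by rewrite sqr_sqrtr //; nra.
have s0 : 0 <= s by exact: sqrtr_ge0.
pose t0 := (d - s) / 2%:R.
have q0 : t0 ^+ 2 + 1 = d * t0.
  have : 4%:R * (t0 ^+ 2 + 1 - d * t0) = s ^+ 2 - d ^+ 2 + 4%:R by rewrite /t0; field.
  by rewrite ss => h; nra.
have sd : s < d by nra.
have ds : d - 2%:R < s by nra.
have t0_gt0 : 0 < t0 by rewrite divr_gt0 // subr_gt0.
have t0_lt1 : t0 < 1 by rewrite ltr_pdivrMr // mul1r; lra.
(* Chosen so that [d * e] is below [t0 ^+ k.+1]: moving from t0 to t0 + e lowers the quadratic by at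
   most [d * e], and the term with [t2 ^+ k.+1] outweighs this. The factor [1 - t0] keeps [t2] below
   1. *)
pose e := t0 ^+ k.+1 * (1 - t0) / (2%:R * d).
have tk0 : 0 < t0 ^+ k.+1 by rewrite exprn_gt0.
have tk1 : t0 ^+ k.+1 <= 1 by rewrite exprn_ile1 // ltW.
have d0 : 0 < d by lra.
have de : d * e = t0 ^+ k.+1 * (1 - t0) / 2%:R by rewrite /e; field; rewrite gt_eqF.
have e0 : 0 < e by rewrite divr_gt0 ?mulr_gt0 // subr_gt0.
have e1 : e < 1 - t0 by nra.
exists t0, (t0 + e); split=> //; rewrite ?ltrDl ?q0 //; first by lra.
set t2 := t0 + e.
have t21 : t2 < 1 by rewrite /t2; lra.
have geo : (1 - t2) * \sum_(j < k) t2 ^+ j.+1 = t2 - t2 ^+ k.+1.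
  have -> : \sum_(j < k) t2 ^+ j.+1 = t2 * \sum_(j < k) t2 ^+ j.
    by rewrite mulr_sumr; apply: eq_bigr => j _; rewrite exprS.
  by rewrite mulrCA -opprB mulNr -subrX1 exprS; ring.
have tt : t0 ^+ k.+1 <= t2 ^+ k.+1 by apply: lerXn2r; rewrite ?nnegrE /t2; lra.
rewrite -subr_gt0 -(pmulr_rgt0 _ (_ : 0 < 1 - t2)); last by lra.
have -> : (1 - t2) * (1 - (t2 + r.+1%:R * \sum_(j < k) t2 ^+ j.+1)) =
   t2 ^+ 2 + 1 - d * t2 + r.+1%:R * t2 ^+ k.+1.
  transitivity ((1 - t2) ^+ 2 - r.+1%:R * ((1 - t2) * \sum_(j < k) t2 ^+ j.+1)); first by ring.
  by rewrite geo dr; ring.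
have r1 : 1 <= r.+1%:R :> R by rewrite ler1n.
have : t0 ^+ k.+1 <= r.+1%:R * t2 ^+ k.+1 by nra.
have -> : t2 ^+ 2 + 1 - d * t2 = 2 * t0 * e + e ^+ 2 - d * e.
  have -> : t2 ^+ 2 + 1 - d * t2 = (t0 ^+ 2 + 1) - d * t0 + (2 * t0 * e + e ^+ 2 - d * e) by rewrite /t2; ring.
  by rewrite q0 subrr add0r.
rewrite de; nra.
Qed.

(** * Thin finitely generated subgroups of the kernel *)

Section Truncation.
Variables (p : nat) (G : topologicalGroupType) (r : nat) (tau x2 : G) (xs : 'I_r.+1 -> G).
Hypotheses (p_pr : prime p) (G_prop : pro_p_group p G)
  (Z_open : forall n, (0 < n)%N -> open (zassenhaus G p n)).
Variables (x : 'I_r.+3 -> G).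
Hypotheses
  (x_gen : forall K : set G, closed_subgroup K -> (forall i, K (x i)) -> K = setT)
  (x_dual : forall c : 'I_r.+3 -> 'F_p, exists2 f : G -> 'F_p, chom f & forall i, f (x i) = c i)
  (cls : (G -> G -> 'F_p) -> 'F_p)
  (clsP : forall a b (c : 'F_p), cocycle_pair a -> cocycle_pair b ->
      cls a = c * cls b -> coboundary_pair (fun x y => a x y - c * b x y)).
Let p_gt1 := prime_gt1 p_pr.
Let G_profinite := pro_p_profinite G_prop.

Definition tgen (o : option ('I_r.+1 * nat)) : G :=
  if o is Some ij then iter ij.2 (fun y => [~ y, tau]%g) (xs ij.1) else x2.

Definition tweight (o : option ('I_r.+1 * nat)) : nat := if o is Some ij then ij.2.+1 else 1.

Definition tgens k : seq (option ('I_r.+1 * nat)) :=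
  None :: [seq Some (i, j) | i <- enum 'I_r.+1, j <- iota 0 k].

Definition truncation k := closed_generated [set tgen o | o in [set` tgens k]].

Lemma truncation_closed_subgroup k : closed_subgroup (truncation k).
Proof. exact: closed_generated_closed_subgroup. Qed.

Lemma tgen_truncation k o : o \in tgens k -> truncation k (tgen o).
Proof. by move=> ok; apply: sub_closed_generated; exists o. Qed.

Lemma truncation_min k (H : set G) : closed_subgroup H -> (forall o, o \in tgens k -> H (tgen o)) ->
  truncation k `<=` H.
Proof. by move=> cH Ho; apply: closed_generated_min => // _ [g gk <-]; exact: Ho. Qed.

Lemma mem_tgens k i j : (Some (i, j) \in tgens k) = (j < k)%N.
Proof.
rewrite inE /=; apply/allpairsP/idP => [[[i' j'] /= [_ j'k [_ ->]]]|jk].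
  by rewrite mem_iota in j'k.
by exists (i, j); rewrite /= mem_enum mem_iota.
Qed.

Lemma tgen_zassenhaus o : zassenhaus G p (tweight o) (tgen o).
Proof.
case: o => [[i j]|] //=; elim: j => [|j IH] //=.
by rewrite -addn1; apply: zassenhaus_commg.
Qed.

Lemma truncation_gap (R : realType) k C n0 :
  exists2 n, (n0 <= n)%N & (C * lg p (truncation k) n < lg p [set: G] n)%N.
Proof.
have [t0 [t2 [t0_gt0 t02 t21 q0 s1]]] := exists_radius R r k.
apply: (growth_gap p_pr G_prop Z_open x_gen x_dual clsP (gens := tgens k) (f := tweight) (y := tgen)
  (K := truncation k) _ _ _ _ _ t0_gt0 t02 t21 q0) => //.
- by case=> [[i j]|].
- by move=> o _; exact: tgen_zassenhaus.
- exact: (truncation_closed_subgroup k).1.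
- exact: tgen_truncation.
- exact: truncation_min.
rewrite big_cons /= expr1; set S := \sum_(_ <- _) _.
suff -> : S = r.+1%:R * \sum_(j < k) t2 ^+ j.+1 by [].
have E : iota 0 k = index_iota 0 k by rewrite /index_iota subn0.
rewrite /S big_flatten big_map big_enum /= (eq_bigr (fun=> \sum_(j < k) t2 ^+ j.+1)) => [|i _].
  by rewrite sumr_const card_ord mulr_natl.
by rewrite big_map E big_mkord.
Qed.

End Truncation.

(** * Interpolation *)

Lemma pgroup_between (p : nat) (gT : finGroupType) (A B : {group gT}) a b x : prime p ->
  normal A B -> #|A| = (p ^ a)%N -> #|B| = (p ^ b)%N -> (a <= x <= b)%N ->
  exists X : {group gT}, [/\ A \subset X, X \subset B & #|X| = (p ^ x)%N].
Proof.
move=> p_pr nAB cA cB /andP[ax xb]; have p_gt0 := prime_gt0 p_pr.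
have cBA : #|(B / A)%g| = (p ^ (b - a))%N.
  by rewrite card_quotient ?normal_norm // -divgS ?normal_sub // cA cB expnB // (leq_trans ax).
have pBA : p.-group (B / A)%g by rewrite /pgroup cBA pnatX pnat_id.
have [|Q [QB _ cQ]] := normal_pgroup (r := (x - a)%N) pBA (normal_refl _).
  by rewrite cBA pfactorK // leq_sub2r.
exists (coset A @*^-1 Q)%G; split.
- exact: sub_cosetpre.
- by rewrite sub_cosetpre_quo.
- by rewrite card_cosetpre cA cQ -expnD subnKC.
Qed.

Lemma log_small M : exists n1, forall n p, (n1 <= n)%N -> (1 < p)%N ->
  exists k, (n <= p ^ k)%N /\ (M * k <= n - 2)%N.
Proof.
(* With k the binary logarithm of [n] and m = k / 2, the threshold gives m >= 2 M + 4, so that M (k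
   + 1) + 2 <= (m + 1)^2 <= 2^(2 m) <= 2^k <= n. Base 2 makes it uniform in [p]. *)
exists (2 ^ (4 * M + 10))%N => n p nn p1.
have n0 : (0 < n)%N by apply: leq_trans nn; rewrite expn_gt0.
have /andP[le lt] := trunc_log_bounds (ltnSn 1) n0; set k := trunc_log 2 n in le lt.
exists k.+1; split; first by apply: leq_trans (ltnW lt) _; rewrite leq_exp2r.
have kM : (4 * M + 10 <= k)%N by rewrite -ltnS -(ltn_exp2l _ _ (ltnSn 1)); exact: leq_ltn_trans nn lt.
suff : (M * k.+1 + 2 <= 2 ^ k)%N by move=> h; have := leq_trans h le; lia.
pose m := (k %/ 2)%N; have km : (k <= 2 * m + 1)%N by rewrite /m; lia.
have mk : (m + m <= k)%N by rewrite /m; lia.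
apply: (@leq_trans (2 ^ (m + m))%N); last by rewrite leq_exp2l.
have hm : (m.+1 <= 2 ^ m)%N by exact: ltn_expl.
rewrite expnD; apply: leq_trans (leq_mul hm hm).
have : (2 * M + 4 <= m)%N by lia.
nia.
Qed.

Section Interpolation.
Variables (p : nat) (G : topologicalGroupType) (r : nat) (N : set G) (tau x2 : G) (xs : 'I_r.+1 -> G).
Hypotheses (p_pr : prime p) (G_prop : pro_p_group p G)
  (Z_open : forall n, (0 < n)%N -> open (zassenhaus G p n)).
Variables (x : 'I_r.+3 -> G).
Hypotheses
  (x_gen : forall K : set G, closed_subgroup K -> (forall i, K (x i)) -> K = setT)
  (x_dual : forall c : 'I_r.+3 -> 'F_p, exists2 f : G -> 'F_p, chom f & forall i, f (x i) = c i)
  (cls : (G -> G -> 'F_p) -> 'F_p)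
  (clsP : forall a b (c : 'F_p), cocycle_pair a -> cocycle_pair b ->
      cls a = c * cls b -> coboundary_pair (fun x y => a x y - c * b x y)).
Hypotheses (nN : normal_subgroup N) (cN : closed N) (N_x2 : N x2) (N_xs : forall i, N (xs i))
  (cyc : forall U, open_normal U -> forall x, exists a, prodset N U (x * tau ^- a)%g)
  (N_gen : forall H, closed_subgroup H -> H x2 ->
    (forall i j, H (iter j (fun y => [~ y, tau]%g) (xs i))) -> N `<=` H).
Local Notation Z := (zassenhaus G p).
Local Notation F k := (truncation tau x2 xs k).
Local Notation a n := (lg p [set: G] n).
Local Notation f n := (lg p N n).
Let p_gt1 := prime_gt1 p_pr.
Let G_profinite := pro_p_profinite G_prop.
Let nZ n : normal_subgroup (Z n) := zassenhaus_normal G_profinite p_gt1 n.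
Let sZ n : subgroup (Z n) := (nZ n).1.
Let sN : subgroup N := nN.1.

Lemma truncation_sub k : F k `<=` N.
Proof.
apply: truncation_min; first by [].
case=> [[i j]|] _ //=; elim: j => [|j IH] //=; exact: commg_normall.
Qed.

Lemma closed_prodset_zassenhaus (H : set G) n : closed_subgroup H -> closed_subgroup (prodset H (Z n)).
Proof.
move=> [sH cH]; split; first by apply: subgroup_prodset.
by apply: closed_prodset => //; exact: zassenhaus_closed.
Qed.

(** A commutator with j letters [tau] lies in [Z j.+1], so the generators of [N] left out of [F n]
    are trivial modulo [Z n]. *)
Lemma kernel_truncation n : (0 < n)%N -> N `<=` prodset (F n) (Z n).
Proof.
move=> n0; have cF := truncation_closed_subgroup tau x2 xs n.
apply: N_gen; first exact: closed_prodset_zassenhaus.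
  apply: prodset_subl => //.
  by apply: (@tgen_truncation _ _ tau x2 xs n None); rewrite inE.
move=> i j; have [jn|jn] := ltnP j n.
  apply: prodset_subl => //.
  by apply: (@tgen_truncation _ _ tau x2 xs n (Some (i, j))); rewrite mem_tgens.
apply: prodset_subr; first exact: cF.1.
apply: (zassenhaus_le G_profinite p_gt1 (i := n) (j := j.+1)) => //; first by rewrite leqW.
exact: (tgen_zassenhaus tau x2 xs p_pr (Some (i, j))).
Qed.

(** [tau] generates [G] modulo [N] and [Z n], and its [p ^ k]-th power lies in [Z (p ^ k)]. *)
Lemma cyclic_quotient_bound n k : (0 < n <= p ^ k)%N -> (a n <= f n + k)%N.
Proof.
move=> /andP[n0 nk]; have [gT [pi [qpi pgT]]] := zassenhaus_quotient p_pr G_prop Z_open n0.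
pose A := Group (group_set_qimg qpi sN).
have AT : [set: gT]%SET \subset (A * <[pi tau]>)%g.
  apply/fintype.subsetP => y _; have [g <-] := qm_surj qpi y.
  have [e [m Nm [z Zz E]]] := cyc (conj (Z_open n0) (nZ n)) g.
  have -> : g = (m * z * tau ^+ e)%g by rewrite -E mulgVK.
  rewrite !(qmM qpi) (qmX qpi); move/(qm_ker qpi): Zz => ->; rewrite mulg1.
  by apply: mem_mulg; [exact: mem_qimg|exact: mem_cycle].
have ot : (#[pi tau]%g <= p ^ k)%N.
  apply: dvdn_leq; first by rewrite expn_gt0 prime_gt0.
  rewrite order_dvdn -(qmX qpi); apply/eqP/(qm_ker qpi).
  apply: (zassenhaus_le G_profinite p_gt1 n0 nk).
  exact: zassenhaus_expg_prime.
rewrite -(leq_exp2l _ _ p_gt1) expnD -!(card_qimg p_pr G_prop qpi pgT) //.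
rewrite (qimgT qpi); apply: leq_trans (subset_leq_card AT) _.
have := mul_cardG A <[pi tau]>%G; rewrite -/(#[pi tau]%g) => E.
apply: (@leq_trans (#|A| * #[pi tau]%g)%N); last by rewrite leq_mul2l ot orbT.
by rewrite E leq_pmulr // cardG_gt0.
Qed.

Lemma kernel_large C : exists n1, forall n, (n1 <= n)%N -> (C * (a n - f n) <= a n)%N.
Proof.
have [n1 n1P] := log_small (p * C)%N; exists n1.+1 => n nn.
have [k [nk Ck]] := n1P n p (ltnW nn) p_gt1.
have n0 : (0 < n)%N by exact: leq_ltn_trans nn.
have ub : (a n - f n <= k)%N by rewrite leq_subLR; apply: cyclic_quotient_bound; rewrite n0.
have d3 : (2 < r.+3)%N by [].
have lb : (n - 2 <= p * a n)%N := zassenhaus_growth p_pr G_prop Z_open d3 x_gen x_dual clsP n.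
rewrite -(leq_pmul2l (prime_gt0 p_pr)); apply: leq_trans lb; apply: leq_trans Ck.
by rewrite mulnA leq_mul2l ub orbT.
Qed.

Section Level.
Variables (m : nat) (gT : finGroupType) (pi : G -> gT) (K : set G) (y : nat).
Hypotheses (m_gt0 : (0 < m)%N) (qpi : quotient_map (Z m.+1) pi) (pgT : p.-group [set: gT]%SET)
  (cK : closed_subgroup K) (KN : K `<=` N)
  (lo : (lg p K m.+1 <= y)%N) (hi : (y + f m <= lg p K m + f m.+1)%N).

(* [X] lies between the image of [K] and its product with the central section
   of the image of [N] by the image of [Z m]. *)
Lemma interpolate_level : exists K', [/\ closed_subgroup K', exists k, K' `<=` F k,
  prodset K' (Z m) = prodset K (Z m) & lg p K' m.+1 = y].
Proof.
have sK := cK.1; have mm : (0 < m <= m.+1)%N by rewrite m_gt0 leqnSn.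
pose A := Group (group_set_qimg qpi sK); pose Nb := Group (group_set_qimg qpi sN).
pose Y := Group (group_set_qimg qpi (sZ m)); pose C := (Nb :&: Y)%G.
have AN : A \subset Nb by exact: qimgS.
have cent : C \subset 'C(A).
  apply/centsP => _ /setIP[_ /qimgP[z Zz <-]] _ /qimgP[g Kg <-].
  apply/commgP; rewrite -(qmR qpi); apply/eqP/(qm_ker qpi).
  by rewrite -addn1; exact: zassenhaus_commg.
have cA : #|A| = (p ^ lg p K m * #|A :&: Y|)%N by exact: (card_qimg_le p_pr G_prop qpi pgT mm sK).
have cA' : #|A| = (p ^ lg p K m.+1)%N by exact: (card_qimg p_pr G_prop qpi pgT).
have cN' : (p ^ f m.+1 = p ^ f m * #|C|)%N.
  rewrite -(card_qimg p_pr G_prop qpi pgT) //.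
  exact: (card_qimg_le p_pr G_prop qpi pgT mm sN).
have fm : (f m <= f m.+1)%N.
  by rewrite -(leq_exp2l _ _ p_gt1) cN' leq_pmulr // cardG_gt0.
have cC : #|C| = (p ^ (f m.+1 - f m))%N.
  apply/eqP; rewrite -(@eqn_pmul2l (p ^ f m)) ?expn_gt0 ?prime_gt0 // -cN' -expnD subnKC //.
pose B := (A <*> C)%G.
have BE : B = (A * C)%g :> {set gT} by exact: cent_joinEr.
have cB : #|B| = (p ^ (lg p K m + (f m.+1 - f m)))%N.
  have AC : A :&: C = A :&: Y :> {set gT} by rewrite /= finset.setIA (finset.setIidPl AN).
  have := mul_cardG A C; rewrite -BE AC => E.
  apply/eqP; rewrite -(@eqn_pmul2r #|A :&: Y|) ?cardG_gt0 // -E cA cC mulnAC -expnD.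
  exact: eqxx.
have nAB : normal A B.
  rewrite /normal joing_subl join_subG normG /=.
  exact: cents_norm cent.
have [|X [AX XB cX]] := pgroup_between p_pr nAB cA' cB (x := y).
  by rewrite lo /=; lia.
have XN : X \subset Nb.
  apply: fintype.subset_trans XB _; rewrite join_subG AN; exact: finset.subsetIl.
(* Intersecting the preimage with [F m.+1] keeps the whole image [X], as [F m.+1] and [N] agree
   modulo [Z m.+1], and places the new subgroup in a thin group. *)
exists (F m.+1 `&` pi @^-1` [set` X]).
have cF := truncation_closed_subgroup tau x2 xs m.+1.
have cX' := closed_subgroup_preim qpi (Z_open (ltn0Sn m)) X.
have sK' : subgroup (F m.+1 `&` pi @^-1` [set` X]) by apply: subgroupI; [exact: cF.1|exact: cX'.1].
have qK' : qimg pi (F m.+1 `&` pi @^-1` [set` X]) = X.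
  apply/setP => h; apply/qimgP/idP => [[g [_ Xg] <-] //|Xh].
  have /qimgP[g Ng gh] := fintype.subsetP XN _ Xh.
  have [u Fu [z Zz gE]] := kernel_truncation (ltn0Sn m) Ng.
  have pu : pi u = h.
    by rewrite -gh gE (qmM qpi); move/(qm_ker qpi): Zz => ->; rewrite mulg1.
  by exists u => //; split=> //; rewrite /preimage /= pu.
split.
- by split => //; apply: closedI; [exact: cF.2|exact: cX'.2].
- by exists m.+1; exact: subIsetl.
- have mem_prod (H : set G) g : prodset H (Z m) g <-> pi g \in (qimg pi H * Y)%g.
    split=> [[h Hh [z Zz ->]]|/mulsgP[_ _ /qimgP[h Hh <-] /qimgP[z Zz <-] E]].
      by rewrite (qmM qpi); apply: mem_mulg; exact: mem_qimg.
    exists h => //; exists (h^-1 * g)%g; last by rewrite mulVKg.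
    have -> : (h^-1 * g = z * ((h * z)^-1 * g))%g by rewrite invgM !mulgA mulgV mul1g.
    apply: (subgroupM (sZ m) Zz); apply: (zassenhausS G_profinite p_gt1 m_gt0).
    by apply/(qm_ker qpi); rewrite !(qmM qpi) (qmV qpi) (qmM qpi) E mulVg.
  have XY : (X * Y = A * Y)%g.
    apply/eqP; rewrite finset.eqEsubset; apply/andP; split; last exact: mulSg.
    apply: fintype.subset_trans (mulSg _ XB) _; rewrite BE -mulgA; apply: mulgS.
    by apply: mul_subG => //; exact: finset.subsetIr.
  by apply/seteqP; split=> g /mem_prod; rewrite ?qK' ?XY => h; apply/mem_prod; rewrite ?qK' ?XY.
- apply/eqP; rewrite -(eqn_exp2l _ _ p_gt1) -(card_qimg p_pr G_prop qpi pgT) // qK'.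
  exact/eqP.
Qed.

End Level.

Lemma lg_le (H : set G) m n : (0 < m <= n)%N -> subgroup H -> (lg p H m <= lg p H n)%N.
Proof.
move=> mn sH; have n0 : (0 < n)%N by case/andP: mn => /leq_trans; apply.
have [gT [pi [qpi pgT]]] := zassenhaus_quotient p_pr G_prop Z_open n0.
rewrite -(leq_exp2l _ _ p_gt1) -[leqRHS](card_qimg p_pr G_prop qpi pgT sH).
rewrite (card_qimg_le p_pr G_prop qpi pgT mn sH) leq_pmulr //.
apply/card_gt0P; exists (pi 1%g); rewrite finset.in_setI; apply/andP.
by split; apply: mem_qimg; exact: subgroup1.
Qed.

Section Target.
Variables (R : realType) (alpha : R).
Hypothesis alpha01 : 0 < alpha < 1.

(** Eventually [a <= 2 f], so [truncation_gap] with a constant above 2 / alpha gives the inequality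
    relative to [N]. *)
Lemma next_level (K : set G) n : subgroup K -> (exists k, K `<=` F k) ->
  exists m, (n < m)%N /\ (lg p K m)%:R < alpha * (f m)%:R.
Proof.
move=> sK [k KF]; have [a0 a1] := andP alpha01.
have [n1 n1P] := kernel_large 2.
pose C := Num.bound (2 / alpha).
have CP : 2 / alpha < C%:R by apply: archi_boundP; rewrite divr_ge0 // ltW.
have [m mn lt] := truncation_gap tau x2 xs p_pr G_prop Z_open x_gen x_dual clsP R k C (maxn n.+1 n1).
exists m; split; first exact: leq_trans (leq_maxl _ _) mn.
have m0 : (0 < m)%N by apply: leq_trans mn; rewrite leq_max.
have bK : (lg p K m <= lg p (F k) m)%N.
  apply: (lgS p_pr G_prop Z_open) => //; exact: (truncation_closed_subgroup _ _ _ _).1.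
have af : (a m <= 2 * f m)%N by have := n1P m (leq_trans (leq_maxr _ _) mn); lia.
have lt' : (C * lg p K m < 2 * f m)%N.
  by apply: leq_trans af; apply: leq_ltn_trans lt; rewrite leq_mul2l bK orbT.
have : C%:R * (lg p K m)%:R < 2 * (f m)%:R :> R by rewrite -[2]/(2%:R) -!natrM ltr_nat.
have b0 : 0 <= (lg p K m)%:R :> R by [].
move=> h; rewrite -(ltr_pM2l (_ : 0 < 2 / alpha)); last by rewrite divr_gt0.
apply: (@le_lt_trans _ _ (C%:R * (lg p K m)%:R)); first by rewrite ler_wpM2r // ltW.
by have -> : 2 / alpha * (alpha * (f m)%:R) = 2 * (f m)%:R by field; rewrite gt_eqF.
Qed.

(** [m.+1] is the first level after [n] at which [K] is too small, and the new order there has as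
    exponent the least integer not below the target. *)
Lemma interpolation_step (K : set G) n : closed_subgroup K -> (exists k, K `<=` F k) -> (0 < n)%N ->
  alpha * (f n)%:R <= (lg p K n)%:R ->
  exists K' m, [/\ closed_subgroup K', exists k, K' `<=` F k, (n <= m)%N,
    prodset K' (Z m) = prodset K (Z m) &
    [/\ forall j, (n <= j <= m)%N -> alpha * (f j)%:R <= (lg p K j)%:R,
     alpha * (f m.+1)%:R <= (lg p K' m.+1)%:R & (lg p K' m.+1)%:R <= alpha * (f m.+1)%:R + 1]].
Proof.
move=> cK KF n0 nK; have [a0 a1] := andP alpha01.
have exm : exists m, (n < m)%N && ((lg p K m)%:R < alpha * (f m)%:R).
  by have [m [nm lt]] := next_level n cK.1 KF; exists m; rewrite nm.
have [[|m] /andP[nm lt] mmin] := ex_minnP exm; first by [].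
have before j : (n <= j <= m)%N -> alpha * (f j)%:R <= (lg p K j)%:R.
  move=> /andP[nj jm]; move: nj; rewrite leq_eqVlt => /predU1P[<- //|nj].
  rewrite leNgt; apply/negP => lt'; have := mmin j; rewrite nj lt' /= => /(_ isT).
  by rewrite leqNgt ltnS jm.
have m0 : (0 < m)%N by rewrite ltnS in nm; exact: leq_trans n0 nm.
have ab0 : 0 <= alpha * (f m.+1)%:R by rewrite mulr_ge0 // ltW.
have exy : exists y : nat, alpha * (f m.+1)%:R <= y%:R.
  by exists (Num.bound (alpha * (f m.+1)%:R)); apply: ltW; exact: archi_boundP.
have [y yge ymin] := ex_minnP exy.
have [gT [pi [qpi pgT]]] := zassenhaus_quotient p_pr G_prop Z_open (ltn0Sn m).
have [k KFk] := KF.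
have fm : (f m <= f m.+1)%N by apply: lg_le => //; rewrite m0 leqnSn.
have [|||K' [cK' K'F K'E K'y]] := @interpolate_level m gT pi K y m0 qpi pgT cK.
- by apply: subset_trans KFk (@truncation_sub k).
- by rewrite -(ler_nat R); apply: le_trans yge; exact: ltW.
(* There is room: [K] met the target at level [m], and since alpha < 1 the target rises by at most
   the increment of [f]. Minimality of [y] takes care of the rounding. *)
- rewrite -(subnK fm) addnA leq_add2r; apply: ymin.
  rewrite natrD; apply: le_trans (_ : (lg p K m)%:R + alpha * (f m.+1 - f m)%:R <= _).
    rewrite -{1}(subnK fm) natrD mulrDr addrC lerD2r; apply: before.
    by rewrite -ltnS nm leqnn.
  by rewrite lerD2l ler_piMl // ltW.
exists K', m; split=> //; split=> //; rewrite K'y //.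
case: y yge ymin {K'y} => [|y] yge ymin; first by rewrite addr_ge0.
rewrite -natr1 lerD2r leNgt; apply/negP => /ltW /ymin.
by rewrite ltnn.
Qed.

End Target.

End Interpolation.

(** * Hausdorff dimension *)

Section LimInf.
Variable R : realType.
Implicit Types (u : nat -> R) (c : R).

Lemma limn_einf_sup_inf (v : (\bar R)^nat) : limn_einf v = ereal_sup (range (einfs v)).
Proof. by rewrite limn_einf_lim; apply/cvg_lim => //; exact: cvg_einfs_sup. Qed.

Lemma limn_einf_ge u c n0 : (forall n, (n0 <= n)%N -> c <= u n) ->
  (c%:E <= limn_einf (fun n => (u n)%:E))%E.
Proof.
move=> cu; rewrite limn_einf_sup_inf; apply: le_trans (ereal_sup_ubound _); last first.
  by exists n0.
by apply: le_ereal_inf_tmp => _ [n /= nn <-]; rewrite lee_fin; exact: cu.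
Qed.

Lemma limn_einf_le u c : (forall n0, exists2 n, (n0 <= n)%N & u n <= c) ->
  (limn_einf (fun n => (u n)%:E) <= c%:E)%E.
Proof.
move=> uc; rewrite limn_einf_sup_inf; apply: ge_ereal_sup => _ [n0 _ <-].
have [n nn un] := uc n0; apply: (@le_trans _ _ (u n)%:E); last by rewrite lee_fin.
by apply: ereal_inf_lbound; exists n.
Qed.

Lemma limn_einf_eq u c :
  (forall e, 0 < e -> exists n0, forall n, (n0 <= n)%N -> c - e <= u n) ->
  (forall e, 0 < e -> forall n0, exists2 n, (n0 <= n)%N & u n <= c + e) ->
  limn_einf (fun n => (u n)%:E) = c%:E.
Proof.
move=> lo hi; apply/eqP; rewrite eq_le; apply/andP; split.
  apply/lee_addgt0Pr => e e0; apply: limn_einf_le; exact: hi.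
apply/lee_addgt0Pr => e e0; have [n0 h] := lo e e0.
by rewrite -leeBlDr // -EFinB; exact: limn_einf_ge h.
Qed.

End LimInf.

Section Hausdorff.
Variables (p : nat) (G : topologicalGroupType).
Hypotheses (p_pr : prime p) (G_prop : pro_p_group p G)
  (Z_open : forall n, (0 < n)%N -> open (zassenhaus G p n)).
Variable (R : realType).
Local Notation a n := (lg p [set: G] n).

Lemma logb_expn k : logb R p (p ^ k) = k%:R.
Proof.
have p0 : 0 < p%:R :> R by rewrite ltr0n prime_gt0.
rewrite /logb natrX lnXn // -[ln _ *+ k]mulr_natl mulfK // gt_eqF // ln_gt0 // ltr1n prime_gt1 //.
Qed.

Lemma lg_set1 n : (0 < n)%N -> lg p [set (1 : G)%g] n = 0%N.
Proof.
move=> n0; have [gT [pi [qpi pgT]]] := zassenhaus_quotient p_pr G_prop Z_open n0.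
have s1 := (normal_subgroup1 G).1.
apply/eqP; rewrite -(eqn_exp2l _ 0 (prime_gt1 p_pr)) -(card_qimg p_pr G_prop qpi pgT s1) expn0.
apply/cards1P; exists (pi 1%g); apply/setP => y; rewrite finset.in_set1.
by apply/qimgP/eqP => [[z -> <-]//|->]; exists 1%g.
Qed.

Lemma hdim_lg (H : set G) : subgroup H ->
  hdim R p (fun i => zassenhaus G p i.+1) H = limn_einf (fun i => ((lg p H i.+1)%:R / (a i.+1)%:R : R)%:E).
Proof.
move=> sH; congr limn_einf; apply: funext => i.
rewrite (index_lg p_pr G_prop Z_open) // -[X in Defs.index X](_ : prodset setT (zassenhaus G p i.+1) = _).
  by rewrite (index_lg p_pr G_prop Z_open) ?logb_expn //; exact: subgroupT.
apply/seteqP; split=> // x _; apply: prodset_subl => //.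
by apply: zassenhaus_subgroup; [exact: pro_p_profinite G_prop|exact: prime_gt1].
Qed.

Lemma hdim01 (H : set G) : subgroup H -> exists2 x : R, 0 <= x <= 1 &
  hdim R p (fun i => zassenhaus G p i.+1) H = x%:E.
Proof.
move=> sH; rewrite hdim_lg //; set L := limn_einf _.
have lo : (0 <= L)%E.
  by apply: (@limn_einf_ge _ _ _ 0%N) => n _; rewrite divr_ge0.
have hi : (L <= 1)%E.
  apply: limn_einf_le => n; exists n => //.
  have [->|a0] := posnP (a n.+1); first by rewrite invr0 mulr0.
  rewrite ler_pdivrMr ?ltr0n // mul1r ler_nat.
  by apply: (lgS p_pr G_prop Z_open) => //; exact: subgroupT.
by case: L lo hi => [x| |] // lo hi; exists x => //; rewrite -!lee_fin lo.
Qed.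

End Hausdorff.

(** * A subgroup of prescribed dimension *)

Section FullSpectrum.
Variables (p : nat) (G : topologicalGroupType) (r : nat) (N : set G) (tau x2 : G) (xs : 'I_r.+1 -> G).
Hypotheses (p_pr : prime p) (G_prop : pro_p_group p G)
  (Z_open : forall n, (0 < n)%N -> open (zassenhaus G p n)).
Variables (x : 'I_r.+3 -> G).
Hypotheses
  (x_gen : forall K : set G, closed_subgroup K -> (forall i, K (x i)) -> K = setT)
  (x_dual : forall c : 'I_r.+3 -> 'F_p, exists2 f : G -> 'F_p, chom f & forall i, f (x i) = c i)
  (cls : (G -> G -> 'F_p) -> 'F_p)
  (clsP : forall a b (c : 'F_p), cocycle_pair a -> cocycle_pair b ->
      cls a = c * cls b -> coboundary_pair (fun x y => a x y - c * b x y)).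
Hypotheses (nN : normal_subgroup N) (cN : closed N) (N_x2 : N x2) (N_xs : forall i, N (xs i))
  (cyc : forall U, open_normal U -> forall x, exists a, prodset N U (x * tau ^- a)%g)
  (N_gen : forall H, closed_subgroup H -> H x2 ->
    (forall i j, H (iter j (fun y => [~ y, tau]%g) (xs i))) -> N `<=` H).
Variables (R : realType) (alpha : R).
Hypothesis alpha01 : 0 < alpha < 1.
Local Notation Z := (zassenhaus G p).
Local Notation F k := (truncation tau x2 xs k).
Local Notation a n := (lg p [set: G] n).
Local Notation f n := (lg p N n).
Let p_gt1 := prime_gt1 p_pr.
Let G_profinite := pro_p_profinite G_prop.
Let nZ n : normal_subgroup (Z n) := zassenhaus_normal G_profinite p_gt1 n.
Let sZ n : subgroup (Z n) := (nZ n).1.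

Lemma prodset_zassenhaus_eq (K K' : set G) j m : (0 < j <= m)%N -> subgroup K -> subgroup K' ->
  prodset K (Z m) = prodset K' (Z m) -> prodset K (Z j) = prodset K' (Z j).
Proof.
move=> /andP[j0 jm] sK sK' E.
suff sub (A B : set G) : subgroup A -> subgroup B -> prodset A (Z m) = prodset B (Z m) ->
    prodset A (Z j) `<=` prodset B (Z j).
  by apply/seteqP; split; apply: sub.
move=> sA sB AB; have sBZ : subgroup (prodset B (Z j)) by exact: subgroup_prodset.
apply: prodset_sub => //; last exact: prodset_subr.
apply: subset_trans (prodsetS (@subset_refl _ B) (zassenhaus_le G_profinite p_gt1 j0 jm)).
by rewrite -AB; exact: prodset_subl.
Qed.

Lemma interpolating_sequence : exists (K : nat -> set G) (n : nat -> nat),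
  [/\ forall i, closed_subgroup (K i), n 0%N = 1%N,
    forall i, (n i < n i.+1)%N /\ prodset (K i.+1) (Z (n i.+1).-1) = prodset (K i) (Z (n i.+1).-1),
    forall i j, (n i <= j < n i.+1)%N -> alpha * (f j)%:R <= (lg p (K i) j)%:R &
    forall i, (lg p (K i.+1) (n i.+1))%:R <= alpha * (f (n i.+1))%:R + 1].
Proof.
pose Inv (s : set G * nat) := [/\ closed_subgroup s.1, exists k, s.1 `<=` F k, (0 < s.2)%N &
  alpha * (f s.2)%:R <= (lg p s.1 s.2)%:R].
pose Step (s s' : set G * nat) := [/\ Inv s', (s.2 < s'.2)%N,
  prodset s'.1 (Z s'.2.-1) = prodset s.1 (Z s'.2.-1),
  forall j, (s.2 <= j < s'.2)%N -> alpha * (f j)%:R <= (lg p s.1 j)%:R &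
  (lg p s'.1 s'.2)%:R <= alpha * (f s'.2)%:R + 1].
have ex s : exists s', Inv s -> Step s s'.
  have [[cK KF n0 nK]|nI] := pselect (Inv s); last by exists s.
  have [K' [m [cK' K'F nm K'E [before lo hi]]]] :=
    interpolation_step p_pr G_prop Z_open x_gen x_dual clsP nN cN N_x2 N_xs cyc N_gen alpha01 cK KF n0 nK.
  by exists (K', m.+1).
have [next nextP] := choice ex.
have Inv0 : Inv ([set 1%g], 1%N).
  have s1 : closed_subgroup [set (1 : G)%g].
    have [c1 n1] := @closed_normal_set1 G G_profinite; split; [exact: n1.1|exact: c1].
  split=> //=; last by rewrite !(lg1 p_pr G_prop Z_open) ?mulr0 //; [exact: s1.1|exact: nN.1].
  exists 0%N => _ ->; exact: (truncation_closed_subgroup tau x2 xs 0).1.1.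
pose s i := iter i next ([set 1%g], 1%N).
have InvS i : Inv (s i) by elim: i => //= i IH; have [] := nextP _ IH.
have stepS i : Step (s i) (s i.+1) by exact: nextP.
exists (fun i => (s i).1), (fun i => (s i).2); split=> // [i|i|i j|i].
- by have [] := InvS i.
- by have [] := stepS i.
- by have [_ _ _ h _] := stepS i; exact: h.
- by have [] := stepS i.
Qed.

(** [H] is the intersection of the descending groups [K i] times [Z (n i)]. By compactness it has
    the same image as [K i] modulo [Z (n i)], so it inherits both bounds. *)
Lemma interpolating_subgroup : exists H : set G, [/\ closed_subgroup H,
  forall j, (0 < j)%N -> alpha * (f j)%:R <= (lg p H j)%:R &
  forall n0, exists2 n, (n0 <= n)%N & (lg p H n)%:R <= alpha * (f n)%:R + 1].
Proof.
have [K [n [cK n0 step lo hi]]] := interpolating_sequence.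
have nlt i : (n i < n i.+1)%N := (step i).1.
have ni i : (i < n i)%N by elim: i => [|i IH]; [rewrite n0|exact: leq_ltn_trans IH (nlt i)].
have n_gt0 i : (0 < n i)%N by apply: leq_ltn_trans (ni i).
have KE i j : (0 < j < n i.+1)%N -> prodset (K i.+1) (Z j) = prodset (K i) (Z j).
  move=> /andP[j0 jn]; apply: (@prodset_zassenhaus_eq _ _ _ (n i.+1).-1).
  - by rewrite j0 /= -ltnS prednK.
  - exact: (cK _).1.
  - exact: (cK _).1.
  - exact: (step i).2.
have nmono i l : (n i <= n (i + l))%N.
  by elim: l => [|l IH]; rewrite ?addn0 // addnS; exact: leq_trans IH (ltnW (nlt _)).
have KEl i l j : (0 < j <= n i)%N -> prodset (K (i + l)%N) (Z j) = prodset (K i) (Z j).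
  move=> /andP[j0 ji]; elim: l => [|l IH]; first by rewrite addn0.
  rewrite addnS KE // j0 /=; apply: leq_ltn_trans (nlt _); exact: leq_trans ji (nmono _ _).
pose C i := prodset (K i) (Z (n i)).
have cC i : closed_subgroup (C i).
  split; first by apply: subgroup_prodset; [exact: (cK i).1|exact: nZ].
  by apply: closed_prodset => //; [exact: (cK i).2|exact: zassenhaus_closed].
have Cdec i l : C (i + l)%N `<=` C i.
  elim: l => [|l IH]; first by rewrite addn0.
  apply: subset_trans IH; rewrite addnS /C; apply: prodset_sub.
  - exact: (cC _).1.
  - rewrite -KE; last by rewrite n_gt0 nlt.
    by apply: prodset_subl; exact: sZ.
  - move=> z Zz; apply: (prodset_subr (cK _).1).
    by apply: (zassenhaus_le G_profinite p_gt1 (n_gt0 _) (ltnW (nlt _))) Zz.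
pose H : set G := \bigcap_i C i.
have cH : closed_subgroup H.
  split; last by apply: closed_bigI => i _; exact: (cC i).2.
  split=> [i _|u v Hu Hv i _]; first exact: (cC i).1.1.
  by apply: (cC i).1.2; [exact: Hu|exact: Hv].
have HE i : prodset H (Z (n i)) = C i.
  apply/seteqP; split.
    apply: prodset_sub; [exact: (cC i).1|by move=> h; apply|].
    by apply: prodset_subr; exact: (cK i).1.
  apply: prodset_sub; [by apply: subgroup_prodset; [exact: cH.1|exact: nZ]| |].
    2: by apply: prodset_subr; exact: cH.1.
  move=> g Kg.
  (* Candidates for an element of [H] congruent to [g] modulo [Z (n i)]: closed, nonempty and
     decreasing in [l], so they share a point. *)
  pose E l := C (i + l)%N `&` [set z | Z (n i) (g^-1 * z)%g].
  have cE l : closed (E l).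
    apply: closedI; first exact: (cC _).2.
    apply: (@closed_preim _ (fun z => g^-1 * z)%g (Z (n i))); first exact: continuousMl.
    exact: zassenhaus_closed.
  have Ene l : exists z, E l z.
    have : prodset (K (i + l)%N) (Z (n i)) g.
      by rewrite KEl ?n_gt0 ?leqnn //; apply: prodset_subl.
    move=> [h Kh [z Zz gE]]; exists h; split; first by apply: prodset_subl.
    by rewrite /= gE invgM mulgVK; apply: subgroupV.
  have [z Ez] : exists z, forall l, E l z.
    apply: contrapT => nz.
    have [|||||_ [l _ <-] E0] := @compact_directed _ [set E l | l in setT] set0 (profinite_compact G_profinite).
    - by exists (E 0%N), 0%N.
    - by move=> _ [l _ <-].
    - move=> _ _ [l _ <-] [l' _ <-]; exists (E (l + l')%N); first by exists (l + l')%N.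
      move=> z [Cz Zz]; split; split=> //; move: Cz.
        by rewrite addnA; exact: Cdec.
      by rewrite (addnC l) addnA; exact: Cdec.
    - exact: open0.
    - by move=> z Ez; apply: nz; exists z => l; apply: Ez; exists l.
    - by have [z /E0] := Ene l.
  exists z.
    move=> l _; have [li|il] := leqP l i.
      have [Cz _] := Ez 0%N; rewrite addn0 -(subnKC li) in Cz.
      exact: Cdec Cz.
    by have [Cz _] := Ez (l - i)%N; rewrite subnKC // ltnW in Cz.
  exists (z^-1 * g)%g; last by rewrite mulVKg.
  by rewrite -[(z^-1 * g)%g]invgK invgM invgK; apply: subgroupV => //; exact: (Ez 0%N).2.
have lgH i j : (0 < j <= n i)%N -> lg p H j = lg p (K i) j.
  move=> ji; apply: lg_eq; apply: (prodset_zassenhaus_eq ji cH.1 (cK i).1); exact: HE.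
exists H; split=> //.
  move=> j j0; have [i ij] : exists i, (n i <= j < n i.+1)%N.
    have exi : exists i, (j < n i)%N by exists j; exact: ni.
    have [[|i] ji imin] := ex_minnP exi; first by rewrite n0 ltnNge j0 in ji.
    exists i; rewrite ji andbT leqNgt; apply/negP => /imin.
    by rewrite ltnn.
  have [_ /ltnW jn] := andP ij.
  rewrite (lgH i.+1) ?j0 //; have -> : lg p (K i.+1) j = lg p (K i) j.
    by apply: lg_eq; apply: KE; rewrite j0; case/andP: ij.
  exact: lo.
move=> n1; exists (n n1.+1); first by apply: ltnW; apply: ltn_trans (ni _).
by rewrite (lgH n1.+1) ?n_gt0 ?leqnn.
Qed.

Lemma hausdorff_dimension_attained : exists2 H : set G, closed_subgroup H &
  hdim R p (fun i => Z i.+1) H = alpha%:E.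
Proof.
have [H [cH lo hi]] := interpolating_subgroup; exists H => //.
rewrite (hdim_lg p_pr G_prop Z_open) //; last exact: cH.1.
have [a0 a1] := andP alpha01.
have large := kernel_large p_pr G_prop Z_open x_gen x_dual clsP nN cyc.
have d3 : (2 < r.+3)%N by [].
have grow n : (n - 2 <= p * a n)%N := zassenhaus_growth p_pr G_prop Z_open d3 x_gen x_dual clsP n.
have a_gt0 n : (2 < n)%N -> (0 < a n)%N.
  by move=> n2; have := grow n; case: (a n) => //; rewrite muln0; lia.
have fa n : (0 < n)%N -> (f n <= a n)%N.
  by move=> n1; apply: (lgS p_pr G_prop Z_open) => //; exact: nN.1.
apply: limn_einf_eq => e e0.
  (* With C >= 1 / e, [kernel_large] gives f >= (1 - e) a eventually, so comparing with [G] instead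
     of [N] costs at most e. *)
  pose C := Num.bound e^-1; have CP : e^-1 < C%:R by apply: archi_boundP; rewrite invr_ge0 ltW.
  have eC : 1 <= e * C%:R by rewrite -ler_pdivrMl // mulr1 ltW.
  have [n1 n1P] := large C; exists (maxn n1 2) => n; rewrite geq_max => /andP[nn n2].
  have an : 0 < (a n.+1)%:R :> R by rewrite ltr0n a_gt0.
  rewrite ler_pdivlMr // mulrBl; apply: le_trans (lo n.+1 (ltn0Sn n)).
  have fan := fa n.+1 (ltn0Sn n).
  rewrite -(subnK fan) natrD; have := n1P n.+1 (leqW nn).
  rewrite -{2}(subnK fan) -(ler_nat R) natrM natrD.
  have : 0 <= (a n.+1 - f n.+1)%:R :> R by [].
  move: (a n.+1 - f n.+1)%:R (f n.+1)%:R => u v u0 Cu; nra.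
move=> n0; pose C := Num.bound e^-1.
have CP : e^-1 < C%:R by apply: archi_boundP; rewrite invr_ge0 ltW.
have eC : 1 <= e * C%:R by rewrite -ler_pdivrMl // mulr1 ltW.
(* Beyond this level linear growth gives a >= C >= 1 / e, which absorbs the rounding error 1. *)
have [[|n] nn hn] := hi (n0 + p * C + 3)%N; first by rewrite addn3 in nn.
exists n; first by rewrite -ltnS; apply: leq_trans nn; lia.
have aC : (C <= a n.+1)%N.
  by rewrite -(leq_pmul2l (prime_gt0 p_pr)); apply: leq_trans (grow n.+1); lia.
have an : 0 < (a n.+1)%:R :> R by rewrite ltr0n a_gt0 //; lia.
rewrite ler_pdivrMr // mulrDl; apply: le_trans hn _.
apply: lerD; first by rewrite ler_pM2l // ler_nat fa.
by apply: le_trans eC _; rewrite ler_pM2l // ler_nat.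
Qed.

End FullSpectrum.

Theorem theorem1p5 (R : realType) (p : nat) (D : topologicalGroupType)
    (p_prime : prime p) (D_demushkin : demushkin p D)
    (D_nonsoluble : ~ soluble D) :
  hspec R p (fun i : nat => zassenhaus D p i.+1) =
  [set x%:E | x in [set x : R | 0 <= x <= 1]].
Proof.
have [D_prop [_ finH1 H2 _]] := D_demushkin.
have D_profinite := pro_p_profinite D_prop.
have Z_open n : (0 < n)%N -> open (zassenhaus D p n).
  by apply: zassenhaus_open => //; exact: finite_chom.
have [cls clsP] := cohomology2_dim1 D_profinite H2.
have [r [N [tau [x2 [xs [[[nN cN] N_x2 N_xs cyc N_gen] [x [x_gen x_dual]]]]]]]] :=
  demushkin_structure p_prime D_demushkin D_nonsoluble.
have d3 : (2 < r.+3)%N by [].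
apply/seteqP; split=> [_ [H cH <-]|_ [alpha /andP[a0 a1] <-]].
  by have [y y01 ->] := hdim01 p_prime D_prop Z_open R cH.1; exists y.
move: a0; rewrite le_eqVlt => /predU1P[<-|a0].
  have [c1 n1] := closed_normal_set1 D_profinite.
  exists [set 1%g]; first by split; [exact: n1.1|].
  rewrite (hdim_lg p_prime D_prop Z_open R n1.1).
  have u0 n : (lg p [set (1 : D)%g] n.+1)%:R / (lg p [set: D] n.+1)%:R = 0 :> R.
    by rewrite (lg_set1 p_prime D_prop Z_open) // mul0r.
  apply: limn_einf_eq => e e0.
    by exists 0%N => n _; rewrite u0 sub0r oppr_le0 ltW.
  by move=> n; exists n => //; rewrite u0 add0r ltW.
move: a1; rewrite le_eqVlt => /predU1P[->|a1].
  exists [set: D]; first by split; [exact: subgroupT|exact: closedT].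
  rewrite (hdim_lg p_prime D_prop Z_open R) //.
  (* At the first level the ratio is 0 / 0, which is 0 by convention; the growth bound makes the
     denominator nonzero from level 3 on. *)
  have u1 n : (1 < n)%N -> (lg p [set: D] n.+1)%:R / (lg p [set: D] n.+1)%:R = 1 :> R.
    move=> n1; rewrite divff // pnatr_eq0 -lt0n.
    have := zassenhaus_growth p_prime D_prop Z_open d3 x_gen x_dual clsP n.+1.
    by case: (lg _ _ _) => //; rewrite muln0; lia.
  apply: limn_einf_eq => e e0.
    by exists 2%N => n n1; rewrite u1 // gerBl ltW.
  by move=> n; exists (maxn n 2); rewrite ?leq_maxl // u1 ?leq_max ?orbT // lerDl ltW.
have [|H cH HE] := hausdorff_dimension_attained p_prime D_prop Z_open x_gen x_dual clsP nN cN N_x2 N_xs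
  cyc N_gen (alpha := alpha).
  by rewrite a0.
by exists H.
Qed.
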